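(* Let $\mathcal H$ be a finite-dimensional Hilbert space with pairwise commuting Hermitian charges $\hat L_0=H,\hat L_1,\dots,\hat L_{q-1}$. Two states $\rho,\sigma$ on $\mathcal H$ satisfy $S(\rho)=S(\sigma)$ and ${\operatorname{Tr}}(\hat L_k\rho)={\operatorname{Tr}}(\hat L_k\sigma)$ for all $k=0,\dots,q-1$ if and only if there exist, for each $n$, an ancillary Hilbert space $\mathcal K_n$ with $\log\dim\mathcal K_n=o(n)$, Hermitian charges $\hat L_{k}'$ on $\mathcal K_n$ ($k=0,\dots,q-1$) with $\|\hat L_k'\|_\infty=o(n)$, states $\omega_n,\omega_n'$ on $\mathcal K_n$, and a unitary $U_n$ on $\mathcal H^{\otimes n}\otimes\mathcal K_n$ with $[U_n,\hat L_k^{(n)}+\hat L_k']=0$ for all $k$, such that $$\lim_{n\to\infty}\big\|U_n(\rho^{\otimes n}\otimes\omega_n')U_n^\dagger-\sigma^{\otimes n}\otimes\omega_n\big\|_1=0.$$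
   Context: $S$ is the von Neumann entropy. The $n$-copy charges are $\hat L_k^{(n)}=\sum_{i=1}^n\mathbb{I}^{\otimes(i-1)}\otimes\hat L_k\otimes\mathbb{I}^{\otimes(n-i)}$ on $\mathcal H^{\otimes n}$, and in $\hat L_k^{(n)}+\hat L_k'$ each term is understood tensored with the identity on the other factor. $\|X\|_1={\operatorname{Tr}}\sqrt{X^\dagger X}$ and $\|X\|_\infty$ is the operator norm. *)

(* Defs.v *)
(* classical reals (Stdlib Reals) with a hand-rolled complex
   field and square matrices represented as functions nat -> nat -> C,
   together with an explicit dimension argument. Only the entries with
   indices < dimension are meaningful. *)
From Stdlib Require Import Reals Lra Lia List ClassicalEpsilon.
Open Scope R_scope.

Record C := mkC { Re : R ; Im : R }.
Definition C0 : C := mkC 0 0.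
Definition C1 : C := mkC 1 0.
Definition RtoC (x : R) : C := mkC x 0.
Definition Cadd (z w : C) : C := mkC (Re z + Re w) (Im z + Im w).
Definition Copp (z : C) : C := mkC (- Re z) (- Im z).
Definition Csub (z w : C) : C := Cadd z (Copp w).
Definition Cmul (z w : C) : C :=
  mkC (Re z * Re w - Im z * Im w) (Re z * Im w + Im z * Re w).
Definition Cconj (z : C) : C := mkC (Re z) (- Im z).
Definition Cmod (z : C) : R := sqrt (Re z * Re z + Im z * Im z).

Fixpoint Csum (n : nat) (f : nat -> C) : C :=
  match n with O => C0 | S n' => Cadd (Csum n' f) (f n') end.
Fixpoint Rsum (n : nat) (f : nat -> R) : R :=
  match n with O => 0 | S n' => Rsum n' f + f n' end.

Definition Mat := nat -> nat -> C.
Definition Vec := nat -> C.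

Definition meq (n : nat) (A B : Mat) : Prop :=
  forall i j, (i < n)%nat -> (j < n)%nat -> A i j = B i j.

Definition mzero : Mat := fun _ _ => C0.
Definition mid : Mat := fun i j => if Nat.eqb i j then C1 else C0.
Definition madd (A B : Mat) : Mat := fun i j => Cadd (A i j) (B i j).
Definition msub (A B : Mat) : Mat := fun i j => Csub (A i j) (B i j).
Definition mmul (n : nat) (A B : Mat) : Mat :=
  fun i j => Csum n (fun k => Cmul (A i k) (B k j)).
Definition adj (A : Mat) : Mat := fun i j => Cconj (A j i).
Definition trace (n : nat) (A : Mat) : C := Csum n (fun i => A i i).
Definition diagm (l : nat -> R) : Mat :=
  fun i j => if Nat.eqb i j then RtoC (l i) else C0.
Fixpoint msum (m : nat) (F : nat -> Mat) : Mat :=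
  match m with O => mzero | S m' => madd (msum m' F) (F m') end.

Definition mapply (n : nat) (A : Mat) (v : Vec) : Vec :=
  fun i => Csum n (fun j => Cmul (A i j) (v j)).
Definition vnorm (n : nat) (v : Vec) : R :=
  sqrt (Rsum n (fun i => Re (Cmul (Cconj (v i)) (v i)))).

Definition kron (m n : nat) (A B : Mat) : Mat :=
  fun i j => Cmul (A (i / n)%nat (j / n)%nat) (B (i mod n)%nat (j mod n)%nat).

Fixpoint kpow (d n : nat) (A : Mat) : Mat :=
  match n with
  | O => mid
  | S n' => kron d (d ^ n') A (kpow d n' A)
  end.

Definition ncopy (d n : nat) (L : Mat) : Mat :=
  msum n (fun i => kron (d ^ i) (d * d ^ (n - 1 - i)) mid
                        (kron d (d ^ (n - 1 - i)) L mid)).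

Definition hermitian (n : nat) (A : Mat) : Prop := meq n A (adj A).
Definition unitary (n : nat) (U : Mat) : Prop :=
  meq n (mmul n (adj U) U) mid /\ meq n (mmul n U (adj U)) mid.
Definition psd (n : nat) (A : Mat) : Prop :=
  hermitian n A /\
  forall v : Vec, 0 <= Re (Csum n (fun i => Cmul (Cconj (v i)) (mapply n A v i))).
Definition is_state (n : nat) (rho : Mat) : Prop :=
  psd n rho /\ trace n rho = C1.
Definition commute (n : nat) (A B : Mat) : Prop :=
  meq n (mmul n A B) (mmul n B A).

Definition msqrt (n : nat) (M : Mat) : Mat :=
  epsilon (inhabits mzero) (fun P => psd n P /\ meq n (mmul n P P) M).

Definition trace_norm (n : nat) (X : Mat) : R :=
  Re (trace n (msqrt n (mmul n (adj X) X))).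

Definition op_norm (n : nat) (X : Mat) : R :=
  epsilon (inhabits 0)
    (is_lub (fun t => exists v : Vec, vnorm n v <= 1 /\ t = vnorm n (mapply n X v))).

Definition eigvals (n : nat) (A : Mat) : nat -> R :=
  epsilon (inhabits (fun _ => 0))
    (fun l => exists V, unitary n V /\ meq n A (mmul n (mmul n V (diagm l)) (adj V))).

Definition eta (x : R) : R := if Req_EM_T x 0 then 0 else x * ln x.

Definition vN_entropy (n : nat) (rho : Mat) : R :=
  - Rsum n (fun i => eta (eigvals n rho i)).

Definition little_o_n (f : nat -> R) : Prop :=
  forall eps, 0 < eps -> exists N, forall n, (N <= n)%nat -> Rabs (f n) <= eps * INR n.

(* Main.v *)
(* Forward direction.  In a joint eigenbasis of the charges, each of the n-copy
   states is, up to a small nuclear norm, a mixture of at most e^(n(S+t)) typical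
   eigenvectors with weights at most e^(-n(S-t)), compressed to the window of basis
   vectors whose charges are o(n) away from the common mean.  Adjoin the embezzling
   state with eigenvalues proportional to 1/i, i <= N = e^(kn).  Counting eigenvalues
   above a threshold shows that the k-th largest eigenvalue of the product is at most
   1/(k H_N), H_N being the harmonic sum, and since the traces are almost 1 these
   bounds are almost attained: both sorted spectra are close to the same sequence, so
   a unitary V of the window carries one state close to the other.  To conserve the
   charges, adjoin a reference frame whose basis vectors are labelled by charge
   vectors, prepared in a flat superposition over a set of labels that is almost
   invariant under differences of window charges, and apply V inside every sector of
   total charge.  Such a set is found among the iterated sumsets of these differences,
   because their size grows only polynomially.

   Backward direction.  Charges are compared through their conserved expectations.
   The entropy cannot increase: the image of a typical subspace has too small a
   dimension to carry the final state if that state has larger entropy; exchanging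
   the two states gives equality. *)
Require Defs.

(** Two demands on the frame pull against each other: its label set must barely change under window
    differences, and its charges must stay [o(n)]. Labels made of about J differences have charge of
    order J times the window width, so the window must be much narrower than n/J, yet wide enough
    for Chebyshev. Taking J^8 of order n and a window of half-width n/J^2 meets both. The charge of
    a word depends only on its letter counts, so the labels number at most a constant times a fixed
    power of J, and growth by a factor 1+eps at each of J steps is impossible. The matching error is
    of order 2nt/H_N, where t is the typicality slack and H_N is at least kn; hence t must be small
    against k, and k tends to 0 only at the end, by a diagonal choice of precision. Frame and
    embezzling state come back almost unchanged, so a single state serves as both omega_n and
    omega_n'. Closeness is expressed by explicit sums of rank-one operators, which behave well under
    sums, unitaries and tensor products; the singular value decomposition identifies the best such
    sum with the trace norm. *)

Module AsymptoticEquivalence.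
From mathcomp Require Import all_boot all_order all_algebra.
From mathcomp Require Import boolp complex reals sequences exp.
From mathcomp Require Import zify ring lra.
Set Implicit Arguments. Unset Strict Implicit. Unset Printing Implicit Defensive.
Import Order.TTheory GRing.Theory Num.Theory.
Local Open Scope ring_scope.

(** * Operators on finite index sets *)

Section Kernels.
Variable R : rcfType.
Local Notation C := (complex R).
Local Notation "x %:C" := (real_complex R x) (at level 1, format "x %:C").
Local Notation cj := (@conjc R).
Implicit Types I J K L : finType.

Definition abs2 (z : C) : R := complex.Re z ^+ 2 + complex.Im z ^+ 2.

Lemma abs2_ge0 z : 0 <= abs2 z.
Proof. by rewrite addr_ge0 ?sqr_ge0. Qed.
Lemma abs2M z w : abs2 (z * w) = abs2 z * abs2 w.
Proof. by case: z w => [a b] [c e]; rewrite /abs2 /=; ring. Qed.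
Lemma abs2J z : abs2 (cj z) = abs2 z.
Proof. by case: z => a b; rewrite /abs2 /= sqrrN. Qed.
Lemma abs2N z : abs2 (- z) = abs2 z.
Proof. by case: z => a b; rewrite /abs2 /= !sqrrN. Qed.
Lemma abs2_real (x : R) : abs2 x%:C = x ^+ 2.
Proof. by rewrite /abs2 /=; ring. Qed.
Lemma abs20 : abs2 0 = 0.
Proof. by rewrite /abs2 /= expr0n addr0. Qed.
Lemma abs21 : abs2 1 = 1.
Proof. by rewrite /abs2 /= expr1n expr0n addr0. Qed.
Lemma abs2_eq0 z : abs2 z = 0 -> z = 0.
Proof.
case: z => a b; rewrite /abs2 /= => /eqP.
by rewrite paddr_eq0 ?sqr_ge0 // !sqrf_eq0 => /andP[/eqP-> /eqP->].
Qed.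
Lemma mulJc z : cj z * z = (abs2 z)%:C.
Proof. by case: z => a b; apply/eqP; rewrite eq_complex /abs2 /=; apply/andP; split; apply/eqP; ring. Qed.
Lemma mulcJ z : z * cj z = (abs2 z)%:C.
Proof. by rewrite mulrC mulJc. Qed.
Lemma cjM z w : cj (z * w) = cj z * cj w.
Proof. exact: rmorphM. Qed.
Lemma cj_sum (T : Type) (s : seq T) (P : pred T) (F : T -> C) :
  cj (\sum_(i <- s | P i) F i) = \sum_(i <- s | P i) cj (F i).
Proof. exact: rmorph_sum. Qed.
Lemma rcM (x y : R) : (x * y)%:C = x%:C * y%:C.
Proof. exact: rmorphM. Qed.
Lemma ReD (z w : C) : complex.Re (z + w) = complex.Re z + complex.Re w.
Proof. by case: z w => [a b] [c e]. Qed.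
Lemma ReN (z : C) : complex.Re (- z) = - complex.Re z.
Proof. by case: z => [a b]. Qed.
Lemma Re_realM (x : R) z : complex.Re (x%:C * z) = x * complex.Re z.
Proof. by case: z => [a b] /=; ring. Qed.
Lemma Re_sum (T : Type) (s : seq T) (P : pred T) (F : T -> C) :
  complex.Re (\sum_(i <- s | P i) F i) = \sum_(i <- s | P i) complex.Re (F i).
Proof. by apply: (big_morph _ ReD). Qed.
Lemma ReMle z w : `|complex.Re (z * w)| <= (abs2 z + abs2 w) / 2.
Proof.
case: z w => [a b] [c e]; rewrite /abs2 /= ler_norml; apply/andP; split;
by have := sqr_ge0 (a + c); have := sqr_ge0 (a - c); have := sqr_ge0 (b + e);
   have := sqr_ge0 (b - e); nra.
Qed.
Lemma abs2D_le z w : abs2 (z + w) <= 2 * (abs2 z + abs2 w).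
Proof.
case: z w => [a b] [c e]; rewrite /abs2 /=.
by have := sqr_ge0 (a - c); have := sqr_ge0 (b - e); nra.
Qed.

Definition norm2 I (v : I -> C) : R := \sum_x abs2 (v x).
Definition dot I (a b : I -> C) : C := \sum_x cj (a x) * b x.
Definition app I (A : I -> I -> C) (v : I -> C) : I -> C :=
  fun x => \sum_y A x y * v y.
Definition outer I (a b : I -> C) : I -> I -> C := fun x y => a x * cj (b y).
Definition opmul I (A B : I -> I -> C) : I -> I -> C :=
  fun x y => \sum_z A x z * B z y.
Definition opadj I (A : I -> I -> C) : I -> I -> C := fun x y => cj (A y x).
Definition opid I : I -> I -> C := fun x y => (x == y)%:R.
Definition optr I (A : I -> I -> C) : C := \sum_x A x x.
Definition optens I J (A : I -> I -> C) (B : J -> J -> C) :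
  I * J -> I * J -> C := fun x y => A x.1 y.1 * B x.2 y.2.
Definition vtens I J (a : I -> C) (b : J -> C) : I * J -> C :=
  fun x => a x.1 * b x.2.
Definition opunitary I (U : I -> I -> C) : Prop :=
  opmul (opadj U) U = @opid I /\ opmul U (opadj U) = @opid I.
Definition opconj I (U X : I -> I -> C) := opmul (opmul U X) (opadj U).
(** States and diagonalised observables are carried in this form: a unitary acts on the vectors
    alone ([opconj_mix]), and errors split into changes of weights and changes of vectors. The
    vectors need not be orthogonal. *)
Definition mix I J (w : J -> R) (v : J -> I -> C) : I -> I -> C :=
  fun x y => \sum_j (w j)%:C * outer (v j) (v j) x y.
(** Orthonormality and completeness are both recorded, so that Parseval and unitarity follow without
    counting dimensions. *)
Definition onb I (v : I -> I -> C) : Prop :=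
  (forall i j, dot (v i) (v j) = (i == j)%:R) /\
  (forall x y, \sum_j v j x * cj (v j y) = (x == y)%:R).

Lemma op_ext I (A B : I -> I -> C) : (forall x y, A x y = B x y) -> A = B.
Proof. by move=> h; apply/funext => x; apply/funext => y. Qed.

Lemma norm2_ge0 I (v : I -> C) : 0 <= norm2 v.
Proof. by apply: sumr_ge0 => x _; apply: abs2_ge0. Qed.
Lemma norm2_dot I (v : I -> C) : (norm2 v)%:C = dot v v.
Proof. by rewrite rmorph_sum; apply: eq_bigr => x _; rewrite mulJc. Qed.
Lemma norm2_Re I (v : I -> C) : norm2 v = complex.Re (dot v v).
Proof. by rewrite -norm2_dot. Qed.
Lemma norm2Z I (c : C) (v : I -> C) : norm2 (fun x => c * v x) = abs2 c * norm2 v.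
Proof. by rewrite /norm2 mulr_sumr; apply: eq_bigr => x _; rewrite abs2M. Qed.
Lemma norm2N I (v : I -> C) : norm2 (fun x => - v x) = norm2 v.
Proof. by apply: eq_bigr => x _; rewrite abs2N. Qed.
Lemma norm2D_le I (v w : I -> C) :
  norm2 (fun x => v x + w x) <= 2 * (norm2 v + norm2 w).
Proof.
rewrite /norm2 -big_split mulr_sumr; apply: ler_sum => x _; exact: abs2D_le.
Qed.
Lemma norm2_eq0 I (v : I -> C) : norm2 v = 0 -> forall x, v x = 0.
Proof.
move=> /eqP; rewrite psumr_eq0 => [|x _]; last exact: abs2_ge0.
by move=> /allP h x; apply/abs2_eq0/eqP/h; rewrite mem_index_enum.
Qed.
Lemma norm2_vtens I J (a : I -> C) (b : J -> C) :
  norm2 (vtens a b) = norm2 a * norm2 b.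
Proof.
rewrite /norm2 big_distrlr /= pair_bigA /=; apply: eq_bigr => -[x y] _.
by rewrite /vtens abs2M.
Qed.

Lemma sum_delta I (F : I -> C) x : \sum_y (x == y)%:R * F y = F x.
Proof.
rewrite (bigD1 x) //= eqxx mul1r big1 ?addr0 // => y ne.
by rewrite eq_sym (negbTE ne) mul0r.
Qed.
Lemma sum_deltar I (F : I -> C) x : \sum_y F y * (y == x)%:R = F x.
Proof.
by rewrite -[RHS]sum_delta; apply: eq_bigr => y _; rewrite mulrC eq_sym.
Qed.

Lemma opmulA I (A B D : I -> I -> C) : opmul A (opmul B D) = opmul (opmul A B) D.
Proof.
apply: op_ext => x y; rewrite /opmul.
under eq_bigr do rewrite mulr_sumr.
rewrite exchange_big /=; apply: eq_bigr => z _.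
by rewrite mulr_suml; apply: eq_bigr => w _; rewrite mulrA.
Qed.
Lemma opmul1l I (A : I -> I -> C) : opmul (@opid I) A = A.
Proof. by apply: op_ext => x y; rewrite /opmul /opid sum_delta. Qed.
Lemma opmul1r I (A : I -> I -> C) : opmul A (@opid I) = A.
Proof. by apply: op_ext => x y; rewrite /opmul /opid sum_deltar. Qed.
Lemma opadjK I (A : I -> I -> C) : opadj (opadj A) = A.
Proof. by apply: op_ext => x y; apply: conjcK. Qed.
Lemma opadjM I (A B : I -> I -> C) : opadj (opmul A B) = opmul (opadj B) (opadj A).
Proof.
apply: op_ext => x y; rewrite /opadj /opmul cj_sum.
by apply: eq_bigr => z _; rewrite cjM mulrC.
Qed.
Lemma optrC I (A B : I -> I -> C) : optr (opmul A B) = optr (opmul B A).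
Proof.
rewrite /optr /opmul exchange_big /=; apply: eq_bigr => x _.
by apply: eq_bigr => y _; rewrite mulrC.
Qed.
Lemma opunitary_adj I (U : I -> I -> C) : opunitary U -> opunitary (opadj U).
Proof. by case=> u1 u2; split; rewrite opadjK. Qed.
Lemma opconjM I (U V X : I -> I -> C) : opconj (opmul U V) X = opconj U (opconj V X).
Proof. by rewrite /opconj opadjM !opmulA. Qed.

Lemma dotJ I (a b : I -> C) : dot a b = cj (dot b a).
Proof.
rewrite /dot cj_sum; apply: eq_bigr => x _.
by rewrite cjM conjcK mulrC.
Qed.
Lemma dot_app I (A : I -> I -> C) (a b : I -> C) : dot a (app A b) = dot (app (opadj A) a) b.
Proof.
rewrite /dot /app /opadj.
under eq_bigr do rewrite mulr_sumr.
rewrite exchange_big /=; apply: eq_bigr => y _.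
rewrite cj_sum mulr_suml; apply: eq_bigr => x _.
by rewrite cjM conjcK; ring.
Qed.
Lemma app_mul I (A B : I -> I -> C) v : app (opmul A B) v = app A (app B v).
Proof.
apply/funext => x; rewrite /app /opmul.
under eq_bigr do rewrite mulr_suml.
rewrite exchange_big /=; apply: eq_bigr => y _.
by rewrite mulr_sumr; apply: eq_bigr => z _; rewrite mulrA.
Qed.
Lemma app_id I (v : I -> C) : app (@opid I) v = v.
Proof. by apply/funext => x; rewrite /app /opid sum_delta. Qed.
Lemma dot_unitary I (U : I -> I -> C) a b :
  opunitary U -> dot (app U a) (app U b) = dot a b.
Proof. by case=> u1 _; rewrite dot_app -app_mul u1 app_id. Qed.
Lemma norm2_unitary I (U : I -> I -> C) v : opunitary U -> norm2 (app U v) = norm2 v.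
Proof. by move=> u; rewrite !norm2_Re dot_unitary. Qed.
Lemma dot_vtens I J (a c : I -> C) (b e : J -> C) :
  dot (vtens a b) (vtens c e) = dot a c * dot b e.
Proof.
rewrite /dot big_distrlr /= pair_bigA /=; apply: eq_bigr => -[x y] _.
by rewrite /vtens /= cjM; ring.
Qed.

Lemma opconj_outer I (U : I -> I -> C) a b :
  opconj U (outer a b) = outer (app U a) (app U b).
Proof.
apply: op_ext => x y; rewrite /opconj /opmul /outer /app /opadj cj_sum mulr_sumr.
apply: eq_bigr => z _; rewrite cjM !mulr_suml; apply: eq_bigr => w _; ring.
Qed.
Lemma opconjE I (U X : I -> I -> C) x y :
  opconj U X x y = \sum_z \sum_w U x z * X z w * cj (U y w).
Proof.
rewrite /opconj /opmul /opadj exchange_big /=; apply: eq_bigr => w _.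
by rewrite mulr_suml.
Qed.
Lemma opconj_sum I (T : Type) (s : seq T) (P : pred T) (U : I -> I -> C) (F : T -> I -> I -> C) :
  opconj U (fun x y => \sum_(j <- s | P j) F j x y) =
  fun x y => \sum_(j <- s | P j) opconj U (F j) x y.
Proof.
apply: op_ext => x y; rewrite opconjE.
under [RHS]eq_bigr do rewrite opconjE.
rewrite [RHS]exchange_big /=; apply: eq_bigr => z _.
rewrite [RHS]exchange_big /=; apply: eq_bigr => w _.
by rewrite mulr_sumr mulr_suml.
Qed.
Lemma opconjZ I (U X : I -> I -> C) (c : C) :
  opconj U (fun x y => c * X x y) = fun x y => c * opconj U X x y.
Proof.
apply: op_ext => x y; rewrite !opconjE mulr_sumr; apply: eq_bigr => z _.
by rewrite mulr_sumr; apply: eq_bigr => w _; ring.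
Qed.
Lemma opconj_mix I J (U : I -> I -> C) (w : J -> R) v :
  opconj U (mix w v) = mix w (fun j => app U (v j)).
Proof.
rewrite /mix opconj_sum; apply: op_ext => x y; apply: eq_bigr => j _.
by rewrite opconjZ opconj_outer.
Qed.
Lemma mix_tens I J K L (w : J -> R) (v : J -> I -> C) (u : K -> R) (g : K -> L -> C) :
  optens (mix w v) (mix u g) =
  mix (fun jk : J * K => w jk.1 * u jk.2) (fun jk => vtens (v jk.1) (g jk.2)).
Proof.
apply: op_ext => x y; rewrite /optens /mix big_distrlr /= pair_bigA /=.
by apply: eq_bigr => -[j k] _; rewrite /outer /vtens /= !(cjM, rcM); ring.
Qed.
Lemma onb_tens I J (v : I -> I -> C) (w : J -> J -> C) :
  onb v -> onb w -> onb (fun jk : I * J => vtens (v jk.1) (w jk.2)).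
Proof.
move=> [v1 v2] [w1 w2]; split=> [[i j] [k l]|[i j] [k l]] /=.
  by rewrite dot_vtens v1 w1 -natrM mulnb xpair_eqE.
rewrite xpair_eqE -mulnb natrM -v2 -w2 big_distrlr /= pair_bigA /=.
by apply: eq_bigr => -[x y] _; rewrite /vtens /= cjM; ring.
Qed.
Lemma onb_norm2 I (v : I -> I -> C) j : onb v -> norm2 (v j) = 1.
Proof. by case=> h _; rewrite norm2_Re h eqxx. Qed.
Lemma parseval I (v : I -> I -> C) (a : I -> C) :
  onb v -> \sum_j abs2 (dot (v j) a) = norm2 a.
Proof.
case=> _ h; apply: complexI; rewrite rmorph_sum /=.
under eq_bigr => j _ do rewrite -mulJc -dotJ /dot big_distrlr /=.
rewrite exchange_big /= norm2_dot; apply: eq_bigr => x _.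
rewrite exchange_big /= -(sum_delta a x) mulr_sumr; apply: eq_bigr => y _.
rewrite -h mulr_suml mulr_sumr; apply: eq_bigr => j _; ring.
Qed.
Lemma onb_unitary I (v : I -> I -> C) : onb v -> opunitary (fun x j => v j x).
Proof.
case=> h1 h2; split; apply: op_ext => x y; rewrite /opmul /opadj /opid.
  by rewrite -h1.
by rewrite -h2.
Qed.
Lemma app_onb_unitary I (v : I -> I -> C) (U : I -> I -> C) :
  opunitary U -> onb v -> onb (fun j => app U (v j)).
Proof.
move=> u [h1 h2]; split=> [i j|x y]; first by rewrite dot_unitary.
have := congr1 (fun A => A x y) u.2; rewrite /opid => <-.
transitivity (opconj U (@opid I) x y); last by rewrite /opconj opmul1r.
have -> : @opid I = mix (fun _ => 1) v.
  by apply: op_ext => z w; rewrite /opid -h2; apply: eq_bigr => j _; rewrite mul1r.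
by rewrite opconj_mix; apply: eq_bigr => j _; rewrite mul1r.
Qed.
Lemma optens_mul I J (A A' : I -> I -> C) (B B' : J -> J -> C) :
  opmul (optens A B) (optens A' B') = optens (opmul A A') (opmul B B').
Proof.
apply: op_ext => -[x i] [y j]; rewrite /opmul /optens big_distrlr /= pair_bigA /=.
by apply: eq_bigr => -[z k] _ /=; ring.
Qed.
Lemma opadj_id I : opadj (@opid I) = @opid I.
Proof. by apply: op_ext => x y; rewrite /opadj /opid conjc_nat eq_sym. Qed.
Lemma opconj_tens I J (U X : I -> I -> C) (V Y : J -> J -> C) :
  opconj (optens U V) (optens X Y) = optens (opconj U X) (opconj V Y).
Proof.
have -> : opconj (optens U V) (optens X Y) =
   opmul (opmul (optens U V) (optens X Y)) (optens (opadj U) (opadj V)).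
  by congr opmul; apply: op_ext => x y; rewrite /opadj /optens cjM.
by rewrite !optens_mul.
Qed.
Lemma opadj_tens I J (U : I -> I -> C) (V : J -> J -> C) :
  opadj (optens U V) = optens (opadj U) (opadj V).
Proof. by apply: op_ext => x y; rewrite /opadj /optens cjM. Qed.
Lemma optens_id I J : optens (@opid I) (@opid J) = @opid _.
Proof. by apply: op_ext => -[x i] [y j]; rewrite /optens /opid xpair_eqE -mulnb natrM. Qed.
Lemma optens_unitary I J (U : I -> I -> C) (V : J -> J -> C) :
  opunitary U -> opunitary V -> opunitary (optens U V).
Proof. by move=> [u1 u2] [v1 v2]; split; rewrite opadj_tens optens_mul ?u1 ?u2 ?v1 ?v2 optens_id. Qed.
Lemma opid_unitary I : opunitary (@opid I).
Proof. by split; rewrite opadj_id opmul1l. Qed.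
Lemma opconj_id I (X : I -> I -> C) : opconj (@opid I) X = X.
Proof. by rewrite /opconj opadj_id opmul1l opmul1r. Qed.
Lemma opconj_opid I (U : I -> I -> C) : opunitary U -> opconj U (@opid I) = @opid I.
Proof. by case=> _ u2; rewrite /opconj opmul1r. Qed.
Lemma opconjK I (U X : I -> I -> C) : opunitary U -> opconj (opadj U) (opconj U X) = X.
Proof. by move=> [u1 _]; rewrite -opconjM u1 opconj_id. Qed.
Lemma opconj_mul I (U X Y : I -> I -> C) : opunitary U ->
  opmul (opconj U X) (opconj U Y) = opconj U (opmul X Y).
Proof.
move=> [u1 _]; rewrite /opconj !opmulA -(opmulA _ (opadj U) U) u1 opmul1r.
by rewrite -!opmulA.
Qed.
Lemma opconj_mulr I (W U : I -> I -> C) : opunitary W ->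
  opmul (opconj W U) W = opmul W U.
Proof. by move=> [w1 _]; rewrite /opconj -opmulA w1 opmul1r. Qed.
Lemma opconj_adj I (U X : I -> I -> C) : opadj (opconj U X) = opconj U (opadj X).
Proof. by rewrite /opconj !opadjM opadjK opmulA. Qed.
Lemma opconj_unitary I (U V : I -> I -> C) : opunitary U -> opunitary V -> opunitary (opconj U V).
Proof. by move=> u [v1 v2]; split; rewrite opconj_adj opconj_mul // ?v1 ?v2 opconj_opid. Qed.
Lemma opconjB I (U X Y : I -> I -> C) x y :
  opconj U (fun x y => X x y - Y x y) x y = opconj U X x y - opconj U Y x y.
Proof.
rewrite !opconjE -sumrB; apply: eq_bigr => z _.
by rewrite -sumrB; apply: eq_bigr => v _ /=; ring.
Qed.
End Kernels.

(** * Nuclear norm bounds and the spectral theorem *)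

Section Nuclear.
Local Open Scope sesquilinear_scope.
Variable R : rcfType.
Local Notation C := (complex R).
Local Notation "x %:C" := (real_complex R x) (at level 1, format "x %:C").
Local Notation cj := (@conjc R).
Implicit Types I J K L : finType.

(* AM-GM form of a nuclear norm bound: rescaling [a, b] to [t a, b / t] makes [norm2 a + norm2 b] as small as twice the product of the norms. *)
Definition nuc I (X : I -> I -> C) (e : R) : Prop :=
  exists s : seq ((I -> C) * (I -> C)),
    X = (fun x y => \sum_(p <- s) outer p.1 p.2 x y) /\
    \sum_(p <- s) (norm2 p.1 + norm2 p.2) <= 2 * e.

Lemma nuc_le I (X : I -> I -> C) e f : nuc X e -> e <= f -> nuc X f.
Proof. by case=> s [-> h] le; exists s; split=> //; apply: le_trans h _; lra. Qed.
Lemma nuc_ext I (X Y : I -> I -> C) e : nuc X e -> (forall x y, X x y = Y x y) -> nuc Y e.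
Proof. by move=> h /op_ext <-. Qed.
Lemma nuc0 I : nuc (fun _ _ : I => 0) 0.
Proof.
exists [::]; split; last by rewrite big_nil mulr0.
by apply: op_ext => x y; rewrite big_nil.
Qed.
Lemma nucD I (X Y : I -> I -> C) e f :
  nuc X e -> nuc Y f -> nuc (fun x y => X x y + Y x y) (e + f).
Proof.
case=> s [-> hs] [t [-> ht]]; exists (s ++ t); split.
  by apply: op_ext => x y; rewrite big_cat.
by rewrite big_cat /= mulrDr lerD.
Qed.
Lemma nuc_sum I (T : Type) (s : seq T) (P : pred T) (F : T -> I -> I -> C) (e : T -> R) :
  (forall t, P t -> nuc (F t) (e t)) ->
  nuc (fun x y => \sum_(t <- s | P t) F t x y) (\sum_(t <- s | P t) e t).
Proof.
move=> h; elim: s => [|t s IH].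
  rewrite big_nil; have -> : (fun x y => \sum_(t <- [::] | P t) F t x y) = (fun _ _ : I => 0).
    by apply: op_ext => x y; rewrite big_nil.
  exact: nuc0.
rewrite big_cons.
have -> : (fun x y => \sum_(t <- t :: s | P t) F t x y) =
   (if P t then fun x y => F t x y + \sum_(t <- s | P t) F t x y
    else fun x y => \sum_(t <- s | P t) F t x y).
  by apply: op_ext => x y; rewrite big_cons; case: (P t).
by case Pt: (P t) => //; apply: nucD => //; apply: h.
Qed.
(** The scale [t] stays free: when [a] is short and [b] has length at most one, a large [t] makes
    the bound small. The coefficient is split as [Num.sg c] times the square roots of [|c| * t] and
    [|c| / t]. *)
Lemma nuc_outer I (c t : R) (a b : I -> C) : 0 < t ->
  nuc (fun x y => c%:C * outer a b x y) (`|c| * (t * norm2 a + t^-1 * norm2 b) / 2).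
Proof.
move=> t0; pose r := Num.sqrt (`|c| * t); pose r' := Num.sqrt (`|c| / t).
have rr : r ^+ 2 = `|c| * t by rewrite sqr_sqrtr // mulr_ge0 // ltW.
have rr' : r' ^+ 2 = `|c| / t by rewrite sqr_sqrtr // mulr_ge0 // invr_ge0 ltW.
exists [:: ((fun x => (Num.sg c * r)%:C * a x), (fun x => r'%:C * b x))]; split.
  apply: op_ext => x y; rewrite big_seq1 /outer /= cjM conjc_real.
  rewrite [c in LHS](_ : c = Num.sg c * r * r'); first by rewrite !rcM; ring.
  rewrite -mulrA /r /r' -sqrtrM ?mulr_ge0 // 1?ltW //.
  rewrite (_ : `|c| * t * (`|c| / t) = `|c| ^+ 2); last by field; rewrite gt_eqF.
  by rewrite sqrtr_sqr normr_id -numEsg.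
rewrite big_seq1 /= !norm2Z !abs2_real exprMn rr rr' sqr_sg.
have [->|c0] := eqVneq c 0; first by rewrite normr0 /=; lra.
by rewrite /= le_eqVlt; apply/orP; left; apply/eqP; field; rewrite gt_eqF.
Qed.
Lemma nucN I (X : I -> I -> C) e : nuc X e -> nuc (fun x y => - X x y) e.
Proof.
case=> s [-> h]; exists [seq ((fun x => - p.1 x), p.2) | p <- s]; split.
  apply: op_ext => x y; rewrite big_map -sumrN; apply: eq_bigr => p _.
  by rewrite /outer mulNr.
by rewrite big_map; under eq_bigr do rewrite /= norm2N.
Qed.
Lemma nucB I (X Y Z : I -> I -> C) e f :
  nuc (fun x y => X x y - Y x y) e -> nuc (fun x y => Y x y - Z x y) f ->
  nuc (fun x y => X x y - Z x y) (e + f).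
Proof.
by move=> h1 h2; apply: nuc_ext (nucD h1 h2) _ => x y; rewrite addrA subrK.
Qed.
Lemma nuc_sym I (X Y : I -> I -> C) e :
  nuc (fun x y => X x y - Y x y) e -> nuc (fun x y => Y x y - X x y) e.
Proof. by move=> /nucN h; apply: nuc_ext h _ => x y; rewrite opprB. Qed.
Lemma nuc_conj I (U X : I -> I -> C) e : opunitary U -> nuc X e -> nuc (opconj U X) e.
Proof.
move=> u [s [-> h]]; exists [seq (app U p.1, app U p.2) | p <- s]; split.
  rewrite opconj_sum; apply: op_ext => x y; rewrite big_map.
  by apply: eq_bigr => p _; rewrite opconj_outer.
by rewrite big_map; under eq_bigr do rewrite /= !norm2_unitary //.
Qed.
(** A second factor of trace one costs nothing: each rank-one term is tensored with every [g k], the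
    square root of its weight going to either side. *)
Lemma nuc_tens I J K (X : I -> I -> C) e (w : K -> R) (g : K -> J -> C) :
  (forall k, 0 <= w k) -> \sum_k w k = 1 -> (forall k, norm2 (g k) = 1) ->
  nuc X e -> nuc (optens X (mix w g)) e.
Proof.
move=> w0 w1 g1 [s [-> h]].
pose sq k := (Num.sqrt (w k))%:C.
exists [seq (vtens p.1 (fun x => sq k * g k x), vtens p.2 (fun x => sq k * g k x)) | p <- s, k <- enum K].
split.
  apply: op_ext => x y; rewrite /optens /mix big_allpairs_dep /= mulr_suml.
  apply: eq_bigr => p _; rewrite mulr_sumr big_enum /=; apply: eq_bigr => k _.
  rewrite /outer /vtens /= !cjM conjc_real.
  rewrite -[w k in LHS]sqr_sqrtr // expr2 rcM /sq; ring.
rewrite big_allpairs_dep /=; apply: le_trans h; rewrite le_eqVlt; apply/orP; left; apply/eqP.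
apply: eq_bigr => p _; rewrite big_enum /=.
under eq_bigr do rewrite !norm2_vtens !norm2Z g1 abs2_real sqr_sqrtr // mulr1 -mulrDl mulrC.
by rewrite -mulr_suml w1 mul1r.
Qed.

(** Duality of trace norm and operator norm in one-sided form: the bound on the form of [B] is
    applied to every rank-one term of [X]. *)
Lemma nuc_trace I (B X : I -> I -> C) (k e : R) : 0 <= k ->
  (forall a b, complex.Re (dot b (app B a)) <= k * (norm2 a + norm2 b) / 2) ->
  nuc X e -> complex.Re (optr (opmul B X)) <= k * e.
Proof.
move=> k0 hB [s [-> h]].
have -> : optr (opmul B (fun x y => \sum_(p <- s) outer p.1 p.2 x y)) =
    \sum_(p <- s) dot p.2 (app B p.1).
  rewrite /optr /opmul /dot /app.
  under eq_bigr do under eq_bigr do rewrite mulr_sumr.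
  under eq_bigr do rewrite exchange_big /=.
  rewrite exchange_big /=; apply: eq_bigr => p _; apply: eq_bigr => x _.
  by rewrite mulr_sumr; apply: eq_bigr => y _; rewrite /outer; ring.
rewrite Re_sum; apply: (@le_trans _ _ (k / 2 * \sum_(p <- s) (norm2 p.1 + norm2 p.2))).
  by rewrite mulr_sumr; apply: ler_sum => p _; apply: le_trans (hB _ _) _; lra.
have := ler_wpM2l (divr_ge0 k0 (ler0n R 2)) h; lra.
Qed.

Lemma bessel I J (w : J -> I -> C) (a : I -> C) :
  (forall j, norm2 (w j) = 1 \/ w j = fun=> 0) ->
  (forall j k, j != k -> dot (w j) (w k) = 0) ->
  \sum_j abs2 (dot (w j) a) <= norm2 a.
Proof.
move=> w1 w2; pose c j := dot (w j) a; pose p x := \sum_j c j * w j x.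
have dotp b : dot p b = \sum_j cj (c j) * dot (w j) b.
  rewrite /dot /p; under eq_bigr do rewrite cj_sum mulr_suml.
  rewrite exchange_big; apply: eq_bigr => j _ /=.
  by rewrite mulr_sumr; apply: eq_bigr => x _; rewrite cjM; ring.
have pa : dot p a = (\sum_j abs2 (c j))%:C.
  by rewrite dotp rmorph_sum; apply: eq_bigr => j _; rewrite mulJc.
have pp : dot p p = (\sum_j abs2 (c j))%:C.
  rewrite dotp rmorph_sum; apply: eq_bigr => j _ /=; rewrite -mulJc; congr (_ * _).
  rewrite dotJ dotp cj_sum (bigD1 j) //= big1 ?addr0 => [|k kj]; last first.
    by rewrite w2 // mulr0 conjc0.
  rewrite cjM conjcK -dotJ; case: (w1 j) => [h|h].
    by rewrite -norm2_dot h mulr1.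
  by rewrite /c h /dot big1 ?mul0r // => x _; rewrite conjc0 mul0r.
have := norm2_ge0 (fun x => a x - p x).
suff -> : norm2 (fun x => a x - p x) = norm2 a - \sum_j abs2 (c j) by rewrite subr_ge0.
apply: complexI; rewrite rmorphB /= !norm2_dot.
have ap : dot a p = (\sum_j abs2 (c j))%:C by rewrite dotJ pa conjc_real.
have -> : dot (fun x => a x - p x) (fun x => a x - p x) =
   dot a a - dot a p - dot p a + dot p p.
  rewrite /dot -!sumrB -big_split; apply: eq_bigr => x _ /=.
  by rewrite [cj (_ - _)](rmorphB (@conjc R)) /=; ring.
by rewrite ap pa pp subrK; congr (_ - _); rewrite -norm2_dot.
Qed.

Definition opherm I (A : I -> I -> C) := forall x y, A x y = cj (A y x).
Definition oppsd I (A : I -> I -> C) :=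
  opherm A /\ forall v, 0 <= complex.Re (dot v (app A v)).

Lemma app_mix I J (w : J -> R) (v : J -> I -> C) a x :
  app (mix w v) a x = \sum_j (w j)%:C * dot (v j) a * v j x.
Proof.
rewrite /app /mix; under eq_bigr do rewrite mulr_suml.
rewrite exchange_big; apply: eq_bigr => j _ /=; rewrite /outer.
by rewrite /dot mulr_sumr mulr_suml; apply: eq_bigr => y _; ring.
Qed.
Lemma app_mix_onb I (w : I -> R) (v : I -> I -> C) j :
  onb v -> app (mix w v) (v j) = fun x => (w j)%:C * v j x.
Proof.
case=> h _; apply/funext => x; rewrite app_mix (bigD1 j) //= h eqxx mulr1.
by rewrite big1 ?addr0 // => k ne; rewrite h (negbTE ne) mulr0 mul0r.
Qed.
Lemma dot_mix I J (w : J -> R) (v : J -> I -> C) a :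
  dot a (app (mix w v) a) = (\sum_j w j * abs2 (dot (v j) a))%:C.
Proof.
rewrite [LHS]/dot; under eq_bigr do rewrite app_mix mulr_sumr.
rewrite exchange_big rmorph_sum; apply: eq_bigr => j _ /=; rewrite rcM -mulcJ.
transitivity ((w j)%:C * dot (v j) a * dot a (v j)); last by rewrite [dot a _]dotJ; ring.
by rewrite [dot a _]/dot mulr_sumr; apply: eq_bigr => x _; ring.
Qed.
Lemma mix_herm I J (w : J -> R) (v : J -> I -> C) : opherm (mix w v).
Proof.
move=> x y; rewrite /mix cj_sum; apply: eq_bigr => j _.
by rewrite /outer !cjM conjc_real conjcK; ring.
Qed.
Lemma mix_psd I J (w : J -> R) (v : J -> I -> C) :
  (forall j, 0 <= w j) -> oppsd (mix w v).
Proof.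
move=> w0; split=> [|a]; first exact: mix_herm.
by rewrite dot_mix /=; apply: sumr_ge0 => j _; rewrite mulr_ge0 ?abs2_ge0.
Qed.
Lemma optr_mix I J (w : J -> R) (v : J -> I -> C) :
  optr (mix w v) = (\sum_j w j * norm2 (v j))%:C.
Proof.
rewrite /optr /mix exchange_big rmorph_sum; apply: eq_bigr => j _ /=.
by rewrite rcM norm2_dot /dot mulr_sumr; apply: eq_bigr => x _; rewrite /outer; ring.
Qed.
Lemma mix_mul I (w u : I -> R) (v : I -> I -> C) : onb v ->
  opmul (mix w v) (mix u v) = mix (fun j => w j * u j) v.
Proof.
case=> h _; apply: op_ext => x y; rewrite /opmul /mix.
under eq_bigr do rewrite big_distrlr /=.
rewrite exchange_big; apply: eq_bigr => j _ /=; rewrite exchange_big (bigD1 j) //= [X in _ + X]big1 => [|k ne].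
  rewrite addr0; transitivity ((w j)%:C * (u j)%:C * outer (v j) (v j) x y * dot (v j) (v j)).
    by rewrite /outer /dot mulr_sumr; apply: eq_bigr => z _; ring.
  by rewrite h eqxx mulr1 rcM.
transitivity ((w j)%:C * (u k)%:C * outer (v j) (v k) x y * dot (v j) (v k)).
  by rewrite /outer /dot mulr_sumr; apply: eq_bigr => z _; ring.
by rewrite h eq_sym (negbTE ne) mulr0.
Qed.

(** The operator is copied to a matrix over ['I_#|I|] through [enum_val]; the conjugated rows of the
    spectral matrix are the eigenvectors. *)
Lemma spectral_op I (A : I -> I -> C) : opherm A ->
  exists v l, onb v /\ A = mix l v.
Proof.
move=> hA; pose M : 'M[C]_#|I| := \matrix_(i, j) A (enum_val i) (enum_val j).
have hM : M \is hermsymmx.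
  apply/is_hermitianmxP; rewrite expr0 scale1r; apply/matrixP => i j.
  by rewrite !mxE hA.
pose P := spectralmx M.
have Pu : P \is unitarymx := spectral_unitarymx M.
have /orthomx_spectralP := hermitian_normalmx hM.
rewrite (invmx_unitary Pu) => MP.
have /mxOverP Dr := hermitian_spectral_diag_real hM.
have /unitarymxP P1 := Pu.
have P2 : P^t* *m P = 1%:M by apply: mulmx1C.
exists (fun j x => cj (P (enum_rank j) (enum_rank x))).
exists (fun j => complex.Re (spectral_diag M 0 (enum_rank j))).
have en (F : I -> C) : \sum_x F x = \sum_(i < #|I|) F (enum_val i).
  by rewrite (reindex (@enum_val _ I)) //; exists enum_rank => i _; rewrite ?enum_valK ?enum_rankK.
split; first split.
- move=> i j; rewrite /dot en.
  have := congr1 (fun M : 'M[C]_#|I| => M (enum_rank i) (enum_rank j)) P1.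
  rewrite !mxE (inj_eq enum_rank_inj) => <-; apply: eq_bigr => k _.
  by rewrite !mxE conjcK enum_valK.
- move=> x y; rewrite en.
  have := congr1 (fun M : 'M[C]_#|I| => M (enum_rank x) (enum_rank y)) P2.
  rewrite !mxE (inj_eq enum_rank_inj) => <-; apply: eq_bigr => k _.
  by rewrite !mxE conjcK enum_valK.
apply: op_ext => x y; rewrite /mix en.
have := congr1 (fun M : 'M[C]_#|I| => M (enum_rank x) (enum_rank y)) MP.
rewrite mxE !enum_rankK => ->; rewrite mxE; apply: eq_bigr => k _.
rewrite mul_mx_diag !mxE /outer conjcK enum_valK.
rewrite [(complex.Re _)%:C]RRe_real ?Dr //; rewrite -!mulrA mulrCA; congr (_ * _).
Qed.

(** Commuting matrices have a common unitary triangularisation, and a triangular Hermitian matrix is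
    diagonal. *)
Lemma simultaneous_diag q n (L : 'I_q -> 'I_n -> 'I_n -> C) :
  (forall k, opherm (L k)) -> (forall k l, opmul (L k) (L l) = opmul (L l) (L k)) ->
  exists v l, onb v /\ forall k, L k = mix (l k) v.
Proof.
move=> hL cL; pose M k : 'M[C]_n := \matrix_(i, j) L k i j.
have cM : {in [seq M k | k <- enum 'I_q] &, forall A B, comm_mx A B}.
  move=> _ _ /mapP[k _ ->] /mapP[l _ ->]; apply/matrixP => i j.
  have := congr1 (fun A => A i j) (cL k l); rewrite /opmul !mxE.
  by move=> e; under eq_bigr do rewrite !mxE; under [in RHS]eq_bigr do rewrite !mxE.
have [P Pu /allP tP] := cotrigonalization cM.
have /unitarymxP P1 := Pu.
have P2 : P^t* *m P = 1%:M by apply: mulmx1C.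
pose D k := P *m M k *m P^t*.
have trD k (i j : 'I_n) : (i < j)%N -> D k i j = 0.
  have /tP : M k \in [seq M k | k <- enum 'I_q] by rewrite map_f ?mem_enum.
  by rewrite /= /similar_to conjumx ?unitarymx_unit // invmx_unitary // => /is_trig_mxP h /h.
have MJ k : (M k)^t* = M k by apply/matrixP => i j; rewrite !mxE [RHS]hL.
have DJ k i j : D k i j = cj (D k j i).
  have : (D k)^t* = D k by rewrite /D !trmx_mul !map_mxM MJ trmxCK mulmxA.
  by move=> /matrixP/(_ i j); rewrite !mxE => <-.
have dD k i j : i != j -> D k i j = 0.
  move=> ne; case: (ltngtP i j) => [|lt|/val_inj e]; first exact: trD.
    by rewrite DJ trD // conjc0.
  by rewrite e eqxx in ne.
(* [E] is a copy of [D] without its body, so that [mxE] stops at its entries instead of unfolding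
   the product. *)
have [E ED] : exists E, forall k, D k = E k by exists D.
have EJ k i j : E k i j = cj (E k j i) by rewrite -ED DJ.
have dE k i j : i != j -> E k i j = 0 by rewrite -ED; apply: dD.
exists (fun j x => cj (P j x)), (fun k j => complex.Re (E k j j)).
split; first split.
- move=> i j; rewrite /dot.
  have := congr1 (fun M : 'M[C]_n => M i j) P1.
  rewrite !mxE => <-; apply: eq_bigr => k _.
  by rewrite !mxE conjcK.
- move=> x y.
  have := congr1 (fun M : 'M[C]_n => M x y) P2.
  rewrite !mxE => <-; apply: eq_bigr => k _.
  by rewrite !mxE conjcK.
move=> k; apply: op_ext => x y.
have : M k = P^t* *m E k *m P.
  by rewrite -ED /D !mulmxA P2 mul1mx -mulmxA P2 mulmx1.
move=> /matrixP/(_ x y); rewrite !mxE => ->; apply: eq_bigr => j _.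
rewrite !mxE (bigD1 j) //= big1 ?addr0 => [|i ne]; last by rewrite dE // mulr0.
rewrite !mxE /outer conjcK.
have : E k j j \is Num.real by apply/CrealP; rewrite [RHS]EJ.
by move=> /RRe_real ->; rewrite -!mulrA mulrCA; congr (_ * _).
Qed.

Lemma psd_spectral I (A : I -> I -> C) : oppsd A ->
  exists v l, [/\ onb v, A = mix l v & forall j, 0 <= l j].
Proof.
case=> /spectral_op [v [l [hv ->]]] h; exists v, l; split=> // j.
have := h (v j); rewrite dot_mix /= (bigD1 j) //= (proj1 hv) eqxx abs2_real expr1n mulr1.
by rewrite big1 ?addr0 // => k ne; rewrite (proj1 hv) (negbTE ne) abs20 mulr0.
Qed.
Lemma psd_sqrt I (A : I -> I -> C) : oppsd A -> exists P, oppsd P /\ opmul P P = A.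
Proof.
case/psd_spectral=> v [l [hv -> l0]]; exists (mix (fun j => Num.sqrt (l j)) v); split.
  by apply: mix_psd => j; apply: sqrtr_ge0.
by rewrite mix_mul //; congr mix; apply/funext => j; rewrite -expr2 sqr_sqrtr.
Qed.
Lemma gram_psd I (X : I -> I -> C) : oppsd (opmul (opadj X) X).
Proof.
split=> [x y|v]; first by rewrite -[in LHS](opadjK X) -opadjM opadjK.
by rewrite app_mul dot_app opadjK -norm2_dot /= norm2_ge0.
Qed.

Section TraceNorm.
Variables (I : finType) (X P : I -> I -> C).
Hypotheses (psdP : oppsd P) (PP : opmul P P = opmul (opadj X) X).

(** The singular value decomposition of [X]: eigenvectors of [P] are sent to orthogonal vectors of
    length [l i]. Here [P] is any positive root, so the two bounds below apply to whichever root a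
    choice operator returns. *)
Lemma polar_basis : exists v l, [/\ onb v, forall j, 0 <= l j,
  optr P = (\sum_j l j)%:C &
  forall i j, dot (app X (v i)) (app X (v j)) = (l i ^+ 2)%:C * (i == j)%:R].
Proof.
have [v [l [hv eP l0]]] := psd_spectral psdP; exists v, l; split=> // [|i j].
  rewrite eP optr_mix; congr (_ %:C); apply: eq_bigr => j _.
  by rewrite onb_norm2 // mulr1.
rewrite -{1}(opadjK X) -dot_app -app_mul -PP eP mix_mul //.
rewrite app_mix_onb // /dot.
rewrite [LHS](_ : _ = (l j * l j)%:C * dot (v i) (v j)).
  rewrite (proj1 hv); case: eqP => [->|_]; last by rewrite !mulr0.
  by rewrite -expr2.
by rewrite /dot mulr_sumr; apply: eq_bigr => x _; ring.
Qed.

(** The trace of [P] is the sum of the inner products of [app X (v j)] with its normalisation [w j].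
    After a rank-one decomposition of [X] is inserted, each term is at most the mean of its two
    squared norms, by Bessel for [w] and Parseval for [v]. *)
Lemma nuc_le_trace e : nuc X e -> complex.Re (optr P) <= e.
Proof.
have [v [l [hv l0 -> hX]]] := polar_basis; case=> s [eX hs] /=.
(* The inverse of 0 is 0, so [w j] is the zero vector when the singular value vanishes. *)
pose w j x := (l j)^-1%:C * app X (v j) x.
have dw i b : dot (w i) b = (l i)^-1%:C * dot (app X (v i)) b.
  rewrite /dot mulr_sumr; apply: eq_bigr => x _.
  by rewrite cjM conjc_real mulrA.
have dww i j : dot (w i) (w j) = (((l i)^-1 * (l j)^-1 * l i ^+ 2) * (i == j)%:R)%:C.
  rewrite dw dotJ dw cjM -dotJ hX conjc_real !rcM rmorph_nat; ring.
have lw j : l j = complex.Re (dot (w j) (app X (v j))).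
  rewrite dw hX eqxx mulr1 -rcM /=; have [->|ne] := eqVneq (l j) 0; first by rewrite expr0n mulr0.
  by field.
have wX j : dot (w j) (app X (v j)) = \sum_(p <- s) dot (w j) p.1 * dot p.2 (v j).
  rewrite /app eX /dot; under eq_bigr do (under eq_bigr do rewrite mulr_suml; rewrite exchange_big mulr_sumr).
  rewrite exchange_big; apply: eq_bigr => p _ /=; rewrite mulr_suml; apply: eq_bigr => x _.
  rewrite -mulrA; congr (_ * _); rewrite mulr_sumr; apply: eq_bigr => y _.
  by rewrite /outer mulrA.
under eq_bigr do rewrite lw wX Re_sum.
rewrite exchange_big /=.
apply: (@le_trans _ _ (\sum_(p <- s) (norm2 p.1 + norm2 p.2) / 2)); last first.
  by rewrite -mulr_suml; lra.
apply: ler_sum => p _.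
apply: (@le_trans _ _ (\sum_j (abs2 (dot (w j) p.1) + abs2 (dot p.2 (v j))) / 2)).
  by apply: ler_sum => j _; apply: le_trans (ReMle _ _); apply: ler_norm.
rewrite -mulr_suml big_split /= ler_pM2r ?invr_gt0 // lerD //.
  apply: bessel => [j|i j ne]; last by rewrite dww (negbTE ne) mulr0.
  have [l0'|ne] := eqVneq (l j) 0; [right|left].
    by apply/funext => x; rewrite /w l0' invr0 mul0r.
  by apply: complexI; rewrite norm2_dot dww eqxx mulr1; congr (_ %:C); field.
rewrite -(parseval p.2 hv); rewrite le_eqVlt; apply/orP; left; apply/eqP; apply: eq_bigr => j _.
by rewrite dotJ abs2J.
Qed.

(** Pairing [app X (v j)] with [v j] and summing over the basis gives back [X]; rescaling by [r j]
    gives both vectors of a pair the squared norm [l j]. *)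
Lemma nuc_trace_norm : nuc X (complex.Re (optr P)).
Proof.
have [v [l [hv l0 -> hX]]] := polar_basis => /=.
pose r j := Num.sqrt (l j).
have rr j : r j ^+ 2 = l j by rewrite sqr_sqrtr.
have nX j : norm2 (app X (v j)) = l j ^+ 2.
  by apply: complexI; rewrite norm2_dot hX eqxx mulr1.
exists [seq ((fun x => (r j)^-1%:C * app X (v j) x), (fun x => (r j)%:C * v j x)) | j <- enum I].
split.
  apply: op_ext => x y; rewrite big_map big_enum /=.
  transitivity (opmul X (@opid R I) x y); first by rewrite opmul1r.
  transitivity (\sum_z X x z * \sum_j v j z * cj (v j y)).
    by apply: eq_bigr => z _; rewrite (proj2 hv).
  under [LHS]eq_bigr do rewrite mulr_sumr.
  rewrite exchange_big; apply: eq_bigr => j _ /=.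
  transitivity (app X (v j) x * cj (v j y)).
    by rewrite /app mulr_suml; apply: eq_bigr => z _; rewrite mulrA.
  rewrite /outer cjM conjc_real.
  have [r0|ne] := eqVneq (r j) 0.
    rewrite (norm2_eq0 (v := app X (v j))) ?nX -?rr ?r0 ?expr0n //; ring.
  rewrite [RHS](_ : _ = ((r j)^-1 * r j)%:C * (app X (v j) x * cj (v j y))); last by rewrite rcM; ring.
  by rewrite mulVf // mul1r.
rewrite big_map big_enum mulr_sumr /=; apply: ler_sum => j _.
rewrite !norm2Z !abs2_real nX onb_norm2 // exprVn rr.
have [->|ne] := eqVneq (l j) 0; first by rewrite invr0; lra.
by rewrite expr2 mulKf //; lra.
Qed.
End TraceNorm.
End Nuclear.

(** * Independent copies and typicality *)

(* Nested pairs rather than functions, so that [tpow] follows the recursion of [Defs.kpow]. *)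
Fixpoint pw (A : finType) (n : nat) : finType :=
  match n with O => unit | S n' => (A * pw A n')%type end.

Fixpoint sumf (A : finType) (V : nmodType) (g : A -> V) n : pw A n -> V :=
  match n with O => fun _ => 0 | S n' => fun x => g x.1 + sumf g x.2 end.

Fixpoint prodw (A : finType) (R : pzRingType) (w : A -> R) n : pw A n -> R :=
  match n with O => fun _ => 1 | S n' => fun x => w x.1 * prodw w x.2 end.

Fixpoint tpow (A B : finType) (R : pzRingType) (M : A -> B -> R) n :
    pw A n -> pw B n -> R :=
  match n with
  | O => fun _ _ => 1
  | S n' => fun x y => M x.1 y.1 * tpow M x.2 y.2
  end.

Section Iid.
Variables (R : realType) (A : finType) (w : A -> R).
Hypotheses (w0 : forall a, 0 <= w a) (w1 : \sum_a w a = 1).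

Lemma prodw_ge0 n (x : pw A n) : 0 <= prodw w x.
Proof. by elim: n x => [|n IH] x //=; rewrite mulr_ge0. Qed.

Lemma sum_pwS n (F : A -> pw A n -> R) :
  \sum_(x : pw A n.+1) F x.1 x.2 = \sum_a \sum_(x : pw A n) F a x.
Proof. by rewrite pair_bigA. Qed.

Lemma prodw_sum n : \sum_(x : pw A n) prodw w x = 1.
Proof.
elim: n => [|n IH]; first by rewrite (big_pred1 tt) //; case.
rewrite (sum_pwS (fun a x => w a * prodw w x)) -[RHS]w1; apply: eq_bigr => a _.
by rewrite -mulr_sumr IH mulr1.
Qed.

Variable g : A -> R.
Let m := \sum_a w a * g a.
Let v := \sum_a w a * (g a - m) ^+ 2.

Lemma centered : \sum_a w a * (g a - m) = 0.
Proof.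
under eq_bigr do rewrite mulrBr.
by rewrite sumrB -mulr_suml w1 mul1r subrr.
Qed.

Lemma sumf_mean n : \sum_(x : pw A n) prodw w x * sumf g x = n%:R * m.
Proof.
elim: n => [|n IH]; first by rewrite (big_pred1 tt) /= ?mul0r ?mulr0 //; case.
rewrite (sum_pwS (fun a x => w a * prodw w x * (g a + sumf g x))).
transitivity (\sum_a (w a * g a + w a * (n%:R * m))).
  apply: eq_bigr => a _; rewrite -IH -[X in X + _]mulr1 -[X in _ * X + _](prodw_sum n).
  rewrite !mulr_sumr -!big_split.
  by apply: eq_bigr => x _ /=; ring.
by rewrite big_split /= -mulr_suml w1 mul1r -/m -natr1; ring.
Qed.

Lemma sumf_variance n :
  \sum_(x : pw A n) prodw w x * (sumf g x - n%:R * m) ^+ 2 = n%:R * v.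
Proof.
elim: n => [|n IH]; first by rewrite (big_pred1 tt) /= => [|[]//]; ring.
rewrite (sum_pwS (fun a x => w a * prodw w x * (g a + sumf g x - n.+1%:R * m) ^+ 2)).
pose s := \sum_(x : pw A n) prodw w x * (sumf g x - n%:R * m).
transitivity (\sum_a (w a * (g a - m) ^+ 2 + w a * (g a - m) * (2 * s) + w a * (n%:R * v))).
  apply: eq_bigr => a _; rewrite -IH -[X in X + _ + _]mulr1 -[X in _ * X + _ + _](prodw_sum n).
  move: (m) @s => m' s; rewrite /s.
  rewrite !mulr_sumr -!big_split; apply: eq_bigr => x _ /=.
  by rewrite -natr1; ring.
rewrite !big_split /= -!mulr_suml centered w1 -/v -natr1; ring.
Qed.

Lemma chebyshev n (t : R) : (0 < n)%N -> 0 < t ->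
  \sum_(x : pw A n | ~~ (`|sumf g x - n%:R * m| <= n%:R * t)) prodw w x <= v / (n%:R * t ^+ 2).
Proof.
move=> n0 t0; have nt : 0 < (n%:R * t) ^+ 2 :> R by rewrite exprn_gt0 // mulr_gt0 ?ltr0n.
rewrite [leRHS](_ : _ = n%:R * v / (n%:R * t) ^+ 2); last first.
  by field; rewrite pnatr_eq0 -lt0n n0 gt_eqF.
rewrite ler_pdivlMr // -sumf_variance mulr_suml big_mkcond /=.
apply: ler_sum => x _; case: ifP => h; last by rewrite mulr_ge0 ?prodw_ge0 ?sqr_ge0.
apply: ler_wpM2l; first exact: prodw_ge0.
rewrite -ltNge in h.
by rewrite -[leRHS]real_normK ?num_real // lerXn2r ?nnegrE ?normr_ge0 ?mulr_ge0 ?ler0n // ltW.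
Qed.
End Iid.

(** * Typical words: probability bounds, mass and number *)

Section Typical.
Variables (R : realType) (A : finType) (r : A -> R).
Hypotheses (r0 : forall a, 0 <= r a) (r1 : \sum_a r a = 1).
Definition shannon : R := \sum_a r a * - ln (r a).
Let S := shannon.

Lemma prodw_exp n (x : pw A n) : 0 < prodw r x ->
  prodw r x = expR (- sumf (fun a => - ln (r a)) x).
Proof.
elim: n x => [|n IH] x /=; first by rewrite oppr0 expR0.
move=> h; have r1' : 0 < r x.1.
  by rewrite lt_neqAle r0 andbT eq_sym; apply: contraTneq h => ->; rewrite mul0r ltxx.
by rewrite opprD opprK expRD lnK // -IH // -(pmulr_rgt0 _ r1').
Qed.

(** Positivity is demanded separately: a word with a letter of weight zero has probability zero, but
    its sum of logarithms, being a total function, could still lie near the mean. *)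
Definition typical (t : R) n (x : pw A n) : bool :=
  (0 < prodw r x) && (`|sumf (fun a => - ln (r a)) x - n%:R * S| <= n%:R * t).

Lemma typical_bounds t n (x : pw A n) : typical t x ->
  expR (- (n%:R * (S + t))) <= prodw r x <= expR (- (n%:R * (S - t))).
Proof.
case/andP => h; rewrite (prodw_exp h) !ler_expR ler_norml => /andP[h1 h2].
by apply/andP; split; lra.
Qed.

Definition entropy_variance := \sum_a r a * (- ln (r a) - S) ^+ 2.

(** Words of probability zero fail [typical] but carry no mass; the rest is Chebyshev for the sum of
    the logarithms. *)
Lemma atypical_mass t n : (0 < n)%N -> 0 < t ->
  \sum_(x : pw A n | ~~ typical t x) prodw r x <= entropy_variance / (n%:R * t ^+ 2).
Proof.
move=> n0 t0; apply: le_trans (chebyshev r0 r1 (fun a => - ln (r a)) n0 t0).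
rewrite [leLHS]big_mkcond [leRHS]big_mkcond /=; apply: ler_sum => x _.
rewrite /typical negb_and -leNgt; case: ifP => //=; last by case: ifP; rewrite ?prodw_ge0.
by case: ifP => // _; rewrite orbF.
Qed.

(** Every typical word has probability at least [expR (- (n%:R * (S + t)))], and all probabilities
    add up to one. *)
Lemma typical_card t n : #|[pred x : pw A n | typical t x]|%:R <= expR (n%:R * (S + t)).
Proof.
have h : expR (- (n%:R * (S + t))) * #|[pred x : pw A n | typical t x]|%:R <= 1.
  apply: (@le_trans _ _ (\sum_(x : pw A n) prodw r x)); last by rewrite prodw_sum.
  rewrite mulr_natr -sumr_const.
  rewrite [leRHS](bigID (typical t (n := n))) /= -[leLHS]addr0 lerD //.
    by apply: ler_sum => x /typical_bounds/andP[].
  by apply: sumr_ge0 => x _; apply: prodw_ge0.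
by move: h; rewrite expRN mulrC ler_pdivrMr ?expR_gt0 // mul1r.
Qed.
End Typical.

(** * Tensor powers of mixtures and the product distribution of measured charges *)

Section TensorPowers.
Variables (R : realType) (d : finType).
Local Notation C := (complex R).
Local Notation "x %:C" := (real_complex R x) (at level 1, format "x %:C").
Local Notation cj := (@conjc R).


Lemma tpow_onb (e : d -> d -> C) n : onb e -> onb (tpow e (n := n)).
Proof.
move=> he; elim: n => [|n IH]; last exact: (onb_tens he IH).
split=> -[] [].
  by rewrite /dot (big_pred1 tt) => [|[]//]; rewrite mulJc [tpow _ _ _]/1 abs21.
by rewrite (big_pred1 tt) => [|[]//]; rewrite mulcJ [tpow _ _ _]/1 abs21.
Qed.

Lemma tpow_mix (r : d -> R) (e : d -> d -> C) n :
  tpow (mix r e) (n := n) = mix (prodw r (n := n)) (tpow e (n := n)).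
Proof.
elim: n => [|n IH].
  apply: op_ext => -[] []; rewrite /mix (big_pred1 tt) => [|[]//].
  by rewrite /outer mulcJ [in RHS]/(tpow _ _ _) abs21 mulr1.
transitivity (optens (mix r e) (tpow (mix r e) (n := n))); first by [].
by rewrite IH mix_tens.
Qed.

(** The outcome distribution when the mixture is measured in the coordinate basis; in coordinates of
    a joint eigenbasis of the charges it governs all charge values together. *)
Definition diag_weight (r : d -> R) (e : d -> d -> C) (y : d) : R :=
  \sum_x r x * abs2 (e x y).

(** Measuring a tensor power copy by copy gives independent outcomes, which is what makes Chebyshev
    applicable to the charges. *)
Lemma tpow_diag_weight (r : d -> R) (e : d -> d -> C) n (y : pw d n) :
  \sum_x prodw r x * abs2 (tpow e x y) = prodw (diag_weight r e) y.
Proof.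
elim: n y => [|n IH] y.
  by rewrite (big_pred1 tt) => [|[]//]; rewrite [tpow _ _ _]/1 abs21 mulr1.
rewrite (sum_pwS (fun a x => r a * prodw r x * abs2 (e a y.1 * tpow e x y.2))).
rewrite [RHS]/= -IH /diag_weight big_distrlr /=; apply: eq_bigr => a _; apply: eq_bigr => x _.
by rewrite abs2M; ring.
Qed.

Lemma diag_weight_ge0 r e y : (forall x, 0 <= r x) -> 0 <= diag_weight r e y.
Proof. by move=> r0; apply: sumr_ge0 => x _; rewrite mulr_ge0 ?abs2_ge0. Qed.

Lemma diag_weight_sum r e : onb e -> \sum_x r x = 1 -> \sum_y diag_weight r e y = 1.
Proof.
move=> he <-; rewrite /diag_weight exchange_big; apply: eq_bigr => x _ /=.
by rewrite -mulr_sumr [X in _ * X](onb_norm2 x he) mulr1.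
Qed.
End TensorPowers.

(** * Matching sorted spectra through the embezzling state *)

Section Harmonic.
Variable R : realType.

(** The inequality [ln (1 + x) <= x] at [x = -1/(k+1)]; the next lemma takes [x = 1/k]. *)
Lemma ln_step_lower (k : nat) : (0 < k)%N ->
  (k.+1%:R)^-1 <= ln k.+1%:R - ln k%:R :> R.
Proof.
move=> k0; have h0 : 0 < k%:R :> R by rewrite ltr0n.
have h1 : 0 < k.+1%:R :> R by rewrite ltr0n.
have hN : - (k.+1%:R)^-1 > -1 :> R.
  by rewrite ltrN2 invf_lt1 // ltr1n.
have := le_ln1Dx hN.
rewrite (_ : 1 - _ = k%:R / k.+1%:R); last by rewrite -natr1; field; rewrite natr1 pnatr_eq0.
by rewrite ln_div ?posrE // lerNr opprB.
Qed.

Lemma ln_step_upper (k : nat) : (0 < k)%N ->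
  ln k.+1%:R - ln k%:R <= (k%:R)^-1 :> R.
Proof.
move=> k0; have h0 : 0 < k%:R :> R by rewrite ltr0n.
have h1 : 0 < k.+1%:R :> R by rewrite ltr0n.
have hN : (k%:R)^-1 > -1 :> R by apply: lt_trans (_ : 0 < _); rewrite ?invr_gt0 // ltrN10.
have := le_ln1Dx hN.
rewrite (_ : 1 + _ = k.+1%:R / k%:R); last by rewrite -natr1; field; rewrite gt_eqF.
by rewrite ln_div ?posrE.
Qed.

Definition harmonic (N : nat) : R := \sum_(i < N) (i.+1%:R)^-1.


Lemma harmonic_ge_ln N : ln N.+1%:R <= harmonic N.
Proof.
elim: N => [|N IH]; first by rewrite /harmonic big_ord0 ln1.
rewrite /harmonic big_ord_recr /= -/(harmonic N).
by have := ln_step_upper (ltn0Sn N); move: (N.+1%:R^-1) => x; lra.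
Qed.

Lemma harmonic_gt0 N : (0 < N)%N -> 0 < harmonic N.
Proof.
by move=> N0; apply: lt_le_trans (harmonic_ge_ln N); rewrite ln_gt0 // ltr1n.
Qed.

Lemma sum_inv_le_ln (a b : nat) : (0 < a <= b)%N ->
  \sum_(a <= k < b) (k.+1%:R)^-1 <= ln b%:R - ln a%:R :> R.
Proof.
case/andP => a0; elim: b => [|b IH]; first by rewrite leqn0 => /eqP e; rewrite e in a0.
rewrite leq_eqVlt => /predU1P[->|]; first by rewrite big_geq // subrr.
rewrite ltnS => ab; rewrite big_nat_recr //=.
by have := IH ab; have := ln_step_lower (leq_trans a0 ab); move: (b.+1%:R^-1) => x; lra.
Qed.

Lemma card_below N (x : R) : 0 <= x ->
  \sum_(i < N | (i.+1%:R <= x)) (1 : R) <= x.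
Proof.
move=> x0; elim: N => [|N IH]; first by rewrite big_ord0.
rewrite big_mkcond big_ord_recr -big_mkcond /=; case: ifP => [h|_]; last by rewrite addr0.
apply: le_trans h; rewrite -natr1 lerD2r.
apply: (@le_trans _ _ (\sum_(i < N) 1)); last by rewrite sumr_const card_ord.
by rewrite [leLHS]big_mkcond; apply: ler_sum => i _; case: ifP.
Qed.

Lemma sum_ord_window K a b (F : nat -> R) : (forall k, 0 <= F k) ->
  \sum_(k < K) (if (a <= k < b)%N then F k else 0) <= \sum_(a <= k < b) F k.
Proof.
move=> F0; rewrite -big_mkcond (big_nat_widen _ _ (maxn K b)) ?leq_maxr //.
rewrite (big_nat_widenl _ 0) // big_mkord (big_ord_widen_cond (maxn K b) (fun k => a <= k < b)%N F) ?leq_maxl //.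
rewrite [leLHS]big_mkcond [leRHS]big_mkcond; apply: ler_sum => k _ /=.
by rewrite [(k < b)%N && _]andbC; case: (a <= k < b)%N; case: (k < K)%N; rewrite ?lexx ?F0.
Qed.

End Harmonic.

Section Sorting.
Variables (R : realType) (T : finType).

Lemma sorted_enumeration (u : T -> R) : exists s : 'I_#|T| -> T,
  bijective s /\ forall i j : 'I_#|T|, (i <= j)%N -> u (s j) <= u (s i).
Proof.
pose le x y := u y <= u x; pose l := sort le (enum T).
have le_total : total le by move=> x y; apply: le_total.
have le_tr : transitive le by move=> x y z h1 h2; apply: le_trans h2 h1.
have sz : size l = #|T| by rewrite size_sort -cardE.
have srt : sorted le l by apply: sort_sorted.
have ul : uniq l by rewrite sort_uniq enum_uniq.
have [x0 _|T0] := pickP T; last first.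
  exists (fun i => enum_val i); split; last first.
    by move=> i; have := T0 (enum_val i).
  by exists enum_rank => i; rewrite ?enum_valK ?enum_rankK.
exists (fun i => nth x0 l i); split; last first.
  move=> i j ij; apply: (sorted_leq_nth le_tr _ x0 srt) => //.
  - by move=> x; apply: lexx.
  - by rewrite inE sz.
  - by rewrite inE sz.
apply: inj_card_bij; last by rewrite card_ord.
by move=> i j /eqP; rewrite nth_uniq ?sz // => /eqP/val_inj.
Qed.
End Sorting.

Section Matching.
Variables (R : realType) (N : nat).
Hypothesis N0 : (0 < N)%N.
Let H := harmonic R N.
Let H0 : 0 < H. Proof. exact: harmonic_gt0. Qed.

(* The embezzling spectrum of van Dam and Hayden: tensoring with it makes the sorted spectrum of any state approximately [1 / (k.+1 * H)], whatever the state. *)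
Definition embezzle (i : 'I_N) : R := (i.+1%:R * H)^-1.

Lemma embezzle_ge0 i : 0 <= embezzle i.
Proof. by rewrite invr_ge0 mulr_ge0 // ltW. Qed.
Lemma embezzle_sum : \sum_i embezzle i = 1.
Proof.
rewrite /embezzle; under eq_bigr do rewrite invfM.
by rewrite -mulr_suml mulfV // gt_eqF.
Qed.
Lemma embezzle_le i : embezzle i <= H^-1.
Proof.
rewrite /embezzle invfM ler_piMl ?invf_le1 ?ler1n ?ltr0n //.
by rewrite invr_ge0 ltW.
Qed.

Variable W : finType.

(** The eigenvalues of a truncated state: [e] bounds the lost mass, [lam] the largest eigenvalue and
    [D] the rank. The matching error depends on these numbers alone, which is why two different
    states can be brought together. *)
Record spectrum (p : W -> R) (e lam D : R) : Prop := Spectrum {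
  spectrum_ge0 : forall j, 0 <= p j;
  spectrum_sum_le1 : \sum_j p j <= 1;
  spectrum_sum_ge : 1 - e <= \sum_j p j;
  spectrum_le : forall j, p j <= lam;
  spectrum_card : #|[pred j | p j != 0]|%:R <= D }.

Let smear (p : W -> R) (a : W * 'I_N) := p a.1 * embezzle a.2.

Section OneSpectrum.
Variables (p : W -> R) (e lam D : R) (B : nat).
Hypotheses (hp : spectrum p e lam D) (hB : D * N%:R <= B%:R).
Variable s : 'I_#|{: W * 'I_N}| -> W * 'I_N.
Hypotheses (sbij : bijective s)
  (smono : forall i j : 'I_#|{: W * 'I_N}|, (i <= j)%N -> smear p (s j) <= smear p (s i)).

Lemma smear_ge0 a : 0 <= smear p a.
Proof. by rewrite mulr_ge0 ?embezzle_ge0 // (spectrum_ge0 hp). Qed.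

(** By monotonicity the values at positions [0, ..., k] are all at least the one at [k]; hence
    [k.+1]. *)
Lemma count_above (k : 'I_#|{: W * 'I_N}|) :
  k.+1%:R <= \sum_(a | smear p (s k) <= smear p a) (1 : R).
Proof.
rewrite (reindex s) /=; last by apply: onW_bij.
apply: (@le_trans _ _ (\sum_(i < #|{: W * 'I_N}| | (i < k.+1)%N) 1)).
  rewrite -(big_ord_widen_cond _ predT (fun _ => 1)) ?ltn_ord //.
  by rewrite sumr_const card_ord.
rewrite [leLHS]big_mkcond [leRHS]big_mkcond; apply: ler_sum => i _.
by case: ifP => [ik|_]; [rewrite smono | case: ifP].
Qed.

(* The number of pairs with [p j / (i.+1 * H) >= x] is at most the sum over [j] of [p j / (x * H)], hence at most [1 / (x * H)]. *)
Lemma smear_le_inv k : smear p (s k) <= (k.+1%:R * H)^-1.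
Proof.
have [->|x0] := eqVneq (smear p (s k)) 0.
  by rewrite invr_ge0 mulr_ge0 // ltW.
have {x0} : 0 < smear p (s k) by rewrite lt_neqAle eq_sym x0 smear_ge0.
have := count_above k; move: (smear p (s k)) => x hk x0.
have {hk} : k.+1%:R <= (x * H)^-1.
  apply: le_trans hk _; rewrite -(pair_big_dep xpredT (fun j i => x <= smear p (j, i)) (fun _ _ => 1)) /=.
  apply: (@le_trans _ _ (\sum_j p j / (x * H))); last first.
    by rewrite -mulr_suml ler_piMl ?invr_ge0 ?mulr_ge0 ?(spectrum_sum_le1 hp) // ltW.
  apply: ler_sum => j _; apply: le_trans (card_below N _); last first.
    by rewrite divr_ge0 ?(spectrum_ge0 hp) // mulr_ge0 // ltW.
  rewrite le_eqVlt; apply/orP; left; apply/eqP; apply: eq_bigl => i.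
  rewrite /smear /embezzle /= ler_pdivlMr ?mulr_gt0 ?ltr0n // ler_pdivlMr ?mulr_gt0 //.
  by congr (_ <= _); ring.
rewrite -[x in _ -> x <= _]invrK => h; rewrite lef_pV2 ?posrE ?invr_gt0 ?mulr_gt0 ?ltr0n //.
by move: h; rewrite invfM -ler_pdivlMr // mulrC.
Qed.

Lemma smear_le_max k : smear p (s k) <= lam / H.
Proof.
apply: ler_pM; rewrite ?embezzle_ge0 ?(spectrum_ge0 hp) ?(spectrum_le hp) //.
exact: embezzle_le.
Qed.

(** At most [D * N] pairs have a nonzero value, and sorting puts them first. *)
Lemma smear_vanish (k : 'I_#|{: W * 'I_N}|) : (B <= k)%N -> smear p (s k) = 0.
Proof.
move=> Bk; apply: contraTeq Bk => x0; rewrite -ltnNge.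
have {x0} x0 : 0 < smear p (s k) by rewrite lt_neqAle eq_sym x0 smear_ge0.
have h : k.+1%:R <= D * N%:R.
  apply: le_trans (count_above k) _.
  apply: (@le_trans _ _ (\sum_(a : W * 'I_N | (p a.1 != 0) && true) 1)).
    rewrite [leLHS]big_mkcond [leRHS]big_mkcond; apply: ler_sum => a _.
    case: ifP => [h|_]; last by case: ifP.
    case: eqP => // pa; move: (lt_le_trans x0 h); by rewrite /smear pa mul0r ltxx.
  rewrite -(pair_big_dep (fun j => p j != 0) (fun _ _ => true) (fun _ _ => 1)) /=.
  under eq_bigr do rewrite sumr_const card_ord.
  by rewrite sumr_const -[leLHS]mulr_natl ler_wpM2r ?(spectrum_card hp).
by rewrite -(ler_nat R); apply: le_trans h hB.
Qed.

Lemma smear_sum_ge : 1 - e <= \sum_k smear p (s k).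
Proof.
apply: le_trans (spectrum_sum_ge hp) _.
have <- : \sum_a smear p a = \sum_k smear p (s k) by apply/reindex/onW_bij.
rewrite (eq_bigr (fun a => smear p (a.1, a.2))) => [|[]//].
rewrite -(pair_bigA _ (fun j i => smear p (j, i))) /=.
apply: ler_sum => j _; rewrite /smear /= -mulr_sumr embezzle_sum mulr1 lexx //.
Qed.
End OneSpectrum.

(** There are three ranges of the sorted position. Below [A] the flat bound [lam / H] is used, at a
    total cost of [8 / H] because [A * lam <= 2]; between [A] and [B] the harmonic bound sums to at
    most [(ln B - ln A) / H]; from [B] on both spectra vanish. Since each spectrum has mass at least
    [1 - e], only the excess of the bound over that mass is lost. *)
Lemma matching (p q : W -> R) (e lam D : R) (A B : nat) :
  spectrum p e lam D -> spectrum q e lam D -> (0 < A <= B)%N ->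
  A%:R * lam <= 2 -> D * N%:R <= B%:R ->
  exists s t : 'I_#|{: W * 'I_N}| -> W * 'I_N,
   [/\ bijective s, bijective t &
    \sum_k `|p (s k).1 * embezzle (s k).2 - q (t k).1 * embezzle (t k).2| <=
    2 * ((ln B%:R - ln A%:R) / H - 1 + e) + 8 / H].
Proof.
move=> hp hq AB hA hB.
have [s [bs ms]] := sorted_enumeration (smear p).
have [t [bt mt]] := sorted_enumeration (smear q).
exists s, t; split=> //.
pose u k := smear p (s k); pose v k := smear q (t k).
pose g (k : nat) : R := (k.+1%:R * H)^-1.
have g0 k : 0 <= g k by rewrite invr_ge0 mulr_ge0 // ltW.
have u0 k : 0 <= u k := smear_ge0 hp (s k).
have v0 k : 0 <= v k := smear_ge0 hq (t k).
(* Both [u] and [v] lie below [g] in the range [A <= k < B], so their distance is at most the total defect [2 g - (u + v)]. *)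
have pt k : `|u k - v k| <= 2 * (if (A <= k < B)%N then g k else 0) - (u k + v k)
     + (if (k < A)%N then 4 * lam / H else 0).
  have [kA|Ak] := ltnP k A.
    rewrite /= addrC mulr0 sub0r; have := smear_le_max hp s k; have := smear_le_max hq t k.
    rewrite -/(u k) -/(v k) => h1 h2; have := u0 k; have := v0 k.
    by rewrite ler_norml => ? ?; apply/andP; split; lra.
  have [kB|Bk] := ltnP k B.
    rewrite /=; have := smear_le_inv hp bs ms k; have := smear_le_inv hq bt mt k.
    rewrite -/(u k) -/(v k) -/(g k) => h1 h2; have := u0 k; have := v0 k.
    by rewrite ler_norml => ? ?; apply/andP; split; lra.
  rewrite /= /u /v (smear_vanish hp hB bs ms Bk) (smear_vanish hq hB bt mt Bk).
  by rewrite subrr normr0; lra.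
apply: le_trans (ler_sum _ (fun k _ => pt k)) _.
rewrite !big_split /= -mulr_sumr sumrN big_split /=.
have h1 : 1 - e <= \sum_k u k := smear_sum_ge hp bs.
have h2 : 1 - e <= \sum_k v k := smear_sum_ge hq bt.
have h3 : \sum_(k < #|{: W * 'I_N}|) (if (A <= k < B)%N then g k else 0) <= (ln B%:R - ln A%:R) / H.
  apply: (@le_trans _ _ (\sum_(A <= k < B) g k)); last first.
    rewrite /g; under eq_bigr do rewrite invfM.
    by rewrite -mulr_suml ler_pM2r ?invr_gt0 // sum_inv_le_ln.
  exact: sum_ord_window.
have h4 : \sum_(k < #|{: W * 'I_N}|) (if (k < A)%N then 4 * lam / H else 0) <= 8 / H.
  (* The record [spectrum] does not state that [lam] is nonnegative; for a negative [lam] every term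
     is at most zero. *)
  have [l0|l0] := leP 0 lam; last first.
    apply: (@le_trans _ _ 0); last by rewrite divr_ge0 // ltW.
    apply: sumr_le0 => k _; case: ifP => // _.
    by rewrite pmulr_lle0 ?invr_gt0 // pmulr_rle0 // ltW.
  apply: (@le_trans _ _ (\sum_(k < A) (4 * lam / H))).
    rewrite -(big_mkord xpredT (fun=> 4 * lam / H)).
    by apply: (sum_ord_window _ 0 A) => k; rewrite divr_ge0 ?mulr_ge0 // ltW.
  rewrite sumr_const card_ord -[leLHS]mulr_natl mulrA ler_pM2r ?invr_gt0 //; lra.
lra.
Qed.
End Matching.

(** * Reference frames for the charges *)

Section Growth.
Variables (G : zmodType) (D : seq G).
Hypothesis D0 : 0 \in D.

(** [undup] makes the length of the list the cardinality of the set. *)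
Fixpoint sumset (j : nat) : seq G :=
  match j with
  | O => [:: 0]
  | S j' => undup [seq t + v | t <- sumset j', v <- D]
  end.

Lemma sumset_uniq j : uniq (sumset j).
Proof. by case: j => //= j; apply: undup_uniq. Qed.
Lemma sumset_step j t v : t \in sumset j -> v \in D -> t + v \in sumset j.+1.
Proof. by move=> ht hv; rewrite /= mem_undup; apply: allpairs_f. Qed.
Lemma sumsetS j t : t \in sumset j.+1 ->
  exists t' v, [/\ t' \in sumset j, v \in D & t = t' + v].
Proof. by rewrite /= mem_undup => /allpairsP[[t' v] [? ? ->]]; exists t', v. Qed.
Lemma sumset_sub j : {subset sumset j <= sumset j.+1}.
Proof. by move=> t ht; rewrite -[t]addr0; apply: sumset_step. Qed.
Lemma sumset_size_gt0 j : (0 < size (sumset j))%N.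
Proof.
elim: j => // j; case: (sumset j) (@sumset_sub j) => // t s h _.
by have := h t (mem_head _ _); case: (sumset j.+1).
Qed.

(* If every step grew by a factor [1 + eps], the size of [sumset J] would be exponential in [J]. *)
Lemma sumset_folner (R : realFieldType) (eps : R) (J : nat) :
  (size (sumset J))%:R < (1 + eps) ^+ J -> 0 < eps ->
  exists2 j, (j < J)%N & (size (sumset j.+1))%:R <= (1 + eps) * (size (sumset j))%:R.
Proof.
move=> hJ e0; apply: contrapT => hn.
have h k : (k <= J)%N -> (1 + eps) ^+ k <= (size (sumset k))%:R.
  elim: k => [|k IH] kJ; first by rewrite expr0 /= ler1n.
  have [//|hk] := leP ((1 + eps) ^+ k.+1) (size (sumset k.+1))%:R.
  exfalso; apply: hn; exists k => //; apply: ltW; apply: lt_le_trans hk _.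
  by rewrite exprS; apply: ler_wpM2l (IH (ltnW kJ)); apply: ltW; rewrite addr_gt0.
by have := h J (leqnn _); rewrite leNgt hJ.
Qed.
End Growth.

(** * Lifting a unitary of the window to one that conserves the total charge *)

Section Lift.
Variables (R : rcfType) (Z : finType) (G : zmodType).
Local Notation C := (complex R).
Local Notation "x %:C" := (real_complex R x) (at level 1, format "x %:C").
Local Notation cj := (@conjc R).
Variables (c : Z -> G) (win : pred Z) (Lam : seq G).
Local Notation T := (seq_sub Lam).

Definition total (b : Z * T) : G := val b.2 + c b.1.
(* The states of a total charge sector are available as a whole: every [z'] in the window is accompanied by some ancilla state of [Lam]. *)
Definition complete_sector (b : Z * T) : bool :=
  win b.1 && [forall z', win z' ==> (total b - c z' \in Lam)].
(** The window states of a complete sector form a copy of the window, the label being fixed by [z]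
    and the total charge, and [V] acts on that copy. Everything else is left fixed, because on an
    incomplete sector the corresponding block of [V] could fail to be unitary. *)
Definition sector_lift (V : Z -> Z -> C) : Z * T -> Z * T -> C := fun b b' =>
  if complete_sector b && complete_sector b' then V b.1 b'.1 * (total b == total b')%:R
  else (b == b')%:R.

Lemma total_eq b b' : total b = total b' -> b.1 = b'.1 -> b = b'.
Proof.
case: b b' => [z t] [z' t'] /= + e; rewrite /total e /= => /addIr /val_inj -> //.
Qed.

(** Given the total charge, each [z] in the window has exactly one label, the total minus [c z], and
    completeness puts it in [Lam]. *)
Lemma sector_sum (x : Z * T) (F : Z -> C) : complete_sector x ->
  \sum_(b : Z * T) (if complete_sector b && (total x == total b) then F b.1 else 0) =
  \sum_(z | win z) F z.
Proof.
case/andP => _ /forallP hx.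
rewrite (eq_bigr (fun b => (fun z t => if complete_sector (z, t) && (total x == total (z, t)) then F z else 0) b.1 b.2)) => [|[z t]//].
rewrite -(pair_bigA _ (fun z t => if complete_sector (z, t) && (total x == total (z, t)) then F z else 0)) /=.
rewrite [RHS]big_mkcond; apply: eq_bigr => z _ /=.
case: ifP => wz; last by rewrite big1 // => t _; rewrite /complete_sector /= wz.
have ht := implyP (hx z) wz.
have tt : total (z, SeqSub ht) = total x by rewrite /total /= subrK.
rewrite (bigD1 (SeqSub ht)) //= tt eqxx andbT /complete_sector wz /=.
rewrite (_ : [forall z', _] = true) ?big1 ?addr0 //; last first.
  by apply/forallP => z'; rewrite tt; apply: hx.
move=> t /eqP ne; case: eqP => e; rewrite ?andbF //.
by case: ne; have := @total_eq (z, t) (z, SeqSub ht); rewrite tt -e => /(_ erefl erefl) [].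
Qed.

Lemma lift_mul (V V' : Z -> Z -> C) :
  (forall z z', win z -> win z' -> \sum_(w | win w) V z w * V' w z' = (z == z')%:R) ->
  opmul (sector_lift V) (sector_lift V') = @opid R _.
Proof.
move=> hV; apply: op_ext => x y; rewrite /opmul /opid.
have [hx|hx] := boolP (complete_sector x); last first.
  rewrite (bigD1 x) //= big1 ?addr0 => [|b ne].
    by rewrite /sector_lift (negbTE hx) /= eqxx mul1r.
  by rewrite /sector_lift (negbTE hx) /= eq_sym (negbTE ne) mul0r.
have [hy|hy] := boolP (complete_sector y); last first.
  have -> : (x == y) = false by apply: contraNF hy => /eqP <-.
  rewrite big1 // => b _; rewrite /sector_lift (negbTE hy) hx andbF /=.
  have [->|_] := eqVneq b y; last by rewrite mulr0.
  by rewrite (negbTE hy); have [e|_] := eqVneq x y; rewrite ?mul0r //; rewrite -e hx in hy.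
transitivity (\sum_b (if complete_sector b && (total x == total b)
   then V x.1 b.1 * V' b.1 y.1 * (total x == total y)%:R else 0)).
  apply: eq_bigr => b _; rewrite /sector_lift hx hy /= andbT.
  have [hb|hb] /= := boolP (complete_sector b).
    by case: eqP => [->|_]; rewrite ?(mul0r, mulr0) // mulr1 mulrA.
  have [e|_] := eqVneq x b; last by rewrite mul0r.
  by rewrite -e hx in hb.
rewrite (sector_sum (fun z => V x.1 z * V' z y.1 * (total x == total y)%:R) hx).
rewrite -mulr_suml hV; first last.
- by case/andP: hy.
- by case/andP: hx.
have [e|ne] := eqVneq x y; first by rewrite e !eqxx mulr1.
have [e1|_] := eqVneq x.1 y.1; last by rewrite mul0r.
have [e2|_] := eqVneq (total x) (total y); last by rewrite mulr0.
by rewrite (total_eq e2 e1) eqxx in ne.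
Qed.

Lemma lift_adj V : opadj (sector_lift V) = sector_lift (opadj V).
Proof.
apply: op_ext => x y; rewrite /opadj /sector_lift andbC [total y == _]eq_sym [y == _]eq_sym.
by case: ifP => _; rewrite ?cjM conjc_nat.
Qed.

Definition win_unitary (V : Z -> Z -> C) :=
  forall z z', win z -> win z' ->
    \sum_(w | win w) V z w * opadj V w z' = (z == z')%:R /\
    \sum_(w | win w) opadj V z w * V w z' = (z == z')%:R.

Lemma lift_unitary V : win_unitary V -> opunitary (sector_lift V).
Proof. by move=> h; split; rewrite lift_adj; apply: lift_mul => z z' wz wz'; case: (h z z' wz wz'). Qed.

Lemma lift_conserve V x y : sector_lift V x y != 0 -> total x = total y.
Proof.
rewrite /sector_lift; case: ifP => _; last by have [->|_] := eqVneq x y; rewrite ?eqxx.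
by have [->|_] := eqVneq (total x) (total y); rewrite // mulr0 eqxx.
Qed.

Variables (S S0 : seq G).
Hypotheses (uS : uniq S) (S_gt0 : (0 < size S)%N) (uS0 : uniq S0).
Hypotheses (S0S : {subset S0 <= S}) (SLam : {subset S <= Lam}).
Hypothesis S0_shift : forall t z z', t \in S0 -> win z -> win z' -> t + c z - c z' \in S.

(** A superposition and not a mixture: the lift moves labels by amounts that depend on the window
    states, and only the overlap of the shifted vectors keeps the result close to a product. *)
Definition flat : T -> C := fun t => if val t \in S then ((Num.sqrt (size S)%:R)^-1)%:C else 0.

Lemma abs2_flat t : abs2 (flat t) = if val t \in S then (size S)%:R^-1 else 0.
Proof.
rewrite /flat; case: ifP => _; last exact: abs20.
by rewrite abs2_real exprVn sqr_sqrtr ?ler0n.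
Qed.

Lemma sum_seq_sub (S' : seq G) (k : R) : uniq S' -> {subset S' <= Lam} ->
  \sum_(t : T) (if val t \in S' then k else 0) = k * (size S')%:R.
Proof.
move=> uS' sub; pose l := [seq t <- enum {: T} | val t \in S'].
have ul : uniq l by rewrite filter_uniq ?enum_uniq.
rewrite -big_mkcond sumr_const mulr_natr; congr (_ *+ _).
rewrite (eq_card (B := mem l)); last by move=> t; rewrite [RHS]mem_filter mem_enum andbT.
rewrite (card_uniqP ul) -(size_map (@ssval _ Lam)).
apply/perm_size/uniq_perm => //; first by rewrite map_inj_uniq //; apply: val_inj.
move=> g; apply/mapP/idP => [[t]|hg]; first by rewrite mem_filter => /andP[h _ ->].
by exists (SeqSub (sub g hg)) => //; rewrite mem_filter mem_enum /= hg.
Qed.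

Lemma norm2_flat : norm2 flat = 1.
Proof.
rewrite /norm2; under eq_bigr do rewrite abs2_flat.
by rewrite sum_seq_sub // mulVf // pnatr_eq0 -lt0n.
Qed.

(* In a core sector every state of the window is paired with a frame state on which [flat] takes its constant value. *)
Definition core (u : G) : bool := [forall z', win z' ==> (u - c z' \in S)].

Definition defect : R := ((size S)%:R - (size S0)%:R) / (size S)%:R.

Definition restrict (P : pred (Z * T)) (f : Z * T -> C) : Z * T -> C :=
  fun b => if P b then f b else 0.

(** If the label lies in [S0], exchanging one window state for another stays inside [S], so the
    sector is core; only labels of [S] outside [S0] contribute. *)
Lemma noncore_norm2 (a : Z -> C) : (forall z, ~~ win z -> a z = 0) ->
  norm2 (restrict (fun b => ~~ core (total b)) (vtens a flat)) <= defect * norm2 a.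
Proof.
move=> ha; rewrite /norm2 mulr_sumr.
rewrite (eq_bigr (fun b => (fun z t => abs2 (restrict (fun b => ~~ core (total b)) (vtens a flat) (z, t))) b.1 b.2)) => [|[z t]//].
rewrite -(pair_bigA _ (fun z t => abs2 (restrict (fun b => ~~ core (total b)) (vtens a flat) (z, t)))) /=.
apply: ler_sum => z _; have [wz|wz] := boolP (win z); last first.
  rewrite big1 => [|t _]; first by rewrite ha // abs20 mulr0.
  by rewrite /restrict /vtens /= ha // mul0r if_same abs20.
apply: (@le_trans _ _ (\sum_(t : T) abs2 (a z) * ((if val t \in S then (size S)%:R^-1 else 0) -
     (if val t \in S0 then (size S)%:R^-1 else 0)))); last first.
  rewrite -mulr_sumr sumrB !sum_seq_sub //; last by move=> t /S0S/SLam.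
  by rewrite -mulrBr /defect mulrC [X in X * _]mulrC.
apply: ler_sum => t _; rewrite /restrict; case: ifP => [hc|_]; last first.
  rewrite abs20 mulr_ge0 ?abs2_ge0 //; case: ifP => [tS|tS].
    by case: ifP; rewrite ?subrr ?subr0 ?invr_ge0.
  by case: ifP => [/S0S|]; rewrite ?tS ?subrr.
rewrite /vtens abs2M abs2_flat /= (_ : (val t \in S0) = false) ?subr0 //.
apply: contraNF hc => ht; apply/forallP => z'; apply/implyP => wz'.
exact: S0_shift.
Qed.

(** Along a core sector [flat] is constant, so the motion of the label is invisible and the lift
    acts exactly as [V] on the first factor. *)
Lemma lift_core V (a : Z -> C) :
  (forall z z', ~~ (win z && win z') -> V z z' = 0) -> (forall z, ~~ win z -> a z = 0) ->
  app (sector_lift V) (restrict (fun b => core (total b)) (vtens a flat)) =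
  restrict (fun b => core (total b)) (vtens (app V a) flat).
Proof.
move=> hV ha.
have core_complete b : core (total b) -> win b.1 -> complete_sector b.
  move=> hc wb; rewrite /complete_sector wb; apply/forallP => z'; apply/implyP => wz'.
  by apply: SLam; apply: (implyP (forallP hc z')).
have core_flat b : core (total b) -> win b.1 -> flat b.2 = ((Num.sqrt (size S)%:R)^-1)%:C.
  move=> hc wb; rewrite /flat; have := implyP (forallP hc b.1) wb.
  by rewrite /total addrK => ->.
have hVa z : ~~ win z -> app V a z = 0.
  by move=> wz; rewrite /app big1 // => w _; rewrite hV ?mul0r // (negbTE wz).
apply/funext => x; rewrite {1}/app; have [hx|hx] := boolP (complete_sector x); last first.
  rewrite (bigD1 x) //= big1 ?addr0 => [|b ne]; last first.
    by rewrite /sector_lift (negbTE hx) /= eq_sym (negbTE ne) mul0r.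
  rewrite /sector_lift (negbTE hx) /= eqxx mul1r /restrict; case: ifP => // hc.
  have wx : ~~ win x.1 by apply: contra hx; apply: core_complete.
  by rewrite /vtens ha // hVa // !mul0r.
have wx : win x.1 by case/andP: hx.
pose k := ((Num.sqrt (size S)%:R)^-1)%:C : C.
transitivity (\sum_b (if complete_sector b && (total x == total b)
   then V x.1 b.1 * a b.1 * (if core (total x) then k else 0) else 0)).
  apply: eq_bigr => b _; rewrite /sector_lift hx /=.
  have [hb|hb] /= := boolP (complete_sector b); last first.
    have [e|_] := eqVneq x b; last by rewrite mul0r.
    by rewrite -e hx in hb.
  have wb : win b.1 by case/andP: hb.
  case: eqP => [e|_]; last by rewrite mulr0 mul0r.
  rewrite mulr1 /restrict -e; case: ifP => hc; last by rewrite !mulr0.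
  by rewrite /vtens core_flat -?e // mulrA.
rewrite (sector_sum (fun z => V x.1 z * a z * (if core (total x) then k else 0)) hx).
rewrite -mulr_suml /restrict; case: ifP => hc; last by rewrite mulr0.
rewrite /vtens core_flat //; congr (_ * _).
rewrite /app big_mkcond; apply: eq_bigr => z _; case: ifP => // wz.
by rewrite hV ?mul0r // wz andbF.
Qed.

(** The core parts cancel by [lift_core]; the two noncore parts are bounded through [defect], the
    lift being unitary. *)
Lemma lift_approx V (a : Z -> C) : win_unitary V ->
  (forall z z', ~~ (win z && win z') -> V z z' = 0) -> (forall z, ~~ win z -> a z = 0) ->
  norm2 (fun b => app (sector_lift V) (vtens a flat) b - vtens (app V a) flat b) <=
  2 * (defect * (norm2 a + norm2 (app V a))).
Proof.
move=> uV hV ha.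
have hVa z : ~~ win z -> app V a z = 0.
  by move=> wz; rewrite /app big1 // => w _; rewrite hV ?mul0r // (negbTE wz).
pose nc b := ~~ core (total b).
have split f b : f b = restrict (fun b => core (total b)) f b + restrict nc f b.
  by rewrite /restrict /nc; case: (core _); rewrite ?addr0 ?add0r.
have appD f g : app (sector_lift V) (fun b => f b + g b) = fun b => app (sector_lift V) f b + app (sector_lift V) g b.
  by apply/funext => x; rewrite /app -big_split; apply: eq_bigr => b _; rewrite /= mulrDr.
have -> : (fun b => app (sector_lift V) (vtens a flat) b - vtens (app V a) flat b) =
   fun b => app (sector_lift V) (restrict nc (vtens a flat)) b + - restrict nc (vtens (app V a) flat) b.
  apply/funext => b; rewrite [in LHS](_ : vtens a flat = fun b => restrict (fun b => core (total b)) (vtens a flat) b + restrict nc (vtens a flat) b); last first.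
    by apply/funext => b'; apply: split.
  by rewrite appD lift_core // [vtens (app V a) flat b]split; ring.
apply: le_trans (norm2D_le _ _) _; rewrite norm2N norm2_unitary; last exact: lift_unitary.
by rewrite ler_pM2l // mulrDr lerD // noncore_norm2.
Qed.
End Lift.

(** * Compression to a window of charges *)

Section Mixtures.
Variable R : rcfType.
Local Notation C := (complex R).
Local Notation "x %:C" := (real_complex R x) (at level 1, format "x %:C").
Local Notation cj := (@conjc R).
Implicit Types I J K : finType.

(** The difference of the projections on [a] and [b] is the outer product of [a - b] with [a] plus
    that of [b] with [a - b]. Giving the short vector the scale [t] yields [t * eta + t^-1], of the
    order of the square root of [eta] for the best [t]. *)
Lemma nuc_mix_vectors I J (w : J -> R) (a b : J -> I -> C) (eta t : R) :
  (forall j, 0 <= w j) -> \sum_j w j <= 1 -> 0 < t ->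
  (forall j, norm2 (a j) <= 1) -> (forall j, norm2 (b j) <= 1) ->
  \sum_j w j * norm2 (fun x => a j x - b j x) <= eta ->
  nuc (fun x y => mix w a x y - mix w b x y) (t * eta + t^-1).
Proof.
move=> w0 w1 t0 a1 b1 hd.
pose D j x := a j x - b j x.
have ti : 0 < t^-1 by rewrite invr_gt0.
have hj j : nuc (fun x y => (w j)%:C * outer (D j) (a j) x y + (w j)%:C * outer (b j) (D j) x y)
    (w j * (t * norm2 (D j) + t^-1)).
  apply: nuc_le (nucD (nuc_outer _ _ _ t0) (nuc_outer _ _ _ ti)) _.
  rewrite (ger0_norm (w0 j)) invrK -mulrDl -mulrDr -mulrA ler_wpM2l //.
  rewrite ler_pdivrMr // [leRHS](_ : _ = t * norm2 (D j) + t^-1 * 1 + (t^-1 * 1 + t * norm2 (D j))); last by ring.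
  by rewrite lerD // lerD // ler_pM2l.
apply: nuc_le (nuc_ext (nuc_sum (index_enum J) (P := xpredT) (fun j _ => hj j)) _) _.
  move=> x y; rewrite /mix -sumrB; apply: eq_bigr => j _.
  rewrite /outer /D [cj (_ - _)](rmorphB (@conjc R)) /=; ring.
under eq_bigr do rewrite mulrDr mulrCA.
rewrite big_split /= -mulr_sumr -mulr_suml lerD ?ler_pM2l //.
by rewrite -[leRHS]mul1r ler_pM2r.
Qed.

Lemma nuc_mix_weights I J (w u : J -> R) (a : J -> I -> C) (eta : R) :
  (forall j, norm2 (a j) <= 1) -> \sum_j `|w j - u j| <= eta ->
  nuc (fun x y => mix w a x y - mix u a x y) eta.
Proof.
move=> a1 hd.
apply: nuc_le (nuc_ext (nuc_sum (index_enum J) (P := xpredT)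
   (fun j _ => nuc_outer (w j - u j) (a j) (a j) ltr01)) _) _.
  move=> x y; rewrite /mix -sumrB; apply: eq_bigr => j _.
  by rewrite rmorphB /= mulrBl.
apply: le_trans hd; apply: ler_sum => j _; rewrite -mulrA ler_piMr //.
by have := a1 j; have := norm2_ge0 (a j); rewrite invr1 !mul1r; lra.
Qed.

Lemma mix_reindex I J K (h : K -> J) (w : J -> R) (a : J -> I -> C) : bijective h ->
  mix w a = mix (fun k => w (h k)) (fun k => a (h k)).
Proof. by move=> bh; apply: op_ext => x y; rewrite /mix (reindex h) //; apply: onW_bij. Qed.

Definition pull I J (h : I -> J) (X : J -> J -> C) : I -> I -> C :=
  fun x y => X (h x) (h y).

Lemma pull_mul I J (h : I -> J) (X Y : J -> J -> C) : bijective h ->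
  opmul (pull h X) (pull h Y) = pull h (opmul X Y).
Proof.
move=> bh; apply: op_ext => x y; rewrite /opmul /pull [RHS](reindex h) //.
exact: onW_bij.
Qed.
Lemma pull_adj I J (h : I -> J) (X : J -> J -> C) :
  opadj (pull h X) = pull h (opadj X).
Proof. by []. Qed.
Lemma pull_unitary I J (h : I -> J) (U : J -> J -> C) : bijective h ->
  opunitary U -> opunitary (pull h U).
Proof.
move=> bh [u1 u2]; split; rewrite pull_adj pull_mul // ?u1 ?u2; apply: op_ext => x y.
  by rewrite /pull /opid (inj_eq (bij_inj bh)).
by rewrite /pull /opid (inj_eq (bij_inj bh)).
Qed.
Lemma norm2_comp I J (h : I -> J) (v : J -> C) : bijective h ->
  norm2 (v \o h) = norm2 v.
Proof. by move=> bh; rewrite /norm2 [RHS](reindex h) //; apply: onW_bij. Qed.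
Lemma app_pull I J (h : I -> J) (U : J -> J -> C) (v : J -> C) : bijective h ->
  app (pull h U) (v \o h) = app U v \o h.
Proof.
move=> bh; apply/funext => x; rewrite /app /pull /= [RHS](reindex h) //.
exact: onW_bij.
Qed.

Lemma sum_sig I (P : pred I) (V : nmodType) (F : I -> V) :
  \sum_(w : {y | P y}) F (val w) = \sum_(y | P y) F y.
Proof.
rewrite [RHS](reindex_omap (val : {y | P y} -> I) insub) /= => [|y Py]; last by rewrite insubT.
by apply: eq_bigl => w; rewrite valK eqxx (valP w).
Qed.

(* If a mixture of [m] rank-one operators has [k] nonzero eigenvalues, the identity of size [k] factors through dimension [m]. *)
Lemma mix_rank I J (p : I -> R) (v : I -> I -> C) (w : J -> R) (a : J -> I -> C) :
  onb v -> mix p v = mix w a ->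
  (#|[pred j | p j != 0%R]| <= #|[pred x | w x != 0%R]|)%N.
Proof.
move=> hv e.
pose P := [pred j | p j != 0]; pose Q := [pred x | w x != 0].
pose K : 'M[C]_(#|P|, #|Q|) := \matrix_(i, x)
   ((p (enum_val i))^-1%:C * (w (enum_val x))%:C * dot (a (enum_val x)) (v (enum_val i))).
pose L : 'M[C]_(#|Q|, #|P|) := \matrix_(x, i) dot (v (enum_val i)) (a (enum_val x)).
suff KL : K *m L = 1%:M.
  by rewrite -(mxrank1 C #|P|) -KL; apply: mulmx_max_rank.
apply/matrixP => i i'; rewrite !mxE.
have pi : p (enum_val i) != 0 by have := enum_valP i; rewrite inE.
pose F x := (w x)%:C * dot (a x) (v (enum_val i)) * dot (v (enum_val i')) (a x).
have eF : \sum_x F x = dot (v (enum_val i')) (app (mix w a) (v (enum_val i))).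
  rewrite [RHS]/dot; under [in RHS]eq_bigr do rewrite app_mix mulr_sumr.
  rewrite exchange_big; apply: eq_bigr => x _ /=; rewrite /F [dot _ (a x)]/dot mulr_sumr.
  by apply: eq_bigr => y _; ring.
transitivity ((p (enum_val i))^-1%:C * \sum_(x in Q) F x).
  rewrite mulr_sumr (big_enum_val (fun x => (p (enum_val i))^-1%:C * F x)).
  by apply: eq_bigr => x _; rewrite !mxE /F -!mulrA.
have -> : \sum_(x in Q) F x = \sum_x F x.
  rewrite [RHS](bigID (mem Q)) /= [X in _ = _ + X]big1 ?addr0 // => x.
  by rewrite inE negbK => /eqP h; rewrite /F h !mul0r.
rewrite eF -e app_mix_onb // /dot.
under eq_bigr do rewrite mulrCA.
rewrite -mulr_sumr -/(dot _ _) (proj1 hv) mulrA -rcM mulVf // mul1r.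
by rewrite (inj_eq enum_val_inj) eq_sym.
Qed.

(** An orthonormal basis of the span of the window coordinates. The index type [K] is free, so that
    such bases can be tensored and then reindexed by sorted position. *)
Definition wbasis I K (win : pred I) (v : K -> I -> C) : Prop :=
  [/\ forall k y, ~~ win y -> v k y = 0,
      forall k l, dot (v k) (v l) = (k == l)%:R &
      forall y y', win y -> win y' -> \sum_k v k y * cj (v k y') = (y == y')%:R].

Lemma wbasis_norm2 I K (win : pred I) (v : K -> I -> C) k : wbasis win v -> norm2 (v k) = 1.
Proof. by case=> _ h _; rewrite norm2_Re h eqxx. Qed.

Definition unit_vec I (i : I) : I -> C := fun j => (i == j)%:R.

Lemma unit_vec_onb I : onb (@unit_vec I).
Proof.
split=> [i j|x y]; rewrite /dot /unit_vec.
  by under eq_bigr do rewrite conjc_nat; rewrite sum_delta eq_sym.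
by under eq_bigr do rewrite conjc_nat; rewrite sum_deltar eq_sym.
Qed.

Lemma wbasis_tens I J K (win : pred I) (v : K -> I -> C) (g : J -> J -> C) :
  wbasis win v -> onb g ->
  wbasis (fun z : I * J => win z.1) (fun a : K * J => vtens (v a.1) (g a.2)).
Proof.
case=> h1 h2 h3 [g1 g2]; split=> [k y wy|[k i] [l j]|[y i] [y' i'] /= wy wy'].
- by rewrite /vtens h1 // mul0r.
- by rewrite dot_vtens h2 g1 -natrM mulnb xpair_eqE.
rewrite xpair_eqE -mulnb natrM -h3 // -g2 big_distrlr /= pair_bigA /=.
by apply: eq_bigr => -[k j] _; rewrite /vtens /= cjM; ring.
Qed.

Lemma wbasis_reindex I K K' (win : pred I) (v : K -> I -> C) (h : K' -> K) :
  bijective h -> wbasis win v -> wbasis win (fun k => v (h k)).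
Proof.
move=> bh [h1 h2 h3]; split=> [k y|k l|y y' wy wy']; first exact: h1.
  by rewrite h2 (inj_eq (bij_inj bh)).
by rewrite -h3 // [RHS](reindex h) //; apply: onW_bij.
Qed.

(** The partial isometry that takes [E k] to [F k]. *)
Definition transfer I K (E F : K -> I -> C) : I -> I -> C :=
  fun z z' => \sum_k F k z * cj (E k z').

Lemma transfer_adj I K (E F : K -> I -> C) : opadj (transfer E F) = transfer F E.
Proof.
apply: op_ext => x y; rewrite /opadj /transfer cj_sum; apply: eq_bigr => k _.
by rewrite cjM conjcK mulrC.
Qed.

Lemma transfer_mul I K (win : pred I) (E F : K -> I -> C) z z' : wbasis win E -> wbasis win F ->
  win z -> win z' -> \sum_(w | win w) transfer E F z w * transfer F E w z' = (z == z')%:R.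
Proof.
move=> [e1 e2 e3] [f1 f2 f3] wz wz'.
transitivity (\sum_w transfer E F z w * transfer F E w z').
  rewrite [RHS](bigID win) /= [X in _ = _ + X]big1 ?addr0 // => w nw.
  by rewrite /transfer big1 ?mul0r // => k _; rewrite e1 // conjc0 mulr0.
rewrite /transfer; under eq_bigr do rewrite big_distrlr /=.
rewrite exchange_big -f3 //; apply: eq_bigr => k _ /=.
rewrite exchange_big (bigD1 k) //= [X in _ + X]big1 ?addr0 => [|l ne].
  transitivity (F k z * cj (F k z') * dot (E k) (E k)); last by rewrite e2 eqxx mulr1.
  by rewrite /dot mulr_sumr; apply: eq_bigr => w _; ring.
transitivity (F k z * cj (F l z') * dot (E k) (E l)); last by rewrite e2 eq_sym (negbTE ne) mulr0.
by rewrite /dot mulr_sumr; apply: eq_bigr => w _; ring.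
Qed.

Lemma transfer_unitary I K (win : pred I) (E F : K -> I -> C) :
  wbasis win E -> wbasis win F -> win_unitary win (transfer E F).
Proof. by move=> hE hF z z' wz wz'; rewrite transfer_adj; split; apply: transfer_mul. Qed.

Lemma transfer_supp I K (win : pred I) (E F : K -> I -> C) z z' :
  wbasis win E -> wbasis win F -> ~~ (win z && win z') -> transfer E F z z' = 0.
Proof.
move=> [e1 _ _] [f1 _ _]; rewrite negb_and => /orP[h|h]; rewrite /transfer big1 // => k _.
  by rewrite f1 // mul0r.
by rewrite e1 // conjc0 mulr0.
Qed.

Lemma app_transfer I K (win : pred I) (E F : K -> I -> C) k :
  wbasis win E -> app (transfer E F) (E k) = F k.
Proof.
case=> _ e2 _; apply/funext => x; rewrite /app /transfer.
under eq_bigr do rewrite mulr_suml.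
rewrite exchange_big (bigD1 k) //= [X in _ + X]big1 ?addr0 => [|l ne].
  transitivity (F k x * dot (E k) (E k)); last by rewrite e2 eqxx mulr1.
  by rewrite /dot mulr_sumr; apply: eq_bigr => w _; ring.
transitivity (F l x * dot (E l) (E k)); last by rewrite e2 (negbTE ne) mulr0.
by rewrite /dot mulr_sumr; apply: eq_bigr => w _; ring.
Qed.
End Mixtures.

Section Compress.
Variables (R : realType) (I : finType) (win typ : pred I) (w : I -> R).
Local Notation C := (complex R).
Local Notation "x %:C" := (real_complex R x) (at level 1, format "x %:C").
Local Notation cj := (@conjc R).
Variables (e : I -> I -> C) (lam D eta1 eta2 : R).
Hypotheses (w0 : forall x, 0 <= w x) (w1 : \sum_x w x = 1) (he : onb e).
Hypotheses (lam0 : 0 <= lam) (typ_le : forall x, typ x -> w x <= lam).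
Hypothesis typ_card : #|[pred x | typ x]|%:R <= D.
Hypothesis win_mass : \sum_(y | ~~ win y) \sum_x w x * abs2 (e x y) <= eta1.
Hypothesis typ_mass : \sum_(x | ~~ typ x) w x <= eta2.
Local Notation W := {y : I | win y}.

Let wt x := if typ x then w x else 0.
Let eW x (y : W) := e x (val y).
Let eP x y := if win y then e x y else 0.

Lemma wt_ge0 x : 0 <= wt x.
Proof. by rewrite /wt; case: ifP. Qed.
Lemma wt_le x : wt x <= w x.
Proof. by rewrite /wt; case: ifP. Qed.

Definition extend (v : W -> C) (y : I) : C := oapp v 0 (insub y).

Lemma extend_val v (y : W) : extend v (val y) = v y.
Proof. by rewrite /extend valK. Qed.
Lemma extend_sub v y (wy : win y) : extend v y = v (Sub y wy).
Proof. by rewrite -[in RHS]extend_val. Qed.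
Lemma extend_out v y : ~~ win y -> extend v y = 0.
Proof. by move=> ny; rewrite /extend insubN. Qed.

Lemma dot_extend (a : I -> C) v : dot a (extend v) = \sum_(y : W) cj (a (val y)) * v y.
Proof.
rewrite /dot (bigID win) /= [X in _ + X]big1 ?addr0; last first.
  by move=> y ny; rewrite extend_out // mulr0.
rewrite -(sum_sig win (fun y => cj (a y) * extend v y)).
by apply: eq_bigr => y _; rewrite extend_val.
Qed.

Lemma extend_wbasis (v : W -> W -> C) : onb v -> wbasis win (fun j => extend (v j)).
Proof.
case=> v1 v2; split=> [k y ny|k l|y y' wy wy']; first exact: extend_out.
  rewrite dot_extend -v1; apply: eq_bigr => y _; by rewrite extend_val.
have -> : y = val (Sub y wy : W) by []. have -> : y' = val (Sub y' wy' : W) by [].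
by under eq_bigr do rewrite !extend_val; rewrite v2.
Qed.

Lemma norm2_eW x : norm2 (eW x) = \sum_(y | win y) abs2 (e x y).
Proof. by rewrite /norm2 /eW (sum_sig win (fun y => abs2 (e x y))). Qed.
Lemma norm2_eW_split x : norm2 (eW x) = 1 - \sum_(y | ~~ win y) abs2 (e x y).
Proof.
by rewrite norm2_eW -(onb_norm2 x he) /norm2 [in RHS](bigID win) /= addrK.
Qed.
Lemma norm2_eW_le1 x : norm2 (eW x) <= 1.
Proof. by rewrite norm2_eW_split lerBlDr lerDl; apply: sumr_ge0 => y _; apply: abs2_ge0. Qed.

(** The mixture is cut twice, by dropping atypical terms and by truncating the vectors to the
    window, and then rediagonalised over the window. The new eigenvalues are weighted averages of
    numbers at most [lam], by Parseval, and the rank is at most the number of typical terms, by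
    [mix_rank]. The first cut changes weights and costs [eta2]; the second changes vectors and costs
    [t * eta1 + t^-1]. *)
Lemma compress : exists (p : W -> R) (v : W -> I -> C),
  [/\ wbasis win v, spectrum p (eta1 + eta2) lam D &
      forall t, 0 < t ->
        nuc (fun x y => mix w e x y - mix p v x y) (eta2 + (t * eta1 + t^-1))].
Proof.
have [v [p [hv ep]]] := spectral_op (mix_herm wt eW).
have pE j : p j = \sum_x wt x * abs2 (dot (eW x) (v j)).
  apply: complexI; rewrite -dot_mix ep app_mix_onb // /dot.
  under eq_bigr do rewrite mulrCA.
  by rewrite -mulr_sumr -/(dot _ _) (proj1 hv) eqxx mulr1.
have dotE x j : dot (eW x) (v j) = dot (e x) (extend (v j)) by rewrite dot_extend.
have hw := extend_wbasis hv.
have psum : \sum_j p j = \sum_x wt x * norm2 (eW x).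
  apply: complexI; rewrite -optr_mix ep optr_mix; congr (_ %:C).
  by apply: eq_bigr => j _; rewrite onb_norm2 // mulr1.
have atyp : \sum_x (w x - wt x) <= eta2.
  apply: le_trans typ_mass; rewrite [leRHS]big_mkcond; apply: ler_sum => x _.
  by rewrite /wt; case: ifP => _ /=; rewrite ?subrr ?subr0.
have outmass : \sum_x w x * \sum_(y | ~~ win y) abs2 (e x y) <= eta1.
  apply: le_trans win_mass; rewrite exchange_big /=.
  by apply: ler_sum => x _; rewrite mulr_sumr.
have out0 x : 0 <= \sum_(y | ~~ win y) abs2 (e x y).
  by apply: sumr_ge0 => y _; apply: abs2_ge0.
exists p, (fun j => extend (v j)); split=> // [|t t0].
- split.
  + by move=> j; rewrite pE; apply: sumr_ge0 => x _; rewrite mulr_ge0 ?wt_ge0 ?abs2_ge0.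
  + rewrite psum -w1; apply: ler_sum => x _; apply: le_trans (wt_le x).
    by rewrite ler_piMr ?wt_ge0 ?norm2_eW_le1.
  + have -> : \sum_j p j = 1 - \sum_x (w x - wt x * norm2 (eW x)).
      by rewrite sumrB w1 psum opprB addrC subrK.
    rewrite lerD2l lerN2 addrC; apply: le_trans (lerD atyp outmass).
    rewrite -big_split; apply: ler_sum => x _ /=; rewrite norm2_eW_split.
    by have := wt_le x; have := out0 x; have := wt_ge0 x; nra.
  + move=> j; rewrite pE; apply: (@le_trans _ _ (\sum_x lam * abs2 (dot (e x) (extend (v j))))).
      apply: ler_sum => x _; rewrite dotE ler_wpM2r ?abs2_ge0 //.
      by rewrite /wt; case: ifP => // /typ_le.
    by rewrite -mulr_sumr parseval // (wbasis_norm2 j hw) mulr1.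
  apply: le_trans typ_card; rewrite ler_nat; apply: leq_trans (mix_rank hv (esym ep)) _.
  by apply/subset_leq_card/subsetP => x; rewrite !inE /wt; case: (typ x); rewrite ?eqxx.
(* Extended by zero, the diagonalised operator is the mixture of the truncated vectors [eP], so it
   can be compared with the original on the full space. *)
have e2 : mix p (fun j => extend (v j)) = mix wt eP.
  apply: op_ext => y y'; rewrite /mix.
  have [wy|wy] := boolP (win y); last first.
    by rewrite !big1 // => j _; rewrite /outer /eP ?(negbTE wy) ?(extend_out _ wy) mul0r mulr0.
  have [wy'|wy'] := boolP (win y'); last first.
    by rewrite !big1 // => j _; rewrite /outer /eP ?(negbTE wy') ?(extend_out _ wy') conjc0 !mulr0.
  have := congr1 (fun X => X (Sub y wy) (Sub y' wy')) ep; rewrite /mix /outer => h.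
  rewrite /eP wy wy' -[RHS]/(\sum_j (wt j)%:C * (eW j (Sub y wy) * cj (eW j (Sub y' wy')))) h.
  by apply: eq_bigr => j _; rewrite (extend_sub _ wy) (extend_sub _ wy').
rewrite e2; apply: (@nucB _ _ _ (mix wt e)).
  apply: nuc_mix_weights => [j|]; first by rewrite onb_norm2.
  apply: le_trans atyp; apply: ler_sum => x _.
  by rewrite ger0_norm // subr_ge0 wt_le.
have eD x : norm2 (fun y => e x y - eP x y) = \sum_(y | ~~ win y) abs2 (e x y).
  rewrite /norm2 [RHS]big_mkcond; apply: eq_bigr => y _; rewrite /eP.
  by case: (win y) => /=; rewrite ?subrr ?abs20 ?subr0.
apply: nuc_mix_vectors => //; first exact: wt_ge0.
- by rewrite -w1; apply: ler_sum => x _; apply: wt_le.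
- by move=> x; rewrite onb_norm2.
- move=> x; apply: le_trans (norm2_eW_le1 x); rewrite norm2_eW /norm2 [leRHS]big_mkcond.
  by apply: ler_sum => y _; rewrite /eP; case: ifP => // _; rewrite abs20.
apply: le_trans outmass; apply: ler_sum => x _; rewrite eD.
by rewrite ler_wpM2r ?wt_le.
Qed.
End Compress.

(** * The conversion at fixed length *)

Section Lattice.
Variables (A : finType) (G : zmodType) (cl : A -> G) (n : nat) (D : seq G).
Hypothesis hD : forall v, v \in D -> v = 0 \/ exists y y' : pw A n, v = sumf cl y - sumf cl y'.

(** The charge of a word depends only on how often each letter occurs. *)
Lemma sumf_lattice m (y : pw A m) :
  exists2 z : A -> nat, forall a, (z a <= m)%N & sumf cl y = \sum_a cl a *+ z a.
Proof.
elim: m y => [|m IH] y; first by exists (fun=> 0%N) => //=; rewrite big1.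
have [z hz e] := IH y.2; exists (fun a => (a == y.1) + z a)%N.
  by move=> a; rewrite -addn1 addnC leq_add //; case: eqP.
rewrite /= e (bigD1 y.1) //= [in RHS](bigD1 y.1) //= eqxx mulrS addrA; congr (_ + _).
by apply: eq_bigr => a /negbTE ->.
Qed.

(** Each of the [j] summands contributes differences of letter counts, which lie between [-n] and
    [n]. *)
Lemma sumset_lattice j t : t \in sumset D j ->
  exists2 z : A -> int, forall a, `|z a| <= (j * n)%:Z & t = \sum_a cl a *~ z a.
Proof.
elim: j t => [|j IH] t.
  rewrite inE => /eqP ->; exists (fun=> 0) => [a|]; first by rewrite normr0.
  by rewrite big1.
case/sumsetS => t' [v [/IH [z hz ->] /hD hv ->]].
case: hv => [->|[y [y' ->]]].
  by exists z; rewrite ?addr0 // => a; apply: le_trans (hz a) _; rewrite lez_nat leq_mul2r leqnSn orbT.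
have [u hu ->] := sumf_lattice y; have [u' hu' ->] := sumf_lattice y'.
exists (fun a => z a + ((u a)%:Z - (u' a)%:Z)) => [a|].
  by have := hz a; have := hu a; have := hu' a; rewrite mulSn; lia.
rewrite -sumrB -big_split; apply: eq_bigr => a _ /=.
by rewrite mulrzDr mulrzBr.
Qed.

(** Each of the [#|A|] integer coefficients takes one of [2 j n + 1] values, so for a fixed alphabet
    the size is polynomial in [j] and [n]. *)
Lemma sumset_size_le j : (size (sumset D j) <= (2 * (j * n)).+1 ^ #|A|)%N.
Proof.
pose K := (2 * (j * n))%N.
pose F (f : {ffun A -> 'I_K.+1}) : G := \sum_a cl a *~ ((f a)%:Z - (j * n)%:Z).
rewrite -[in leqRHS](card_ord K.+1) -card_ffun cardE -(size_map F).
apply: uniq_leq_size; first exact: sumset_uniq.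
move=> t /sumset_lattice [z hz ->]; apply/mapP.
exists [ffun a => inord (absz (z a + (j * n)%:Z)%R)]; first by rewrite mem_enum.
apply: eq_bigr => a _; congr (_ *~ _); rewrite ffunE inordK; have := hz a; lia.
Qed.
End Lattice.

Section FixedLength.
Variables (R : realType) (A : finType) (q : nat) (l : 'I_q -> A -> R).
Local Notation C := (complex R).
Local Notation "x %:C" := (real_complex R x) (at level 1, format "x %:C").
Variables (r s : A -> R) (e f : A -> A -> C).
Hypotheses (r0 : forall a, 0 <= r a) (r1 : \sum_a r a = 1) (he : onb e).
Hypotheses (s0 : forall a, 0 <= s a) (s1 : \sum_a s a = 1) (hf : onb f).
Variable M : 'I_q -> R.
Variables (n N j : nat) (width t lam eps eta1 eta2 tau : R) (a b : nat).
Hypotheses (N0 : (0 < N)%N).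
Let S := shannon r.
Hypothesis S_eq : shannon s = S.
Hypotheses (lam0 : 0 <= lam) (lam_r : forall x : pw A n, typical r t x -> prodw r x <= lam)
  (lam_s : forall x : pw A n, typical s t x -> prodw s x <= lam).

Definition charge_window (y : pw A n) : bool :=
  [forall k, `|sumf (l k) y - n%:R * M k| <= n%:R * width].
Let win := charge_window.

Hypothesis mass_r : \sum_(y | ~~ win y) prodw (diag_weight r e) y <= eta1.
Hypothesis mass_s : \sum_(y | ~~ win y) prodw (diag_weight s f) y <= eta1.
Hypothesis atyp_r : \sum_(x : pw A n | ~~ typical r t x) prodw r x <= eta2.
Hypothesis atyp_s : \sum_(x : pw A n | ~~ typical s t x) prodw s x <= eta2.

Definition charge_vec (x : A) : {ffun 'I_q -> R} := [ffun k => l k x].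
(** The leading [0] makes the sumsets increasing, also when the window is empty. *)
Definition shifts : seq {ffun 'I_q -> R} :=
  0 :: [seq sumf charge_vec y - sumf charge_vec y' | y <- enum win, y' <- enum win].
Let G := sumset shifts.

Hypothesis folner : (size (G j.+1))%:R <= (1 + eps) * (size (G j))%:R :> R.
Hypotheses (eps0 : 0 < eps) (tau0 : 0 < tau).
Hypotheses (ab : (0 < a <= b)%N) (ha : a%:R * lam <= 2)
  (hb : expR (n%:R * (S + t)) * N%:R <= b%:R).

Lemma sumf_charge m (y : pw A m) k : sumf charge_vec y k = sumf (l k) y.
Proof. by elim: m y => [|m IH] y /=; rewrite ffunE // IH ffunE. Qed.

Lemma shifts0 : 0 \in shifts.
Proof. exact: mem_head. Qed.
Lemma shifts_win y y' : win y -> win y' -> sumf charge_vec y - sumf charge_vec y' \in shifts.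
Proof. by move=> wy wy'; rewrite inE; apply/orP; right; apply: allpairs_f; rewrite mem_enum. Qed.
Lemma shiftsP v : v \in shifts ->
  v = 0 \/ exists y y' : pw A n, v = sumf charge_vec y - sumf charge_vec y'.
Proof. by rewrite inE => /predU1P[|/allpairsP[[y y'] [_ _ ->]]]; [left|right; exists y, y']. Qed.

(** This is where the window pays off: a difference of two window charges is at most [2 n width] in
    each component, whereas arbitrary words would allow order [n]. *)
Lemma sumset_charge i g k : 0 <= width -> g \in G i -> `|g k| <= i%:R * (2 * (n%:R * width)).
Proof.
move=> w0; elim: i g => [|i IH] g.
  by rewrite inE => /eqP ->; rewrite ffunE normr0 mul0r.
case/sumsetS => g' [v [/IH hg]].
rewrite inE => /predU1P hv ->; rewrite ffunE -natr1 mulrDl mul1r.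
apply: le_trans (ler_normD _ _) _; apply: lerD => //.
case: hv => [->|/allpairsP[[y y'] /= [wy wy' ->]]].
  by rewrite ffunE normr0 !mulr_ge0.
rewrite !mem_enum in wy wy'; rewrite !ffunE !sumf_charge.
have /forallP/(_ k) := wy; have /forallP/(_ k) := wy'.
by rewrite !ler_norml => /andP[h1 h2] /andP[h3 h4]; apply/andP; split; lra.
Qed.

Local Notation Lam := (G j.+2).
(** The register of the embezzling state times the labels of the frame. Labels run over [G j.+2],
    the superposition is spread over [G j.+1], and [G j] is the set [S0] of labels that tolerate one
    shift. Only the label carries charge. *)
Definition ancilla : finType := ('I_N * seq_sub Lam)%type.
Definition ancilla_vec (i : 'I_N) : ancilla -> C :=
  vtens (@unit_vec R _ i) (flat R (Lam := Lam) (G j.+1)).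
Definition ancilla_charge (k : 'I_q) (x : ancilla) : R := (val x.2) k.

Lemma norm2_ancilla_vec i : norm2 (ancilla_vec i) = 1.
Proof.
rewrite norm2_vtens (onb_norm2 i (@unit_vec_onb R _)) mul1r norm2_flat //.
- exact: sumset_uniq.
- by apply: sumset_size_gt0; apply: shifts0.
- by apply: sumset_sub; apply: shifts0.
Qed.

Lemma card_ancilla : (#|ancilla| = N * size Lam)%N.
Proof. by rewrite card_prod card_ord card_seq_sub // sumset_uniq. Qed.

(** Four nuclear distances add up: compressing the first state, replacing the lifted unitary by the
    exact transfer of eigenvectors, exchanging the matched spectra, and undoing the compression of
    the second state. The sorting bijections of [matching] dictate which eigenvector goes to
    which. *)
Lemma fixed_length : exists U : pw A n * ancilla -> pw A n * ancilla -> C,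
  [/\ opunitary U,
      (forall x y, U x y != 0 -> forall k,
         sumf (l k) x.1 + ancilla_charge k x.2 = sumf (l k) y.1 + ancilla_charge k y.2) &
      nuc (fun x y => opconj U (optens (tpow (mix r e) (n := n)) (mix (@embezzle R N) ancilla_vec)) x y
            - optens (tpow (mix s f) (n := n)) (mix (@embezzle R N) ancilla_vec) x y)
        (2 * (eta2 + (tau * eta1 + tau^-1)) + (tau * (4 * eps) + tau^-1) +
         (2 * ((ln b%:R - ln a%:R) / harmonic R N - 1 + (eta1 + eta2)) + 8 / harmonic R N))].
Proof.
have mr : \sum_(y | ~~ win y) \sum_x prodw r x * abs2 (tpow e (n := n) x y) <= eta1.
  by apply: le_trans mass_r; apply: ler_sum => y _; rewrite tpow_diag_weight.
have ms : \sum_(y | ~~ win y) \sum_x prodw s x * abs2 (tpow f (n := n) x y) <= eta1.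
  by apply: le_trans mass_s; apply: ler_sum => y _; rewrite tpow_diag_weight.
have cr := typical_card r0 r1 t n.
have cs := typical_card s0 s1 t n; rewrite S_eq in cs.
have [p [v [hv hp np]]] := compress (prodw_ge0 r0 (n := n)) (prodw_sum r1 n) (tpow_onb n he)
   lam0 lam_r cr mr atyp_r.
have [p' [v' [hv' hp' np']]] := compress (prodw_ge0 s0 (n := n)) (prodw_sum s1 n) (tpow_onb n hf)
   lam0 lam_s cs ms atyp_s.
have [h [h' [bh bh' dist]]] := matching N0 hp hp' ab ha hb.
pose E0 := fun a : {y | win y} * 'I_N => vtens (v a.1) (@unit_vec R _ a.2).
pose F0 := fun a : {y | win y} * 'I_N => vtens (v' a.1) (@unit_vec R _ a.2).
pose E k := E0 (h k); pose F k := F0 (h' k).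
pose P k := p (h k).1 * embezzle R (h k).2.
pose Q k := p' (h' k).1 * embezzle R (h' k).2.
pose win2 := fun z : pw A n * 'I_N => win z.1.
have hE : wbasis win2 E.
  by apply: wbasis_reindex => //; apply: wbasis_tens => //; apply: unit_vec_onb.
have hF : wbasis win2 F.
  by apply: wbasis_reindex => //; apply: wbasis_tens => //; apply: unit_vec_onb.
pose c (z : pw A n * 'I_N) := sumf charge_vec z.1.
pose V := transfer E F.
pose g (x : pw A n * ancilla) : (pw A n * 'I_N) * seq_sub Lam := ((x.1, x.2.1), x.2.2).
have bg : bijective g by exists (fun x => (x.1.1, (x.1.2, x.2))) => [[? []]|[[]]].
pose U := pull g (sector_lift c win2 V).
have uV : win_unitary win2 V := transfer_unitary hE hF.
have uU : opunitary U by apply: pull_unitary bg _; apply: lift_unitary.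
pose fl := flat R (Lam := Lam) (G j.+1).
have split_vec (u : pw A n -> C) i :
    vtens u (ancilla_vec i) = vtens (vtens u (@unit_vec R _ i)) fl \o g.
  by apply/funext => x; rewrite /vtens /ancilla_vec /vtens /= mulrA.
have mixE (p0 : {y | win y} -> R) u (h0 : 'I_#|{: {y | win y} * 'I_N}| -> {y | win y} * 'I_N) :
    bijective h0 ->
    optens (mix p0 u) (mix (embezzle R (N := N)) ancilla_vec) =
    mix (fun k => p0 (h0 k).1 * embezzle R (h0 k).2)
      (fun k => vtens (vtens (u (h0 k).1) (@unit_vec R _ (h0 k).2)) fl \o g).
  move=> bh0; rewrite mix_tens (mix_reindex _ _ bh0); congr mix.
  by apply/funext => k; rewrite split_vec.
have mu0 := embezzle_ge0 R N0; have mu1 := embezzle_sum R N0.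
exists U; split=> // [x y nz k|].
  have /(congr1 (fun u : {ffun 'I_q -> R} => u k)) := lift_conserve nz.
  by rewrite /total /c !ffunE !sumf_charge /ancilla_charge /= addrC => ->; rewrite addrC.
(* Growth by a factor of at most [1 + eps] from [G j] to [G j.+1] means that at most a fraction
   [eps] of the labels is new. *)
have def : defect R (G j.+1) (G j) <= eps.
  have sz : 0 < (size (G j.+1))%:R :> R by rewrite ltr0n sumset_size_gt0 // shifts0.
  rewrite /defect ler_pdivrMr //.
  have le : (size (G j))%:R <= (size (G j.+1))%:R :> R.
    by rewrite ler_nat; apply: uniq_leq_size (sumset_uniq _ _) _; apply: sumset_sub shifts0 _.
  have := folner; have := eps0; nra.
have P0 k : 0 <= P k by rewrite mulr_ge0 ?mu0 // (spectrum_ge0 hp).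
have P1 : \sum_k P k <= 1.
  apply: le_trans (spectrum_sum_le1 hp).
  have <- : \sum_(x : {y | win y} * 'I_N) p x.1 * embezzle R x.2 = \sum_k P k.
    by apply: reindex; apply: onW_bij.
  rewrite -(pair_bigA _ (fun i k => p i * embezzle R k)) /=.
  by apply: ler_sum => i _; rewrite -mulr_sumr mu1 mulr1.
have nfl : norm2 fl = 1.
  apply: norm2_flat; first exact: sumset_uniq.
    by apply: sumset_size_gt0; apply: shifts0.
  by apply: sumset_sub; apply: shifts0.
have nE k : norm2 (vtens (E k) fl \o g) = 1.
  by rewrite norm2_comp // norm2_vtens nfl mulr1 (wbasis_norm2 k hE).
have nF k : norm2 (vtens (F k) fl \o g) = 1.
  by rewrite norm2_comp // norm2_vtens nfl mulr1 (wbasis_norm2 k hF).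
(* For unit vectors [lift_approx] gives [2 * (eps * (1 + 1))]. *)
have step k : norm2 (fun x => app U (vtens (E k) fl \o g) x - (vtens (F k) fl \o g) x) <= 4 * eps.
  have -> : (fun x => app U (vtens (E k) fl \o g) x - (vtens (F k) fl \o g) x) =
      (fun x => app (sector_lift c win2 V) (vtens (E k) fl) x - vtens (app V (E k)) fl x) \o g.
    by apply/funext => x; rewrite /= (app_transfer F k hE) app_pull.
  rewrite norm2_comp //.
  have Gsub i : {subset G i <= G i.+1} by apply: sumset_sub shifts0 _.
  have shift t' z z' : t' \in G j -> win2 z -> win2 z' -> t' + c z - c z' \in G j.+1.
    by move=> ht' wz wz'; rewrite -addrA; apply: sumset_step => //; apply: shifts_win.
  have supp z z' : ~~ (win2 z && win2 z') -> V z z' = 0 by apply: transfer_supp.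
  have [E1 _ _] := hE.
  apply: le_trans (lift_approx (sumset_uniq _ _) (sumset_uniq _ _) (Gsub j) (Gsub j.+1) shift uV supp (E1 k)) _.
  rewrite (app_transfer F k hE) (wbasis_norm2 k hE) (wbasis_norm2 k hF); lra.
pose rho2 := optens (mix p v) (mix (embezzle R (N := N)) ancilla_vec).
pose sig2 := optens (mix p' v') (mix (embezzle R (N := N)) ancilla_vec).
have optensB (X Y : pw A n -> pw A n -> C) (Z : ancilla -> ancilla -> C) x y :
   optens X Z x y - optens Y Z x y = optens (fun x y => X x y - Y x y) Z x y.
  by rewrite /optens mulrBl.
have n1 := np _ tau0; have n4 := np' _ tau0.
rewrite tpow_mix tpow_mix.
have {n1} n1 : nuc (fun x y => opconj U (optens (mix (prodw r (n := n)) (tpow e (n := n)))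
    (mix (embezzle R (N := N)) ancilla_vec)) x y - opconj U rho2 x y) (eta2 + (tau * eta1 + tau^-1)).
  apply: nuc_ext (nuc_conj uU (nuc_tens mu0 mu1 norm2_ancilla_vec n1)) _ => x y.
  rewrite -opconjB; congr (opconj U _ x y); apply: op_ext => z w; by rewrite optensB.
have {n4} n4 : nuc (fun x y => sig2 x y - optens (mix (prodw s (n := n)) (tpow f (n := n)))
    (mix (embezzle R (N := N)) ancilla_vec) x y) (eta2 + (tau * eta1 + tau^-1)).
  apply: nuc_ext (nuc_tens mu0 mu1 norm2_ancilla_vec (nuc_sym n4)) _ => x y.
  by rewrite optensB.
have n2 : nuc (fun x y => opconj U rho2 x y - mix P (fun k => vtens (F k) fl \o g) x y)
    (tau * (4 * eps) + tau^-1).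
  rewrite /rho2 (mixE _ _ _ bh) opconj_mix; apply: nuc_mix_vectors => // [k|k|].
  - by rewrite norm2_unitary // nE.
  - by rewrite nF.
  apply: (@le_trans _ _ (\sum_k P k * (4 * eps))).
    by apply: ler_sum => k _; apply: ler_wpM2l; [apply: P0 | apply: step].
  by rewrite -mulr_suml ler_piMl // mulr_ge0 // ltW.
have n3 : nuc (fun x y => mix P (fun k => vtens (F k) fl \o g) x y - sig2 x y)
   (2 * ((ln b%:R - ln a%:R) / harmonic R N - 1 + (eta1 + eta2)) + 8 / harmonic R N).
  rewrite /sig2 (mixE _ _ _ bh'); apply: nuc_mix_weights => [k|]; first by rewrite nF.
  exact: dist.
apply: nuc_le (nucB n1 (nucB n2 (nucB n3 n4))) _; lra.
Qed.
End FixedLength.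

(** * Choice of the parameters *)

Section Eventually.
Variable R : realType.

Lemma eventually_linear (c x : R) : 0 < x ->
  exists n0, forall n, (n0 <= n)%N -> c <= x * n%:R.
Proof.
move=> x0; exists (Num.Def.archi_bound (`|c| / x)) => n hn.
apply: le_trans (ler_norm c) _; rewrite mulrC -ler_pdivrMr //.
apply: le_trans (ltW (archi_boundP _)) _; last by rewrite ler_nat.
by rewrite divr_ge0 // ltW.
Qed.

(** The exponential dominates its Taylor term of degree [m + 1], which beats degree [m]. *)
Lemma eventually_poly_exp (c lam : R) m : 0 < lam ->
  exists J0, forall J, (J0 <= J)%N -> c * J%:R ^+ m < expR (lam * J%:R).
Proof.
move=> l0; have h0 : 0 < lam ^+ m.+1 / (m.+1)`!%:R by rewrite divr_gt0 ?exprn_gt0 // ltr0n fact_gt0.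
have [J0 hJ] := eventually_linear c h0; exists J0 => J /hJ h.
have l1 : 0 <= lam * J%:R by rewrite mulr_ge0 // ltW.
apply: lt_le_trans (expR_ge1Dxn m l1).
apply: (@le_lt_trans _ _ ((lam * J%:R) ^+ m.+1 / (m.+1)`!%:R)); last by rewrite ltrDr ltr01.
rewrite exprMn [X in _ <= _ * X / _]exprS.
rewrite [leRHS](_ : _ = lam ^+ m.+1 / (m.+1)`!%:R * J%:R * J%:R ^+ m); last by ring.
by rewrite ler_wpM2r // exprn_ge0.
Qed.

(** The left side bounds the number of frame labels of depth at most [J + 1] when
    [n < (J + 1)^8]. *)
Lemma eventually_growth (eps : R) (d : nat) : 0 < eps ->
  exists J0, forall J, (J0 <= J)%N ->
    ((2 * (J.+1 * J.+1 ^ 8)).+1 ^ d)%:R < (1 + eps) ^+ J :> R.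
Proof.
move=> e0; have l0 : 0 < ln (1 + eps) by rewrite ln_gt0 // ltrDl.
have [J0 hJ] := eventually_poly_exp (1536 ^ d)%:R (9 * d) l0.
exists J0.+1 => J hJ0; have J1 : (0 < J)%N by apply: leq_trans hJ0.
(* [2 (J + 1)^9 + 1 <= 2 (2 J)^9 + 1 <= 3 * 512 * J^9], whence 1536. *)
apply: le_lt_trans (_ : _ <= (1536 ^ d)%:R * J%:R ^+ (9 * d)) _.
  rewrite -natrX -natrM ler_nat expnM -expnMn.
  have le_exp u v : (u <= v)%N -> (u ^ d <= v ^ d)%N.
    by case: (d) => // k uv; rewrite leq_exp2r.
  apply: le_exp; rewrite -expnS.
  have h : (J.+1 ^ 9 <= (2 * J) ^ 9)%N by rewrite leq_exp2r //; lia.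
  have h1 : (0 < J ^ 9)%N by rewrite expn_gt0 J1.
  by rewrite expnMn (_ : 2 ^ 9 = 512)%N // in h; lia.
apply: lt_le_trans (hJ _ (ltnW hJ0)) _.
by rewrite expRM_natr lnK // posrE addr_gt0.
Qed.

Lemma root8 n : exists J, (J ^ 8 <= n < J.+1 ^ 8)%N.
Proof.
have ex : exists J, (J ^ 8 <= n)%N by exists 0%N.
have ub J : (J ^ 8 <= n)%N -> (J <= n)%N.
  by move=> h; apply: leq_trans h; case: J => // J; rewrite -[leqLHS]expn1 leq_pexp2l.
case: (ex_maxnP ex ub) => J hJ mJ; exists J; rewrite hJ /= ltnNge.
by apply/negP => /mJ; rewrite ltnn.
Qed.
End Eventually.

Ltac clear_inequalities := repeat match goal with H : is_true _ |- _ => clear H end.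

Section Asymptotic.
Variables (R : realType) (A : finType) (q : nat) (l : 'I_q -> A -> R).
Local Notation C := (complex R).
Variables (r s : A -> R) (e f : A -> A -> C).

Lemma shannon_ge0 (w : A -> R) : (forall a, 0 <= w a) -> \sum_a w a = 1 -> 0 <= shannon w.
Proof.
move=> w0 w1; apply: sumr_ge0 => a _; rewrite mulr_ge0 // oppr_ge0 ln_le0 //.
by rewrite -w1 (bigD1 a) //= lerDl; apply: sumr_ge0.
Qed.

(** Chebyshev for each charge and a union bound over the charges. *)
Lemma window_mass (w : A -> R) (n : nat) (width : R) (M := fun k => \sum_a w a * l k a) :
  (forall a, 0 <= w a) -> \sum_a w a = 1 -> (0 < n)%N -> 0 < width ->
  \sum_(y : pw A n | ~~ charge_window l M width y) prodw w y <=
  (\sum_k \sum_a w a * (l k a - M k) ^+ 2) / (n%:R * width ^+ 2).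
Proof.
move=> w0 w1 n0 wd0; rewrite mulr_suml.
apply: (@le_trans _ _ (\sum_k \sum_(y : pw A n | ~~ (`|sumf (l k) y - n%:R * M k| <= n%:R * width)) prodw w y)); last first.
  by apply: ler_sum => k _; apply: chebyshev.
under [leRHS]eq_bigr do rewrite big_mkcond.
rewrite exchange_big big_mkcond; apply: ler_sum => y _ /=.
case: ifP => [|_]; last by apply: sumr_ge0 => k _; case: ifP; rewrite ?prodw_ge0.
rewrite negb_forall => /existsP[k hk]; rewrite (bigD1 k) //= hk lerDl.
by apply: sumr_ge0 => i _; case: ifP; rewrite ?prodw_ge0.
Qed.

(** The catalytic form of the conversion: the same ancilla state stands on both sides, and the
    ancilla charges are diagonal with values [h k t]. Conservation then says that [U] has no entry
    between different totals. *)
Definition protocol (n : nat) (eps : R) : Prop :=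
  exists (T K : finType) (mu : K -> R) (g : K -> T -> C) (h : 'I_q -> T -> R)
    (U : pw A n * T -> pw A n * T -> C),
  [/\ ln #|T|%:R <= eps * n%:R, forall k t, `|h k t| <= eps * n%:R,
      [/\ forall i, 0 <= mu i, \sum_i mu i = 1 & forall i, norm2 (g i) = 1],
      opunitary U /\
      (forall x y, U x y != 0 -> forall k,
         sumf (l k) x.1 + h k x.2 = sumf (l k) y.1 + h k y.2) &
      nuc (fun x y => opconj U (optens (tpow (mix r e) (n := n)) (mix mu g)) x y
            - optens (tpow (mix s f) (n := n)) (mix mu g) x y) eps].

Hypotheses (r0 : forall a, 0 <= r a) (r1 : \sum_a r a = 1) (he : onb e).
Hypotheses (s0 : forall a, 0 <= s a) (s1 : \sum_a s a = 1) (hf : onb f).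
Hypothesis S_eq : shannon s = shannon r.
Hypothesis M_eq : forall k, \sum_y diag_weight r e y * l k y = \sum_y diag_weight s f y * l k y.

Let S := shannon r.
Let M k := \sum_y diag_weight r e y * l k y.
Let M' k := \sum_y diag_weight s f y * l k y.

Lemma protocol_le1 (eps : R) : 0 < eps <= 1 ->
  exists n0, forall n, (n0 <= n)%N -> protocol n eps.
Proof.
case/andP => eps0 eps1.
(* With both masses bounded by [th^2] and [tau = 1/th], the errors of [fixed_length] come to at most
   [9 th + 6 th^2 <= 15 th]. *)
pose th : R := eps / 15; have th0 : 0 < th by rewrite divr_gt0.
have th1 : th <= eps / 2 by rewrite /th; lra.
(* Half of the allowed [eps * n] goes to the logarithm of the embezzling dimension, the other half
   to that of the frame. *)
pose kap := eps / 2; have kap0 : 0 < kap by rewrite divr_gt0.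
(* The two typicality slacks make [2 t n = th * kap * n / 2], half of what [th * H] allows; [hn2]
   keeps the other half for rounding. *)
pose t := th * kap / 4; have t0 : 0 < t by apply: divr_gt0 => //; apply: mulr_gt0.
(* Chosen so that [tau * (4 * ep)] equals [th]. *)
pose ep := th ^+ 2 / 4; have ep0 : 0 < ep by apply: divr_gt0 => //; apply: exprn_gt0.
have th2 : 0 < th ^+ 2 by rewrite exprn_gt0.
pose v := \sum_k \sum_a diag_weight r e a * (l k a - M k) ^+ 2.
pose v' := \sum_k \sum_a diag_weight s f a * (l k a - M' k) ^+ 2.
have dr0 a : 0 <= diag_weight r e a := diag_weight_ge0 e a r0.
have ds0 a : 0 <= diag_weight s f a := diag_weight_ge0 f a s0.
have dr1 := diag_weight_sum he r1.
have ds1 := diag_weight_sum hf s1.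
have v0 : 0 <= v.
  by apply: sumr_ge0 => k _; apply: sumr_ge0 => a _; rewrite mulr_ge0 ?sqr_ge0.
have v0' : 0 <= v'.
  by apply: sumr_ge0 => k _; apply: sumr_ge0 => a _; rewrite mulr_ge0 ?sqr_ge0.
have [J1 hJ1] := eventually_growth #|A| ep0.
have [J2 hJ2] := eventually_linear (v + v') th2.
have [J3 hJ3] := eventually_linear 4 eps0.
have vr0 : 0 <= entropy_variance r.
  by apply: sumr_ge0 => a _; rewrite mulr_ge0 ?sqr_ge0.
have vs0 : 0 <= entropy_variance s.
  by apply: sumr_ge0 => a _; rewrite mulr_ge0 ?sqr_ge0.
have [n1 hn1] := eventually_linear (entropy_variance r + entropy_variance s) (mulr_gt0 th2 (exprn_gt0 2 t0)).
have [n2 hn2] := eventually_linear (2 * ln 2) (mulr_gt0 kap0 (divr_gt0 th0 (ltr0n R 2))).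
have [n3 hn3] := eventually_linear 8 (mulr_gt0 kap0 th0).
pose J0 := maxn 1 (maxn J1 (maxn J2 J3)).
exists (maxn (J0 ^ 8) (maxn n1 (maxn n2 n3))) => n.
rewrite !geq_max => /and4P[nJ0 /hn1 {}hn1 /hn2 {}hn2 /hn3 {}hn3].
have [J /andP[Jn nJ]] := root8 n.
have : (J0 <= J)%N.
  by rewrite -ltnS -(ltn_exp2r _ _ (isT : 0 < 8)%N); apply: leq_ltn_trans nJ0 nJ.
rewrite !geq_max => /and4P[J_gt0 /hJ1 {}hJ1 /hJ2 {}hJ2 /hJ3 {}hJ3].
have JR : 0 < J%:R :> R by rewrite ltr0n.
have JR1 : 1 <= J%:R :> R by rewrite ler1n.
have n_gt0 : (0 < n)%N by apply: leq_trans Jn; rewrite expn_gt0 J_gt0.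
have nR : 0 < n%:R :> R by rewrite ltr0n.
have JnR : J%:R ^+ 8 <= n%:R :> R by rewrite -natrX ler_nat.
(* [n * width^2] is at least [J^4], so the Chebyshev errors vanish, while [J] window differences add
   up to a charge of order at most [n / J]. *)
pose width : R := (J%:R ^+ 2)^-1; have wd0 : 0 < width by rewrite invr_gt0 exprn_gt0.
have J4 : J%:R <= n%:R * width ^+ 2.
  rewrite /width exprVn ler_pdivlMr ?exprn_gt0 //; apply: le_trans JnR.
  rewrite -exprM -exprS; apply: ler_weXn2l => //.
have mass (x : R) : 0 <= x -> x <= v + v' -> x / (n%:R * width ^+ 2) <= th ^+ 2.
  move=> x0 xv; rewrite ler_pdivrMr; last by rewrite mulr_gt0 ?exprn_gt0.
  apply: le_trans xv _; apply: le_trans hJ2 _; by rewrite ler_wpM2l // ltW.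
have mass_r : \sum_(y : pw A n | ~~ charge_window l M width y) prodw (diag_weight r e) y <= th ^+ 2.
  by apply: le_trans (window_mass dr0 dr1 n_gt0 wd0) (mass v v0 _); rewrite lerDl.
have mass_s : \sum_(y : pw A n | ~~ charge_window l M width y) prodw (diag_weight s f) y <= th ^+ 2.
  have -> : M = M' by apply/funext => k; apply: M_eq.
  by apply: le_trans (window_mass ds0 ds1 n_gt0 wd0) (mass v' v0' _); rewrite lerDr.
have atyp x : 0 <= x -> x <= entropy_variance r + entropy_variance s -> x / (n%:R * t ^+ 2) <= th ^+ 2.
  move=> x0 xv; rewrite ler_pdivrMr; last by rewrite mulr_gt0 ?exprn_gt0.
  by apply: le_trans xv (le_trans hn1 _); rewrite -mulrA [t ^+ 2 * _]mulrC.
have atyp_r := le_trans (atypical_mass r0 r1 n_gt0 t0) (atyp _ vr0 _).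
have {}atyp_r := atyp_r _; rewrite lerDl in atyp_r; have {}atyp_r := atyp_r vs0.
have atyp_s := le_trans (atypical_mass s0 s1 n_gt0 t0) (atyp _ vs0 _).
have {}atyp_s := atyp_s _; rewrite lerDr in atyp_s; have {}atyp_s := atyp_s vr0.
(* The minimum with [1] keeps [lam^-1 >= 1], hence [a >= 1], also when [S < t]. *)
pose lam := Num.min 1 (expR (- (n%:R * (S - t)))).
have lam_gt0 : 0 < lam by rewrite lt_min ltr01 expR_gt0.
have lam_r (x : pw A n) : typical r t x -> prodw r x <= lam.
  move=> h; have /andP[_ h1] := typical_bounds r0 h; rewrite le_min h1 andbT.
  by rewrite -(prodw_sum r1 n) (bigD1 x) //= lerDl; apply: sumr_ge0 => y _; apply: prodw_ge0.
have lam_s (x : pw A n) : typical s t x -> prodw s x <= lam.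
  move=> h; have /andP[_] := typical_bounds s0 h; rewrite S_eq => h1; rewrite le_min h1 andbT.
  by rewrite -(prodw_sum s1 n) (bigD1 x) //= lerDl; apply: sumr_ge0 => y _; apply: prodw_ge0.
have S0 : 0 <= S := shannon_ge0 r0 r1.
pose X := expR (kap * n%:R).
have X1 : 1 <= X by rewrite -expR0 ler_expR mulr_ge0 // ltW.
pose N := Num.Def.trunc X.
have /andP[NX XN] := truncn_itv (le_trans ler01 X1).
have N_gt0 : (0 < N)%N by rewrite -ltnS -(ltr_nat R); apply: le_lt_trans X1 XN.
pose H := harmonic R N; have H_gt0 : 0 < H := harmonic_gt0 R N_gt0.
have HX : kap * n%:R <= H.
  apply: le_trans (harmonic_ge_ln R N); rewrite -[leLHS]expRK ler_ln ?posrE ?expR_gt0 ?ltr0n //.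
  exact: ltW.
pose a := Num.Def.trunc lam^-1.
have lamV1 : 1 <= lam^-1 by rewrite invf_ge1 // ge_min lexx.
have /andP[aL La] := truncn_itv (le_trans ler01 lamV1).
have a_gt0 : (0 < a)%N by rewrite -ltnS -(ltr_nat R); apply: le_lt_trans lamV1 La.
have aR1 : 1 <= a%:R :> R by rewrite ler1n.
pose D := expR (n%:R * (S + t)).
have D1 : 1 <= D by rewrite -expR0 ler_expR mulr_ge0 // addr_ge0 // ltW.
have DN1 : 1 <= D * N%:R by apply: le_trans D1 _; rewrite ler_peMr ?expR_ge0 ?ler1n.
pose b := (Num.Def.trunc (D * N%:R)).+1.
have /andP[bL Lb] := truncn_itv (le_trans ler01 DN1).
have lamD : lam^-1 <= D.
  rewrite -[leRHS]invrK lef_pV2 ?posrE ?invr_gt0 ?expR_gt0 // le_min invf_le1 ?expR_gt0 // D1 /=.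
  by rewrite -expRN ler_expR lerN2 ler_wpM2l ?ler0n // lerD2l lerNl; apply: ltW; apply: lt_trans (_ : _ < 0) _; rewrite ?oppr_lt0.
have ab : (0 < a <= b)%N.
  rewrite a_gt0 -(ler_nat R); apply: le_trans aL (le_trans lamD _); apply: le_trans (ltW Lb).
  by rewrite ler_peMr ?ler1n // expR_ge0.
have ha : a%:R * lam <= 2.
  by apply: (@le_trans _ _ 1); [rewrite -ler_pdivlMr // div1r | rewrite ler1n].
(* [b] is about [N] times the exponential of [n (S + t)], and [a] about that of [n (S - t)]: the
   entropy cancels, [ln N] is absorbed into [H], and each rounding costs [ln 2]. *)
have hln : ln b%:R - ln a%:R <= 2 * ln 2 + n%:R * (2 * t) + H.
  have hb : ln b%:R <= ln 2 + n%:R * (S + t) + kap * n%:R.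
    have : b%:R <= 2 * (D * X) :> R.
      apply: (@le_trans _ _ (D * N%:R + 1)); first by rewrite -natr1 lerD2r.
      have : D * N%:R <= D * X by rewrite ler_pM2l ?expR_gt0.
      move: DN1; clear_inequalities; lra.
    rewrite -ler_ln ?posrE ?ltr0n // ?mulr_gt0 ?expR_gt0 // lnM ?posrE ?mulr_gt0 ?expR_gt0 //.
    by rewrite lnM ?posrE ?expR_gt0 // !expRK; clear_inequalities; lra.
  have ha' : n%:R * (S - t) - ln 2 <= ln a%:R.
    have : expR (n%:R * (S - t)) <= 2 * a%:R.
      apply: (@le_trans _ _ lam^-1).
        by rewrite -[leLHS]invrK -expRN lef_pV2 ?posrE ?expR_gt0 // ge_min lexx orbT.
      by apply: ltW (lt_le_trans La _); rewrite -natr1; move: aR1; clear_inequalities; lra.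
    rewrite -ler_ln ?posrE ?expR_gt0 ?mulr_gt0 ?ltr0n // lnM ?posrE ?ltr0n // expRK; clear_inequalities; lra.
  move: hb ha' HX; clear_inequalities; lra.
have hX : (ln b%:R - ln a%:R) / H - 1 <= th.
  rewrite lerBlDr ler_pdivrMr // mulrDl mul1r; apply: le_trans hln _; rewrite lerD2r.
  apply: (@le_trans _ _ (th * (kap * n%:R))); last by rewrite ler_pM2l.
  by rewrite /t; move: hn2; clear_inequalities; lra.
have h8 : 8 / H <= th.
  rewrite ler_pdivrMr //; apply: le_trans hn3 _.
  by rewrite [kap * _]mulrC -mulrA ler_pM2l.
pose D' := shifts l M n width.
have size_le i : (i <= J.+1)%N -> (size (sumset D' i))%:R < (1 + ep) ^+ J.
  move=> iJ; apply: le_lt_trans hJ1; rewrite ler_nat.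
  apply: leq_trans (sumset_size_le (@shiftsP _ _ _ l M n width) i) _.
  have le_exp u w d : (u <= w)%N -> (u ^ d <= w ^ d)%N.
    by case: d => // k uv; rewrite leq_exp2r.
  apply: le_exp; rewrite ltnS leq_mul2l leq_mul //; exact: ltnW.
(* The sumset of depth [J] has fewer than [(1 + ep)^J] elements, so one of the first [J] steps grows
   by a factor of at most [1 + ep]. *)
have [j jJ folner] := sumset_folner (size_le _ (leqnSn J)) ep0.
have th_gt0 : 0 < th^-1 by rewrite invr_gt0.
have [U [uU consU nU]] := fixed_length r0 r1 he s0 s1 hf N_gt0 S_eq (ltW lam_gt0) lam_r lam_s
  mass_r mass_s atyp_r atyp_s folner ep0 th_gt0 ab ha (ltW Lb).
exists (ancilla l M n N j width), ('I_N : finType), (@embezzle R N), (@ancilla_vec _ _ _ l M n N j width),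
  (@ancilla_charge _ _ _ l M n N j width), U.
split=> //.
- rewrite card_ancilla natrM.
  have sz : (0 < size (sumset D' j.+2))%N by apply/sumset_size_gt0/shifts0.
  rewrite lnM ?posrE ?ltr0n //.
  have h1 : ln N%:R <= kap * n%:R.
    by rewrite -[leRHS]expRK ler_ln ?posrE ?ltr0n ?expR_gt0.
  have h2 : ln (size (sumset D' j.+2))%:R <= ep * J%:R.
    apply: (@le_trans _ _ (ln ((1 + ep) ^+ J))).
      rewrite ler_ln ?posrE ?ltr0n ?exprn_gt0 ?addr_gt0 //; apply/ltW/size_le.
      by rewrite ltnS.
    rewrite lnXn ?addr_gt0 // -[leLHS]mulr_natr ler_wpM2r //; apply: le_ln1Dx.
    by apply: lt_trans ep0; rewrite ltrN10.
  have h3 : ep * J%:R <= kap * n%:R.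
    apply: ler_pM => //; first exact: ltW.
      by rewrite /ep /kap; move: th0 th1 eps1; clear_inequalities; nra.
    rewrite ler_nat; apply: leq_trans Jn; rewrite -[leqLHS]expn1.
    by rewrite leq_pexp2l.
  rewrite /kap in h1 h3; move: h1 h2 h3; clear_inequalities; lra.
- move=> k x; apply: le_trans (sumset_charge k (ltW wd0) (valP x.2)) _.
  have jR : j.+2%:R <= J%:R + 1 :> R by rewrite natr1 ler_nat.
  apply: (@le_trans _ _ ((J%:R + 1) * (2 * (n%:R * width)))).
    by rewrite ler_wpM2r // !mulr_ge0 // ltW.
  have -> : (J%:R + 1) * (2 * (n%:R * width)) = 2 * (J%:R + 1) * width * n%:R by ring.
  rewrite ler_pM2r // /width ler_pdivrMr ?exprn_gt0 //.
  have := ler_wpM2r (ltW JR) hJ3; move: JR1; clear_inequalities; nra.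
- by split=> //; [exact: embezzle_ge0 | exact: embezzle_sum | exact: norm2_ancilla_vec].
apply: nuc_le nU _; rewrite invrK -/H.
have -> : th^-1 * th ^+ 2 = th by field; rewrite gt_eqF.
have -> : th^-1 * (4 * ep) = th by rewrite /ep; field; rewrite gt_eqF.
have th_le1 : th <= 1 by rewrite /th; move: eps1; clear_inequalities; lra.
have : th ^+ 2 <= th by rewrite expr2 ler_piMl // ltW.
by rewrite /th in hX h8 *; move: hX h8; clear_inequalities; lra.
Qed.

Lemma protocol_eventually (eps : R) : 0 < eps ->
  exists n0, forall n, (n0 <= n)%N -> protocol n eps.
Proof.
move=> eps0; have h : 0 < Num.min 1 eps <= 1 by rewrite lt_min ltr01 eps0 ge_min lexx.
have [n0 hn] := protocol_le1 h; exists n0 => n /hn.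
have le : Num.min 1 eps <= eps by rewrite ge_min lexx orbT.
have len : Num.min 1 eps * n%:R <= eps * n%:R by rewrite ler_wpM2r.
move=> [T [K [mu [g [hh [U [h1 h2 h3 h4 h5]]]]]]]; exists T, K, mu, g, hh, U; split=> //.
- exact: le_trans h1 len.
- by move=> k t; apply: le_trans (h2 k t) len.
exact: nuc_le h5 le.
Qed.
End Asymptotic.

(** * Invariants of asymptotic conversion *)

Section Traces.
Variable R : rcfType.
Local Notation C := (complex R).
Local Notation "x %:C" := (real_complex R x) (at level 1, format "x %:C").
Local Notation cj := (@conjc R).
Implicit Types I J K : finType.

Definition opadd I (A B : I -> I -> C) : I -> I -> C := fun x y => A x y + B x y.

Lemma optr_mul_mix I J (B : I -> I -> C) (w : J -> R) (v : J -> I -> C) :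
  optr (opmul B (mix w v)) = \sum_j (w j)%:C * dot (v j) (app B (v j)).
Proof.
rewrite /optr /opmul /mix.
under eq_bigr do under eq_bigr do rewrite mulr_sumr.
under eq_bigr do rewrite exchange_big /=.
rewrite exchange_big; apply: eq_bigr => j _ /=; rewrite /dot mulr_sumr.
apply: eq_bigr => x _; rewrite /app !mulr_sumr; apply: eq_bigr => z _.
by rewrite /outer; ring.
Qed.

Lemma optr_mix_onb I (w : I -> R) (v : I -> I -> C) : onb v -> \sum_i w i = 1 ->
  optr (mix w v) = 1.
Proof.
move=> hv w1; rewrite optr_mix -[RHS]/(1%:C) -w1; congr (_ %:C).
by apply: eq_bigr => i _; rewrite onb_norm2 // mulr1.
Qed.

Lemma optr_mulD I (A B X : I -> I -> C) :
  optr (opmul (opadd A B) X) = optr (opmul A X) + optr (opmul B X).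
Proof.
rewrite /optr -big_split; apply: eq_bigr => x _ /=; rewrite /opmul -big_split.
by apply: eq_bigr => z _; rewrite /= -mulrDl.
Qed.

Lemma optr_mulB I (A X Y : I -> I -> C) :
  optr (opmul A (fun x y => X x y - Y x y)) = optr (opmul A X) - optr (opmul A Y).
Proof.
rewrite /optr -sumrB; apply: eq_bigr => x _; rewrite /opmul -sumrB.
by apply: eq_bigr => z _; rewrite mulrBr.
Qed.


Lemma optr_tens I J (A : I -> I -> C) (B : J -> J -> C) :
  optr (optens A B) = optr A * optr B.
Proof.
rewrite /optr big_distrlr /= pair_bigA /=.
by apply: eq_bigr => -[x i] _.
Qed.

Lemma optr_conj_comm I (U B Y : I -> I -> C) : opunitary U ->
  opmul U B = opmul B U -> optr (opmul B (opconj U Y)) = optr (opmul B Y).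
Proof.
move=> [u1 _] cUB; rewrite /opconj opmulA optrC !opmulA -(opmulA (opadj U)) -cUB.
by rewrite opmulA u1 opmul1l.
Qed.


Definition dgm I (c : I -> R) : I -> I -> C := fun x y => (x == y)%:R * (c x)%:C.

Lemma app_dgm I (c : I -> R) a x : app (dgm c) a x = (c x)%:C * a x.
Proof.
rewrite /app /dgm; under eq_bigr do rewrite -mulrA.
by rewrite (sum_delta (fun y => (c x)%:C * a y)).
Qed.

Lemma dgm_bound I (c : I -> R) (k : R) a b : (forall x, `|c x| <= k) ->
  complex.Re (dot b (app (dgm c) a)) <= k * (norm2 a + norm2 b) / 2.
Proof.
move=> hc; rewrite Re_sum /norm2 -big_split mulr_sumr mulr_suml; apply: ler_sum => x _ /=.
rewrite app_dgm (_ : _ * _ = (c x)%:C * (cj (b x) * a x)); last by ring.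
rewrite Re_realM; apply: le_trans (ler_norm _) _; rewrite normrM -mulrA.
apply: ler_pM => //; apply: le_trans (ReMle _ _) _; by rewrite abs2J addrC.
Qed.

Lemma tens_id_bound I J (L : J -> J -> C) (k : R) (a b : I * J -> C) :
  (forall a b, complex.Re (dot b (app L a)) <= k * (norm2 a + norm2 b) / 2) ->
  complex.Re (dot b (app (optens (@opid R I) L) a)) <= k * (norm2 a + norm2 b) / 2.
Proof.
move=> hL; pose sl (a : I * J -> C) x y := a (x, y).
have n2 c : norm2 c = \sum_x norm2 (sl c x).
  by rewrite /norm2 pair_bigA; apply: eq_bigr => -[x y].
have -> : dot b (app (optens (@opid R I) L) a) = \sum_x dot (sl b x) (app L (sl a x)).
  rewrite /dot pair_bigA; apply: eq_bigr => -[x y] _ /=; congr (_ * _).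
  rewrite /app (eq_bigr (fun z => (fun x' y' => (x == x')%:R * (L y y' * a (x', y'))) z.1 z.2)); last first.
    by move=> [x' y'] _; rewrite /optens /opid /= mulrA.
  rewrite -(pair_bigA _ (fun x' y' => (x == x')%:R * (L y y' * a (x', y')))) /=.
  under eq_bigr do rewrite -mulr_sumr.
  by rewrite (sum_delta (fun x' => \sum_y' L y y' * a (x', y'))).
rewrite Re_sum !n2 -big_split mulr_sumr mulr_suml; apply: ler_sum => x _.
exact: hL.
Qed.
Lemma optens_dgm I J (c : I -> R) :
  optens (dgm c) (@opid R J) = dgm (fun z => c z.1).
Proof.
apply: op_ext => -[x i] [y j]; rewrite /optens /dgm /opid /= xpair_eqE -mulnb natrM.
by ring.
Qed.

Lemma mix_bound I (w : I -> R) (v : I -> I -> C) a b :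
  (forall i, 0 <= w i <= 1) -> onb v ->
  complex.Re (dot b (app (mix w v) a)) <= 1 * (norm2 a + norm2 b) / 2.
Proof.
move=> hw hv; rewrite mul1r -(parseval a hv) -(parseval b hv) -big_split mulr_suml.
have -> : dot b (app (mix w v) a) = \sum_j (w j)%:C * (dot (v j) a * dot b (v j)).
  rewrite [LHS]/dot; under eq_bigr do rewrite app_mix mulr_sumr.
  rewrite exchange_big; apply: eq_bigr => j _ /=; rewrite mulrA [dot b _]/dot mulr_sumr.
  by apply: eq_bigr => x _; ring.
rewrite Re_sum; apply: ler_sum => j _; rewrite Re_realM [dot b _]dotJ -(abs2J (dot _ b)) /=.
have h := ReMle (dot (v j) a) (cj (dot (v j) b)).
have /andP[w0 w1] := hw j; apply: le_trans (ler_norm _) _; rewrite normrM ger0_norm //.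
by apply: le_trans h; apply: ler_piMl.
Qed.

End Traces.

Section Converse.
Variables (R : realType) (A : finType) (q : nat) (l : 'I_q -> A -> R).
Local Notation C := (complex R).
Local Notation "x %:C" := (real_complex R x) (at level 1, format "x %:C").
Local Notation cj := (@conjc R).

Definition total_charge n (T : finType) (L : T -> T -> C) (k : 'I_q) :
    pw A n * T -> pw A n * T -> C :=
  opadd (optens (dgm (sumf (l k) (n := n))) (@opid R T)) (optens (@opid R (pw A n)) L).

(** The form in which the converse uses its hypothesis: the two ancilla states may differ, the
    ancilla charges need not be diagonal, and their operator norm enters through a bound on the
    form. *)
Definition conversion (r : A -> R) (e : A -> A -> C) (s : A -> R) (f : A -> A -> C)
    (n : nat) (eps : R) : Prop :=
  exists (T : finType) (u w : T -> R) (g h : T -> T -> C) (L : 'I_q -> T -> T -> C)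
    (U : pw A n * T -> pw A n * T -> C),
  [/\ ln #|T|%:R <= eps * n%:R,
      forall k a b, `|complex.Re (dot b (app (L k) a))| <= eps * n%:R * (norm2 a + norm2 b) / 2,
      [/\ forall i, 0 <= u i, \sum_i u i = 1 & onb g] /\
      [/\ forall i, 0 <= w i, \sum_i w i = 1 & onb h],
      opunitary U /\ (forall k, opmul U (total_charge (L k) k) = opmul (total_charge (L k) k) U) &
      nuc (fun x y => opconj U (optens (tpow (mix r e) (n := n)) (mix u g)) x y
            - optens (tpow (mix s f) (n := n)) (mix w h) x y) eps].

(** The adjoint unitary runs the conversion backwards with the ancilla states exchanged, so proving
    inequalities in one direction suffices. *)
Lemma conversion_sym r e s f n eps : conversion r e s f n eps -> conversion s f r e n eps.
Proof.
move=> [T [u [w [g [h [L [U [h1 h2 [h3 h4] [h5 h6] h7]]]]]]]].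
exists T, w, u, h, g, L, (opadj U); split=> //.
  split=> [|k]; first exact: opunitary_adj.
  set B := total_charge _ _; have := congr1 (fun X => opmul (opadj U) (opmul X (opadj U))) (h6 k).
  rewrite -/B -!opmulA (proj2 h5) opmul1r => <-.
  by rewrite opmulA (proj1 h5) opmul1l.
apply: nuc_ext (nuc_conj (opunitary_adj h5) (nuc_sym h7)) _ => x y.
set Y := optens (tpow (mix r e) (n := n)) _; set Z := optens (tpow (mix s f) (n := n)) _.
have -> : Y x y = opconj (opadj U) (opconj U Y) x y.
  by rewrite opconjK.
by rewrite opconjB.
Qed.

Section OneSided.
Variables (r s : A -> R) (e f : A -> A -> C).
Hypotheses (r0 : forall a, 0 <= r a) (r1 : \sum_a r a = 1) (he : onb e).
Hypotheses (s0 : forall a, 0 <= s a) (s1 : \sum_a s a = 1) (hf : onb f).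
Hypothesis conv : forall eps, 0 < eps ->
  exists n0, forall n, (n0 <= n)%N -> conversion r e s f n eps.

Lemma trace_total n (T : finType) (u : T -> R) g (L : T -> T -> C) k (r' : A -> R) (e' : A -> A -> C) :
  (forall a, 0 <= r' a) -> \sum_a r' a = 1 -> onb e' -> \sum_i u i = 1 -> onb g ->
  complex.Re (optr (opmul (total_charge L k) (optens (tpow (mix r' e') (n := n)) (mix u g)))) =
  n%:R * (\sum_y diag_weight r' e' y * l k y) + \sum_i u i * complex.Re (dot (g i) (app L (g i))).
Proof.
move=> r0' r1' he' u1 hg.
rewrite optr_mulD !optens_mul !optr_tens !opmul1l ReD.
rewrite (optr_mix_onb hg u1) tpow_mix (optr_mix_onb (tpow_onb n he') (prodw_sum r1' n)).
rewrite mulr1 mul1r; congr (_ + _); last first.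
  by rewrite optr_mul_mix Re_sum; apply: eq_bigr => i _; rewrite Re_realM.
rewrite -(sumf_mean (diag_weight_sum he' r1')) optr_mul_mix Re_sum.
under [RHS]eq_bigr do rewrite -tpow_diag_weight mulr_suml.
rewrite [RHS]exchange_big; apply: eq_bigr => x _ /=; rewrite Re_realM.
under [RHS]eq_bigr do rewrite -mulrA.
rewrite -mulr_sumr; congr (_ * _); rewrite /dot Re_sum; apply: eq_bigr => y _.
rewrite app_dgm (_ : _ * _ = (sumf (l k) y)%:C * (cj (tpow e' x y) * tpow e' x y)); last by ring.
by rewrite Re_realM mulJc mulrC.
Qed.

Lemma onb_bound (T : finType) (L : T -> T -> C) (c : R) (u : T -> R) g :
  (forall a b, `|complex.Re (dot b (app L a))| <= c * (norm2 a + norm2 b) / 2) ->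
  (forall i, 0 <= u i) -> \sum_i u i = 1 -> onb g ->
  `|\sum_i u i * complex.Re (dot (g i) (app L (g i)))| <= c.
Proof.
move=> hL u0 u1 hg; apply: le_trans (ler_norm_sum _ _ _) _.
rewrite -[c]mulr1 -u1 mulr_sumr; apply: ler_sum => i _.
rewrite normrM ger0_norm // [c * _]mulrC ler_wpM2l //; apply: le_trans (hL _ _) _.
by rewrite onb_norm2 //; lra.
Qed.

Lemma sumf_bound (g : A -> R) (k : R) n (x : pw A n) : (forall a, `|g a| <= k) ->
  `|sumf g x| <= n%:R * k.
Proof.
move=> hg; elim: n x => [|n IH] x; first by rewrite /= normr0 mul0r.
by rewrite /= -natr1 mulrDl mul1r addrC; apply: le_trans (ler_normD _ _) _; rewrite lerD.
Qed.

(** The total charge is conserved and has norm at most [n (K + 1)], so a nuclear error [ep] moves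
    its expectation by at most [ep n (K + 1)]; the two ancilla terms add at most [ep n] each.
    Dividing by [n] leaves [ep (K + 3)]. *)
Lemma charge_le k :
  \sum_y diag_weight r e y * l k y <= \sum_y diag_weight s f y * l k y.
Proof.
apply/ler_addgt0Pr => eps eps0.
pose K := \sum_a `|l k a|.
have hK a : `|l k a| <= K by rewrite /K (bigD1 a) //= lerDl; apply: sumr_ge0.
have K0 : 0 <= K by apply: sumr_ge0.
pose ep := Num.min 1 (eps / (K + 3)).
have K3 : 0 < K + 3 by apply: ltr_wpDl.
have ep0 : 0 < ep by rewrite lt_min ltr01 divr_gt0.
have ep1 : ep <= 1 by rewrite ge_min lexx.
have epK : ep * (K + 3) <= eps by rewrite -ler_pdivlMr // ge_min lexx orbT.
have [n0 /(_ n0.+1 (leqnSn _))] := conv ep0.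
set n := n0.+1 => -[T [u [w [g [h [L [U [h1 h2 [[u0 u1 hg] [w0 w1 hh]] [h5 h6] h7]]]]]]]].
have nR : 0 < n%:R :> R by rewrite ltr0n.
set Y := optens (tpow (mix r e) (n := n)) (mix u g) in h7 *.
set Z := optens (tpow (mix s f) (n := n)) (mix w h) in h7 *.
pose B := total_charge (L k) k (n := n).
have eY : complex.Re (optr (opmul B (opconj U Y))) = _ := congr1 _ (optr_conj_comm Y h5 (h6 k)).
have hB a b : complex.Re (dot b (app B a)) <= n%:R * (K + 1) * (norm2 a + norm2 b) / 2.
  have -> : dot b (app B a) = dot b (app (dgm (fun z : pw A n * T => sumf (l k) z.1)) a) +
      dot b (app (optens (@opid R (pw A n)) (L k)) a).
    rewrite -optens_dgm /dot -big_split; apply: eq_bigr => x _ /=; rewrite -mulrDr; congr (_ * _).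
    by rewrite /app -big_split; apply: eq_bigr => y _ /=; rewrite -mulrDl.
  rewrite ReD.
  have c1 := dgm_bound a b (fun z : pw A n * T => sumf_bound z.1 hK).
  have c2 := tens_id_bound (I := pw A n) a b (fun a b => le_trans (ler_norm _) (h2 k a b)).
  apply: le_trans (lerD c1 c2) _.
  have := norm2_ge0 a; have := norm2_ge0 b => p1 p2.
  have p3 : 0 <= n%:R * (norm2 a + norm2 b) by rewrite mulr_ge0 ?addr_ge0 // ltW.
  have := ler_wpM2r p3 ep1; lra.
have nK : 0 <= n%:R * (K + 1) by rewrite mulr_ge0 ?addr_ge0 // ltW.
have := nuc_trace nK hB h7.
rewrite optr_mulB ReD ReN eY !trace_total //.
have := onb_bound (h2 k) u0 u1 hg; have := onb_bound (h2 k) w0 w1 hh.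
set x1 := \sum_i _ * _; set x2 := \sum_i _ * _.
rewrite !ler_norml => /andP[b1 b2] /andP[b3 b4] b5.
rewrite -(ler_pM2l nR).
have := ler_wpM2l (ltW nR) epK; lra.
Qed.

(* A projection of rank [#typ r * #|T|] captures almost all of the initial state, hence of the final one, whose eigenvalues are mostly below [exp (- n (shannon s - t))]. *)
Lemma entropy_le : shannon s <= shannon r.
Proof.
rewrite leNgt; apply/negP => lt.
(* The entropies are [8 t] apart; typicality on both sides and [ln #|T|] use up at most [3 t], so
   [lam * (D * #|T|)] stays exponentially small. *)
pose t := (shannon s - shannon r) / 8; have t0 : 0 < t by rewrite divr_gt0 ?subr_gt0.
pose ep := Num.min (1 / 4) t.
have ep0 : 0 < ep by rewrite lt_min t0 divr_gt0.
have ep1 : ep <= 1 / 4 by rewrite ge_min lexx.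
have ept : ep <= t by rewrite ge_min lexx orbT.
have [n0 hn0] := conv ep0.
have vr0 : 0 <= entropy_variance r.
  by apply: sumr_ge0 => a _; rewrite mulr_ge0 ?sqr_ge0.
have vs0 : 0 <= entropy_variance s.
  by apply: sumr_ge0 => a _; rewrite mulr_ge0 ?sqr_ge0.
have [n1 hn1] := eventually_linear (8 * (entropy_variance r + entropy_variance s)) (exprn_gt0 2 t0).
have [n2 hn2] := eventually_linear 8 t0.
pose n := maxn n0 (maxn n1 (maxn n2 1)).
have : (n <= n)%N by []. rewrite {1}/n !geq_max => /and4P[/hn0 {}hn0 /hn1 {}hn1 /hn2 {}hn2 n_gt0].
have nR : 0 < n%:R :> R by rewrite ltr0n.
have atyp x : 0 <= x -> 8 * x <= 8 * (entropy_variance r + entropy_variance s) -> x / (n%:R * t ^+ 2) <= 1 / 8.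
  move=> x0 xv; rewrite ler_pdivrMr; last by rewrite mulr_gt0 ?exprn_gt0.
  by have := le_trans xv hn1; lra.
have atyp_r : \sum_(x : pw A n | ~~ typical r t x) prodw r x <= 1 / 8.
  by apply: le_trans (atypical_mass r0 r1 n_gt0 t0) (atyp _ vr0 _); lra.
have atyp_s : \sum_(x : pw A n | ~~ typical s t x) prodw s x <= 1 / 8.
  by apply: le_trans (atypical_mass s0 s1 n_gt0 t0) (atyp _ vs0 _); lra.
move: hn0 => [T [u [w [g [h [L [U [h1 h2 [[u0 u1 hg] [w0 w1 hh]] [h5 h6] h7]]]]]]]].
pose q0 (z : pw A n * T) := vtens (tpow e (n := n) z.1) (@unit_vec R T z.2).
pose qb (z : pw A n * T) := app U (q0 z).
have hq : onb qb.
  by apply: app_onb_unitary => //; apply: (onb_tens (tpow_onb n he) (@unit_vec_onb R T)).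
pose ind (z : pw A n * T) : R := if typical r t z.1 then 1 else 0.
have ind01 z : 0 <= ind z <= 1 by rewrite /ind; case: ifP; rewrite ?lexx ?ler01.
pose Q := mix ind qb.
have := nuc_trace (ler01 : 0 <= (1 : R)) (fun a b => mix_bound a b ind01 hq) h7.
rewrite optr_mulB ReD ReN !tpow_mix !mix_tens opconj_mix !optr_mul_mix !Re_sum.
under eq_bigr do rewrite Re_realM dot_mix /=.
under [X in _ - X]eq_bigr do rewrite Re_realM dot_mix /=.
rewrite mul1r.
(* The weight, in the range of [Q], of the eigenvector [z] of the final state: at most one for each
   [z], and in total the rank of [Q]. *)
pose kap z := \sum_j ind j * abs2 (dot (qb j) (vtens (tpow f (n := n) z.1) (h z.2))).
have e1 : \sum_i prodw r i.1 * u i.2 *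
     \sum_j ind j * abs2 (dot (qb j) (app U (vtens (tpow e (n := n) i.1) (g i.2)))) =
     \sum_(x : pw A n | typical r t x) prodw r x.
  transitivity (\sum_(z : pw A n * T) prodw r z.1 * u z.2 * ind z).
    apply: eq_bigr => -[x i] _ /=; congr (_ * _).
    have [tp te] := tpow_onb n he.
    transitivity (\sum_(j : pw A n * T) (fun y i' => ind (y, i') * ((y == x)%:R * abs2 (dot (@unit_vec R T i') (g i)))) j.1 j.2).
      apply: eq_bigr => -[y i'] _ /=; rewrite dot_unitary // dot_vtens tp abs2M; congr (_ * (_ * _)).
      by case: (y == x); rewrite ?abs21 ?abs20.
    rewrite -(pair_bigA _ (fun y i' => ind (y, i') * ((y == x)%:R * abs2 (dot (@unit_vec R T i') (g i))))) /=.
    rewrite (bigD1 x) //= [X in _ + X]big1 ?addr0 => [|y /negbTE ne]; last first.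
      by rewrite big1 // => i' _; rewrite ne mul0r mulr0.
    under eq_bigr do rewrite eqxx mul1r.
    rewrite /ind /= -mulr_sumr (parseval _ (@unit_vec_onb R T)) (onb_norm2 _ hg) mulr1 //.
  rewrite -(pair_bigA _ (fun x i => prodw r x * u i * ind (x, i))) /= [RHS]big_mkcond.
  apply: eq_bigr => x _ /=; rewrite /ind /=; case: ifP => _; last by rewrite big1 // => i _; rewrite mulr0.
  by under eq_bigr do rewrite mulr1; rewrite -mulr_sumr u1 mulr1.
rewrite e1 -/(kap _).
have e2 : 1 - 1 / 8 <= \sum_(x : pw A n | typical r t x) prodw r x.
  have := prodw_sum r1 n; rewrite (bigID (typical r t (n := n))) /=; lra.
pose lam := expR (- (n%:R * (shannon s - t))).
pose D := expR (n%:R * (shannon r + t)).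
have hz : onb (fun z : pw A n * T => vtens (tpow f (n := n) z.1) (h z.2)) := onb_tens (tpow_onb n hf) hh.
have kap0 z : 0 <= kap z.
  by apply: sumr_ge0 => j _; rewrite mulr_ge0 ?abs2_ge0 //; case/andP: (ind01 j).
have kap1 z : kap z <= 1.
  rewrite -(onb_norm2 z hz) -(parseval _ hq); apply: ler_sum => j _.
  by rewrite ler_piMl ?abs2_ge0 //; case/andP: (ind01 j).
have kapS : \sum_z kap z <= D * #|T|%:R.
  rewrite /kap exchange_big /=.
  have -> : \sum_j \sum_i ind j * abs2 (dot (qb j) (vtens (tpow f (n := n) i.1) (h i.2))) = \sum_j ind j.
    apply: eq_bigr => j _; rewrite -mulr_sumr -[RHS]mulr1; congr (_ * _).
    rewrite -(onb_norm2 j hq) -(parseval _ hz); apply: eq_bigr => i _.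
    by rewrite dotJ abs2J.
  rewrite (eq_bigr (fun z => (fun x i => ind (x, i)) z.1 z.2)) => [|[]//].
  rewrite -(pair_bigA _ (fun x i => ind (x, i))) /=.
  apply: (@le_trans _ _ (#|[pred x : pw A n | typical r t x]|%:R * #|T|%:R)); last first.
    by rewrite ler_wpM2r // typical_card.
  rewrite /ind /=; under eq_bigr do rewrite sumr_const -mulr_natr.
  by rewrite -mulr_suml ler_wpM2r // -big_mkcond /= sumr_const.
have e3 : \sum_i prodw s i.1 * w i.2 * kap i <= lam * (D * #|T|%:R) + 1 / 8.
  apply: le_trans (lerD (ler_wpM2l (expR_ge0 _) kapS) atyp_s).
  have -> : \sum_(x : pw A n | ~~ typical s t x) prodw s x =
      \sum_(z : pw A n * T) (if typical s t z.1 then 0 else prodw s z.1 * w z.2).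
    rewrite -(pair_bigA _ (fun x i => if typical s t x then 0 else prodw s x * w i)) /= big_mkcond.
    by apply: eq_bigr => x _ /=; case: (typical s t x) => /=; [rewrite big1 | rewrite -mulr_sumr w1 mulr1].
  rewrite mulr_sumr -big_split; apply: ler_sum => -[x i] _ /=.
  have p0 : 0 <= prodw s x := prodw_ge0 s0 x.
  case: ifP => [/(typical_bounds s0)/andP[_ le]|_].
    rewrite addr0 ler_wpM2r // -[leRHS]mulr1 ler_pM //.
    by rewrite -w1 (bigD1 i) //= lerDl; apply: sumr_ge0.
  by rewrite ler_wpDl ?mulr_ge0 ?expR_ge0 // ler_piMr // mulr_ge0.
have T0 : 0 < #|T|%:R :> R.
  rewrite ltr0n lt0n; apply/eqP => T0; have := oner_neq0 R; rewrite -u1 big1 ?eqxx // => i _.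
  by have := card0_eq T0 i.
have TE : #|T|%:R <= expR (ep * n%:R) by rewrite -[leLHS](lnK (T0 : _ \is Num.pos)) ler_expR.
have e4 : lam * (D * #|T|%:R) <= 1 / 4.
  apply: (@le_trans _ _ (expR (- (t * n%:R)))).
    rewrite /lam /D; apply: (@le_trans _ _ (expR (- (n%:R * (shannon s - t))) * (expR (n%:R * (shannon r + t)) * expR (ep * n%:R)))).
      by rewrite !ler_pM2l ?expR_gt0.
    rewrite -!expRD ler_expR.
    have -> : shannon s = shannon r + 8 * t by rewrite /t; lra.
    have := ler_wpM2r (ltW nR) ept; have := mulr_gt0 t0 nR; lra.
  rewrite expRN -[leRHS]invrK lef_pV2 ?posrE ?expR_gt0 ?invr_gt0 ?divr_gt0 //.
  by have := expR_ge1Dx (t * n%:R); lra.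
(* The projection sees at least [7/8] of the initial state and at most [1/4 + 1/8] of the final one,
   a gap larger than [ep <= 1/4]. *)
lra.
Qed.
End OneSided.

Lemma conversion_invariants (r s : A -> R) (e f : A -> A -> C) :
  (forall a, 0 <= r a) -> \sum_a r a = 1 -> onb e ->
  (forall a, 0 <= s a) -> \sum_a s a = 1 -> onb f ->
  (forall eps, 0 < eps -> exists n0, forall n, (n0 <= n)%N -> conversion r e s f n eps) ->
  shannon r = shannon s /\
  forall k, \sum_y diag_weight r e y * l k y = \sum_y diag_weight s f y * l k y.
Proof.
move=> r0 r1 he s0 s1 hf cv.
have cv' eps : 0 < eps -> exists n0, forall n, (n0 <= n)%N -> conversion s f r e n eps.
  by move=> /cv[n0 hn]; exists n0 => n /hn; apply: conversion_sym.
split=> [|k]; apply/eqP; rewrite eq_le.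
  by rewrite (entropy_le s0 s1 hf r0 r1 he cv') (entropy_le r0 r1 he s0 s1 hf cv).
by rewrite (charge_le r0 r1 he s0 s1 hf cv) (charge_le s0 s1 hf r0 r1 he cv').
Qed.
End Converse.

(** * Change of basis *)

Section BasisChange.
Variables (R : realType) (A : finType).
Local Notation C := (complex R).
Local Notation "x %:C" := (real_complex R x) (at level 1, format "x %:C").
Local Notation cj := (@conjc R).
Implicit Types I J T : finType.

(** The recursion peels off the first copy, as [pw] and [tpow] do, so that diagonalisation goes
    through by induction. *)
Fixpoint opsum (X : A -> A -> C) n : pw A n -> pw A n -> C :=
  match n with
  | O => fun _ _ => 0
  | S n' => opadd (optens X (@opid R (pw A n'))) (optens (@opid R A) (opsum X (n := n')))
  end.

Lemma mix_add I J (w u : J -> R) (v : J -> I -> C) :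
  opadd (mix w v) (mix u v) = mix (fun j => w j + u j) v.
Proof.
apply: op_ext => x y; rewrite /opadd /mix -big_split; apply: eq_bigr => j _ /=.
by rewrite rmorphD /= mulrDl.
Qed.

Lemma onb_mix1 I (v : I -> I -> C) : onb v -> mix (fun=> 1) v = @opid R I.
Proof. by case=> _ h; apply: op_ext => x y; rewrite /opid -h; apply: eq_bigr => j _; rewrite mul1r. Qed.

Lemma opsum_mix (l : A -> R) (w : A -> A -> C) n : onb w ->
  opsum (mix l w) (n := n) = mix (sumf l (n := n)) (tpow w (n := n)).
Proof.
move=> hw; elim: n => [|n IH].
  by apply: op_ext => x y; rewrite /mix big1 // => j _; rewrite mul0r.
rewrite /= IH -(onb_mix1 (tpow_onb n hw)) -(onb_mix1 hw) !mix_tens mix_add.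
by congr mix; apply/funext => x /=; rewrite mulr1 mul1r.
Qed.













Lemma opconjD I (U X Y : I -> I -> C) : opconj U (opadd X Y) = opadd (opconj U X) (opconj U Y).
Proof.
apply: op_ext => x y; rewrite /opadd !opconjE -big_split; apply: eq_bigr => z _ /=.
by rewrite -big_split; apply: eq_bigr => v _ /=; ring.
Qed.


Lemma dgm_mix I (c : I -> R) : dgm c = mix c (@unit_vec R I).
Proof.
apply: op_ext => x y; rewrite /dgm /mix /outer /unit_vec.
under eq_bigr do rewrite conjc_nat mulrCA eq_sym.
by rewrite (sum_delta (fun j => (c j)%:C * (j == y)%:R)) mulrC.
Qed.

Variable w : A -> A -> C.
Hypothesis hw : onb w.

Definition basis_change n : pw A n -> pw A n -> C := fun y x => tpow w x y.
Definition rotate (e : A -> A -> C) : A -> A -> C := fun x y => dot (w y) (e x).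

Lemma basis_change_unitary n : opunitary (@basis_change n).
Proof. exact/onb_unitary/tpow_onb. Qed.

Lemma rotateE e : rotate e = fun x => app (opadj (fun y x => w x y)) (e x).
Proof. by []. Qed.

Lemma rotate_onb e : onb e -> onb (rotate e).
Proof. by move=> he; rewrite rotateE; apply: app_onb_unitary he; apply/opunitary_adj/onb_unitary. Qed.

Lemma tpow_app (e e' : A -> A -> C) n (x : pw A n) :
  (forall a, app (fun y x => w x y) (e' a) = e a) ->
  app (@basis_change n) (tpow e' x) = tpow e x.
Proof.
move=> he; elim: n x => [|n IH] x.
  by apply/funext => y; rewrite /app (big_pred1 tt) => [|[]//]; rewrite /= mulr1.
apply/funext => y /=; rewrite -he -IH {2 3}/app big_distrlr /= pair_bigA.
by rewrite /app; apply: eq_bigr => z _; rewrite /basis_change /=; ring.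
Qed.

Lemma tpow_rotate r e n : tpow (mix r e) (n := n) = opconj (@basis_change n) (tpow (mix r (rotate e)) (n := n)).
Proof.
rewrite !tpow_mix opconj_mix; congr mix; apply/funext => x; rewrite (tpow_app (e := e)) // => a.
by rewrite -app_mul (proj2 (onb_unitary hw)) app_id.
Qed.

Lemma opsum_rotate (l : A -> R) n :
  opsum (mix l w) (n := n) = opconj (@basis_change n) (dgm (sumf l (n := n))).
Proof.
rewrite opsum_mix // dgm_mix opconj_mix; congr mix; apply/funext => x; apply/funext => y.
by rewrite /app /unit_vec; under eq_bigr do rewrite mulrC; rewrite (sum_delta (fun z => basis_change y z)).
Qed.

Lemma trace_rotate (l r : A -> R) e :
  optr (opmul (mix l w) (mix r e)) = (\sum_y diag_weight r (rotate e) y * l y)%:C.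
Proof.
rewrite optr_mul_mix rmorph_sum /=.
under eq_bigr do rewrite dot_mix -rcM mulr_sumr rmorph_sum.
rewrite exchange_big; apply: eq_bigr => y _ /=.
rewrite /diag_weight mulr_suml rmorph_sum; apply: eq_bigr => x _ /=; congr (_ %:C).
by rewrite /rotate; ring.
Qed.
End BasisChange.

Section Protocols.
Variables (R : realType) (A : finType) (q : nat) (l : 'I_q -> A -> R).
Local Notation C := (complex R).
Local Notation "x %:C" := (real_complex R x) (at level 1, format "x %:C").
Variables (w : A -> A -> C) (r s : A -> R) (e f : A -> A -> C).
Hypothesis hw : onb w.
Let rho := mix r e.
Let sigma := mix s f.
Local Notation charge n T k L :=
  (opadd (optens (opsum (mix (l k) w) (n := n)) (@opid R T)) (optens (@opid R (pw A n)) L)).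

Lemma charge_rotate n (T : finType) k (L : T -> T -> C) :
  charge n T k L = opconj (optens (@basis_change R A w n) (@opid R T)) (total_charge l L k).
Proof.
by rewrite /total_charge opconjD !opconj_tens !opconj_id opsum_rotate // opconj_opid //; apply: basis_change_unitary.
Qed.

(** [U] is conjugated by the change to the charge basis on the copies, the ancilla being
    untouched. *)
Lemma protocol_rotate n eps : protocol l r s (rotate w e) (rotate w f) n eps ->
  exists (T : finType) (omega : T -> T -> C) (h : 'I_q -> T -> R)
    (U : pw A n * T -> pw A n * T -> C),
  [/\ ln #|T|%:R <= eps * n%:R, forall k t, `|h k t| <= eps * n%:R,
      oppsd omega /\ optr omega = 1,
      opunitary U /\ (forall k, opmul U (charge n T k (dgm (h k))) = opmul (charge n T k (dgm (h k))) U) &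
      nuc (fun x y => opconj U (optens (tpow rho (n := n)) omega) x y
            - optens (tpow sigma (n := n)) omega x y) eps].
Proof.
move=> [T [K [mu [g [h [U [h1 h2 [mu0 mu1 g1] [h4 h5] h6]]]]]]].
pose W := optens (@basis_change R A w n) (@opid R T).
have uW : opunitary W by apply: optens_unitary (basis_change_unitary hw n) (opid_unitary _ _).
exists T, (mix mu g), h, (opconj W U); split=> //.
- split; first exact: mix_psd.
  by rewrite optr_mix; under eq_bigr do rewrite g1 mulr1; rewrite mu1.
- split=> [|k]; first exact: opconj_unitary.
  rewrite !charge_rotate -/W !opconj_mul //; congr opconj.
  (* In the charge basis the total charge is diagonal, so commuting with it means vanishing between
     different totals. *)
  have -> : total_charge l (dgm (h k)) k (n := n) = dgm (fun z : pw A n * T => sumf (l k) z.1 + h k z.2).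
    apply: op_ext => -[x i] [y j]; rewrite /total_charge /opadd /optens /dgm /opid /= xpair_eqE -mulnb natrM rmorphD /=.
    ring.
  apply: op_ext => x y; rewrite /opmul /dgm.
  under [RHS]eq_bigr do rewrite -mulrA.
  rewrite (sum_delta (fun z => (sumf (l k) x.1 + h k x.2)%:C * U z y)).
  under [LHS]eq_bigr do rewrite mulrCA eq_sym.
  rewrite (sum_delta (fun z => U x z * (sumf (l k) z.1 + h k z.2)%:C)) mulrC.
  by have [->|/h5 ->] := eqVneq (U x y) 0; rewrite ?mulr0.
rewrite /rho /sigma (tpow_rotate hw r e) (tpow_rotate hw s f).
have wid (X : pw A n -> pw A n -> C) : optens (opconj (basis_change w (n := n)) X) (mix mu g) = opconj W (optens X (mix mu g)).
  by rewrite opconj_tens opconj_id.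
rewrite !wid; apply: nuc_ext (nuc_conj uW h6) _ => x y; rewrite opconjB; congr (_ x y - _).
by rewrite -[RHS]opconjM opconj_mulr // opconjM.
Qed.

(** Ancillas are demanded for every [n], while the construction starts at some [n0]. Below it the
    identity with a one-dimensional ancilla serves, two states being at distance at most [2]. *)
Lemma protocol_trivial n :
  (forall a, 0 <= r a) -> \sum_a r a = 1 -> onb e ->
  (forall a, 0 <= s a) -> \sum_a s a = 1 -> onb f -> protocol l r s e f n 2.
Proof.
move=> r0 r1 he s0 s1 hf.
exists unit, unit, (fun=> 1), (fun _ _ => 1), (fun _ _ => 0), (@opid R _); split.
- by rewrite card_unit ln1 mulr_ge0.
- by move=> k t; rewrite normr0 mulr_ge0.
- split=> [i||i]; first exact: ler01.
    by rewrite (big_pred1 tt) // => -[].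
  by rewrite /norm2 (big_pred1 tt) ?abs21 // => -[].
- split=> [|x y]; first exact: opid_unitary.
  by rewrite /opid; have [->|_] := eqVneq x y; rewrite ?eqxx.
rewrite opconj_id !tpow_mix !mix_tens.
have nuc1 (v : A -> R) (u : A -> A -> C) : (forall a, 0 <= v a) -> \sum_a v a = 1 -> onb u ->
   nuc (mix (fun jk : pw A n * unit => prodw v jk.1 * 1)
     (fun jk => vtens (tpow u jk.1) (fun _ : unit => 1))) 1.
  move=> v0 v1 hu; apply: nuc_ext (nuc_mix_weights (w := fun jk : pw A n * unit => prodw v jk.1 * 1) (u := fun=> 0) (a := fun jk => vtens (tpow u jk.1) (fun _ : unit => 1)) (eta := 1) _ _) _.
  - move=> j; rewrite norm2_vtens (onb_norm2 _ (tpow_onb n hu)) mul1r.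
    by rewrite /norm2 (big_pred1 tt) ?abs21 // => -[].
  - rewrite -(pair_bigA _ (fun (x : pw A n) (_ : unit) => `|prodw v x * 1 - 0|)) /=.
    apply: (@le_trans _ _ (\sum_(x : pw A n) prodw v x)); last by rewrite prodw_sum.
    apply: ler_sum => x _; rewrite (big_pred1 tt) => [|[]//].
    by rewrite /= mulr1 subr0 ger0_norm // prodw_ge0.
  - by move=> x y; rewrite [X in _ - X]/mix big1 ?subr0 // => j _; rewrite mul0r.
apply: nuc_le (nucD (nuc1 _ _ r0 r1 he) (nucN (nuc1 _ _ s0 s1 hf))) _; lra.
Qed.

(* Diagonal choice: [kap n] is the best precision at most [n] available at length [n]. *)
Lemma protocol_sequence : (forall n, protocol l r s e f n 2) ->
  (forall eps, 0 < eps -> exists n0, forall n, (n0 <= n)%N -> protocol l r s e f n eps) ->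
  exists eps : nat -> R, (forall n, 0 <= eps n /\ protocol l r s e f n (eps n)) /\
    forall c, 0 < c -> exists n0, forall n, (n0 <= n)%N -> eps n <= c.
Proof.
move=> triv ev; pose Q n k := protocol l r s e f n (2 / k.+1%:R).
have ex n : exists k, (k <= n)%N && `[< Q n k >].
  by exists 0%N; rewrite leq0n; apply/asboolP; rewrite /Q divr1.
have ub n k : (k <= n)%N && `[< Q n k >] -> (k <= n)%N by case/andP.
pose kap n := ex_maxn (ex n) (ub n).
exists (fun n => 2 / (kap n).+1%:R); split=> [n|c c0].
  by split; [rewrite divr_ge0 | rewrite /kap; case: ex_maxnP => k /andP[_ /asboolP]].
have [k hk] := eventually_linear 2 c0.
have k0 : 0 < 2 / k.+1%:R :> R by rewrite divr_gt0.
have [n0 hn0] := ev _ k0; exists (maxn k n0) => n; rewrite geq_max => /andP[kn /hn0 hQ].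
rewrite ler_pdivrMr //; apply: hk; rewrite /kap; case: ex_maxnP => k' _ /(_ k); rewrite kn /=.
by move=> h; apply: leqW; apply: h; apply/asboolP.
Qed.

Lemma conversion_rotate n eps (T : finType) (omega omega' : T -> T -> C)
    (L : 'I_q -> T -> T -> C) (U : pw A n * T -> pw A n * T -> C) :
  ln #|T|%:R <= eps * n%:R ->
  (forall k a b, `|complex.Re (dot b (app (L k) a))| <= eps * n%:R * (norm2 a + norm2 b) / 2) ->
  oppsd omega -> optr omega = 1 -> oppsd omega' -> optr omega' = 1 ->
  opunitary U -> (forall k, opmul U (charge n T k (L k)) = opmul (charge n T k (L k)) U) ->
  nuc (fun x y => opconj U (optens (tpow rho (n := n)) omega') x y
        - optens (tpow sigma (n := n)) omega x y) eps ->
  conversion l r (rotate w e) s (rotate w f) n eps.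
Proof.
move=> h1 h2 po to po' to' uU cU hn.
have weights (X : T -> T -> C) : oppsd X -> optr X = 1 -> exists (u : T -> R) g,
    [/\ X = mix u g, forall i, 0 <= u i, \sum_i u i = 1 & onb g].
  move=> /psd_spectral[g [u [hg -> u0]]]; rewrite optr_mix => h; exists u, g; split=> //.
  have := congr1 (@complex.Re R) h => /= <-; apply: eq_bigr => i _; by rewrite onb_norm2 // mulr1.
have [u [g [eu u0 u1 hg]]] := weights _ po' to'.
have [v [h [ev v0 v1 hh]]] := weights _ po to.
pose W := optens (@basis_change R A w n) (@opid R T).
have uW : opunitary W by apply: optens_unitary (basis_change_unitary hw n) (opid_unitary _ _).
exists T, u, v, g, h, L, (opconj (opadj W) U); split=> //.
  split=> [|k]; first by apply: opconj_unitary => //; apply: opunitary_adj.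
  have -> : total_charge l (L k) k = opconj (opadj W) (charge n T k (L k)).
    by rewrite charge_rotate opconjK.
  by rewrite !opconj_mul ?cU //; apply: opunitary_adj.
have wid (X : pw A n -> pw A n -> C) Y : optens (opconj (basis_change w (n := n)) X) Y = opconj W (optens X Y).
  by rewrite opconj_tens opconj_id.
rewrite /rho /sigma (tpow_rotate hw r e) (tpow_rotate hw s f) !wid in hn.
apply: nuc_ext (nuc_conj (opunitary_adj uW) hn) _ => x y.
rewrite opconjB opconjK // eu ev; congr (_ x y - _).
have -> : opconj (opadj W) U = opmul (opadj W) (opmul U W) by rewrite /opconj opadjK opmulA.
by rewrite !opconjM.
Qed.
End Protocols.

(** * Matrices indexed by natural numbers *)

From mathcomp Require Import Rstruct Rstruct_topology.

Local Notation R := Rdefinitions.R.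
Local Notation C := (complex R).
Local Notation "x %:C" := (real_complex R x) (at level 1, format "x %:C").
Local Notation cj := (@conjc R).

Definition toC (z : Defs.C) : C := Complex (Defs.Re z) (Defs.Im z).
Definition ofC (z : C) : Defs.C := Defs.mkC (complex.Re z) (complex.Im z).

Lemma toCK : cancel toC ofC. Proof. by case. Qed.
Lemma ofCK : cancel ofC toC. Proof. by case. Qed.
Lemma toC_inj : injective toC. Proof. exact: can_inj toCK. Qed.
Lemma toC_add z w : toC (Defs.Cadd z w) = toC z + toC w. Proof. by []. Qed.
Lemma toC_mul z w : toC (Defs.Cmul z w) = toC z * toC w. Proof. by []. Qed.
Lemma toC_conj z : toC (Defs.Cconj z) = cj (toC z). Proof. by []. Qed.
Lemma toC_0 : toC Defs.C0 = 0. Proof. by []. Qed.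
Lemma toC_1 : toC Defs.C1 = 1. Proof. by []. Qed.

Lemma Rsum_ord n (F : nat -> R) : Defs.Rsum n F = \sum_(i < n) F i.
Proof. by elim: n => [|n IH] /=; rewrite ?big_ord0 // big_ord_recr /= IH. Qed.
Lemma Csum_ord n (F : nat -> Defs.C) : toC (Defs.Csum n F) = \sum_(i < n) toC (F i).
Proof. by elim: n => [|n IH]; rewrite ?big_ord0 // big_ord_recr /= toC_add IH. Qed.

(* Entries of a [Defs.Mat] beyond the dimension are junk; [rk] only ever reaches the meaningful ones. *)
Record indexing (I : finType) (n : nat) := Indexing {
  ix : nat -> I;
  rk : I -> nat;
  rk_lt : forall x, (rk x < n)%N;
  rkK : forall x, ix (rk x) = x;
  ixK : forall i, (i < n)%N -> rk (ix i) = i }.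

Section Indexed.
Variables (I : finType) (n : nat) (D : indexing I n).

Lemma rk_inj : injective (rk D).
Proof. exact: can_inj (rkK D). Qed.

Lemma sum_ix (V : nmodType) (F : nat -> V) : \sum_(i < n) F i = \sum_(x : I) F (rk D x).
Proof.
pose h (x : I) : 'I_n := Ordinal (rk_lt D x).
rewrite (reindex h) //; exists (fun i : 'I_n => ix D i) => [x|i] _ /=; first exact: rkK.
by apply/val_inj; rewrite /= ixK.
Qed.

Definition ker (A : Defs.Mat) : I -> I -> C := fun x y => toC (A (rk D x) (rk D y)).
Definition mat (X : I -> I -> C) : Defs.Mat := fun i j => ofC (X (ix D i) (ix D j)).
Definition kerv (v : Defs.Vec) : I -> C := fun x => toC (v (rk D x)).
Definition vec (a : I -> C) : Defs.Vec := fun i => ofC (a (ix D i)).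

Lemma matK X : ker (mat X) = X.
Proof. by apply: op_ext => x y; rewrite /ker /mat ofCK !rkK. Qed.
Lemma vecK a : kerv (vec a) = a.
Proof. by apply/funext => x; rewrite /kerv /vec ofCK rkK. Qed.

Lemma ker_meq A B : Defs.meq n A B <-> ker A = ker B.
Proof.
split=> [h|h i j hi hj].
  by apply: op_ext => x y; rewrite /ker h //; apply/ssrnat.ltP/rk_lt.
move/ssrnat.ltP: hi => hi; move/ssrnat.ltP: hj => hj.
have := congr1 (fun X => X (ix D i) (ix D j)) h; rewrite /ker !ixK //; exact: toC_inj.
Qed.

Lemma ker_mmul A B : ker (Defs.mmul n A B) = opmul (ker A) (ker B).
Proof. by apply: op_ext => x y; rewrite /ker /Defs.mmul Csum_ord (sum_ix (fun k => toC (Defs.Cmul (A (rk D x) k) (B k (rk D y))))). Qed.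
Lemma ker_adj A : ker (Defs.adj A) = opadj (ker A).
Proof. by []. Qed.
Lemma ker_mid : ker Defs.mid = @opid R I.
Proof.
apply: op_ext => x y; rewrite /ker /Defs.mid /opid -(inj_eq rk_inj).
by have [e|/eqP e] := eqVneq (rk D x) (rk D y); [rewrite (PeanoNat.Nat.eqb_eq _ _).2 | rewrite (PeanoNat.Nat.eqb_neq _ _).2].
Qed.
Lemma ker_madd A B : ker (Defs.madd A B) = opadd (ker A) (ker B).
Proof. by []. Qed.
Lemma ker_msub A B : ker (Defs.msub A B) = fun x y => ker A x y - ker B x y.
Proof. by []. Qed.
Lemma ker_trace A : toC (Defs.trace n A) = optr (ker A).
Proof. by rewrite /Defs.trace Csum_ord (sum_ix (fun i => toC (A i i))). Qed.
Lemma ker_diagm l : ker (Defs.diagm l) = dgm (fun x => l (rk D x)).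
Proof.
apply: op_ext => x y; rewrite /ker /Defs.diagm /dgm -(inj_eq rk_inj).
have [e|/eqP e] := eqVneq (rk D x) (rk D y).
  by rewrite (PeanoNat.Nat.eqb_eq _ _).2 // mul1r.
by rewrite (PeanoNat.Nat.eqb_neq _ _).2 // mul0r.
Qed.
Lemma kerv_mapply A v : kerv (Defs.mapply n A v) = app (ker A) (kerv v).
Proof.
apply/funext => x; rewrite /kerv /Defs.mapply Csum_ord.
by rewrite (sum_ix (fun i => toC (Defs.Cmul (A (rk D x) i) (v i)))).
Qed.
Lemma ker_hermitian A : Defs.hermitian n A <-> opherm (ker A).
Proof.
rewrite /Defs.hermitian ker_meq ker_adj; split=> [h x y|h]; first by rewrite {1}h.
by apply: op_ext => x y; apply: h.
Qed.
Lemma ker_unitary U : Defs.unitary n U <-> opunitary (ker U).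
Proof. by rewrite /Defs.unitary !ker_meq !ker_mmul ker_mid ker_adj. Qed.
Lemma ker_commute A B : Defs.commute n A B <-> opmul (ker A) (ker B) = opmul (ker B) (ker A).
Proof. by rewrite /Defs.commute ker_meq !ker_mmul. Qed.
Lemma Re_toC z : complex.Re (toC z) = Defs.Re z. Proof. by []. Qed.
Lemma quad_dot A v : Defs.Re (Defs.Csum n (fun i => Defs.Cmul (Defs.Cconj (v i)) (Defs.mapply n A v i))) =
  complex.Re (dot (kerv v) (app (ker A) (kerv v))).
Proof.
rewrite -Re_toC Csum_ord (sum_ix (fun i => toC (Defs.Cmul (Defs.Cconj (v i)) (Defs.mapply n A v i)))).
by rewrite -kerv_mapply.
Qed.
Lemma ker_psd A : Defs.psd n A <-> oppsd (ker A).
Proof.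
rewrite /Defs.psd ker_hermitian /oppsd; split=> -[hA h]; split=> // v.
  by have := h (vec v); rewrite quad_dot vecK => /RleP.
by apply/RleP; rewrite quad_dot.
Qed.
Lemma ker_state A : Defs.is_state n A <-> oppsd (ker A) /\ optr (ker A) = 1.
Proof.
rewrite /Defs.is_state ker_psd -ker_trace; split=> -[h1 h2]; split=> //.
  by rewrite h2.
exact: toC_inj.
Qed.

Lemma vnormE v : Defs.vnorm n v = Num.sqrt (norm2 (kerv v)).
Proof.
rewrite /Defs.vnorm RsqrtE Rsum_ord; congr Num.sqrt.
rewrite (sum_ix (fun i => Defs.Re (Defs.Cmul (Defs.Cconj (v i)) (v i)))).
by apply: eq_bigr => x _; rewrite -Re_toC toC_mul toC_conj mulJc.
Qed.

(** The square root is picked by a choice operator. The spectral theorem shows that there is one to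
    pick, and the nuclear bounds hold for any positive root, so this is all that has to be known of
    it. *)
Lemma trace_norm_spec X : exists P : I -> I -> C,
  [/\ oppsd P, opmul P P = opmul (opadj (ker X)) (ker X) & Defs.trace_norm n X = complex.Re (optr P)].
Proof.
have [P [hP eP]] := psd_sqrt (gram_psd (ker X)).
have := @ClassicalEpsilon.epsilon_spec _ (inhabits Defs.mzero)
  (fun P => Defs.psd n P /\ Defs.meq n (Defs.mmul n P P) (Defs.mmul n (Defs.adj X) X)).
rewrite -/(Defs.msqrt n _) => /(_ _)[].
  exists (mat P); rewrite ker_psd matK; split=> //.
  by rewrite ker_meq !ker_mmul matK ker_adj.
rewrite ker_psd ker_meq !ker_mmul ker_adj => h1 h2.
exists (ker (Defs.msqrt n (Defs.mmul n (Defs.adj X) X))); split=> //.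
by rewrite /Defs.trace_norm -Re_toC ker_trace.
Qed.

Lemma trace_norm_le X e : nuc (ker X) e -> Defs.trace_norm n X <= e.
Proof. by have [P [h1 h2 ->]] := trace_norm_spec X; apply: nuc_le_trace. Qed.
Lemma nuc_trace_norm_mat X : nuc (ker X) (Defs.trace_norm n X).
Proof. by have [P [h1 h2 ->]] := trace_norm_spec X; apply: nuc_trace_norm. Qed.
Lemma trace_norm_ge0 X : 0 <= Defs.trace_norm n X.
Proof.
have [P [/psd_spectral[v [p [hv -> p0]]] _ ->]] := trace_norm_spec X.
by rewrite optr_mix /=; apply: sumr_ge0 => j _; rewrite mulr_ge0 ?norm2_ge0.
Qed.

(** A crude bound, the trace of [opmul (opadj X) X], enough for the supremum that defines the
    operator norm to exist. *)
Lemma app_bounded (X : I -> I -> C) : exists2 k, 0 <= k & forall a, norm2 (app X a) <= k * norm2 a.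
Proof.
have [v [p [hv e p0]]] := psd_spectral (gram_psd X).
exists (\sum_j p j); first by apply: sumr_ge0.
move=> a; rewrite -lecR norm2_dot -{1}(opadjK X) -dot_app -app_mul e dot_mix lecR.
rewrite mulr_suml; apply: ler_sum => j _; rewrite ler_wpM2l // -(parseval a hv).
by rewrite (bigD1 j) //= lerDl; apply: sumr_ge0 => i _; apply: abs2_ge0.
Qed.

End Indexed.

(** * Operator norm and entropy of indexed matrices *)

Section Norms.
Variables (I : finType) (n : nat) (D : indexing I n).


Let E X := fun t : R => exists v : Defs.Vec, Rdefinitions.Rle (Defs.vnorm n v) 1 /\ t = Defs.vnorm n (Defs.mapply n X v).

Lemma op_norm_lub X : Raxioms.is_lub (E X) (Defs.op_norm n X).
Proof.
apply: ClassicalEpsilon.epsilon_spec.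
have [k k0 hk] := app_bounded (ker D X).
have bE : Raxioms.bound (E X).
  exists (Num.sqrt k) => t [v [/RleP hv ->]]; apply/RleP.
  rewrite (vnormE D) (kerv_mapply D) ler_wsqrtr //; apply: le_trans (hk _) _.
  rewrite ler_piMr //; move: hv; rewrite (vnormE D) -{1}sqrtr1 ler_sqrt //.
have nE : exists t, E X t.
  exists (Defs.vnorm n (Defs.mapply n X (fun=> Defs.C0))), (fun=> Defs.C0); split=> //.
  apply/RleP; rewrite (vnormE D) /kerv /norm2 big1 ?sqrtr0 ?ler01 // => x _.
  by rewrite toC_0 abs20.
by have [m hm] := Raxioms.completeness _ bE nE; exists m.
Qed.

Lemma op_norm_ub X a : norm2 a <= 1 -> Num.sqrt (norm2 (app (ker D X) a)) <= Defs.op_norm n X.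
Proof.
move=> ha; have [ub _] := op_norm_lub X; apply/RleP/ub; exists (vec D a); split.
  by apply/RleP; rewrite (vnormE D) vecK -sqrtr1 ler_wsqrtr.
by rewrite (vnormE D) (kerv_mapply D) vecK.
Qed.

Lemma op_norm_le X c : (forall a, norm2 a <= 1 -> Num.sqrt (norm2 (app (ker D X) a)) <= c) ->
  Defs.op_norm n X <= c.
Proof.
move=> h; have [_ lub] := op_norm_lub X; apply/RleP/lub => t [v [/RleP hv ->]]; apply/RleP.
rewrite (vnormE D) (kerv_mapply D); apply: h.
by move: hv; rewrite (vnormE D) -{1}sqrtr1 ler_sqrt.
Qed.

Lemma op_norm_ge0 X : 0 <= Defs.op_norm n X.
Proof.
have h0 : norm2 (fun _ : I => 0 : C) <= 1.
  by rewrite /norm2 big1 ?ler01 // => x _; rewrite abs20.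
exact: le_trans (sqrtr_ge0 _) (op_norm_ub X h0).
Qed.

Lemma op_norm_dgm X (h : I -> R) c : ker D X = dgm h -> 0 <= c ->
  (forall x, `|h x| <= c) -> Defs.op_norm n X <= c.
Proof.
move=> e c0 hc; apply: op_norm_le => a ha; rewrite e.
rewrite -[leRHS]ger0_norm // -sqrtr_sqr ler_wsqrtr //.
apply: (@le_trans _ _ (c ^+ 2 * norm2 a)); last by rewrite ler_piMr ?sqr_ge0.
rewrite /norm2 mulr_sumr; apply: ler_sum => x _; rewrite app_dgm abs2M abs2_real.
rewrite ler_wpM2r ?abs2_ge0 // -[leLHS]real_normK ?num_real //.
by rewrite lerXn2r ?nnegrE.
Qed.

Lemma op_norm_app X a : norm2 (app (ker D X) a) <= Defs.op_norm n X ^+ 2 * norm2 a.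
Proof.
have [a0|a0] := eqVneq (norm2 a) 0.
  have -> : a = fun=> 0 by apply/funext => x; apply: norm2_eq0.
  rewrite /norm2 big1 => [|x _]; first by rewrite mulr_ge0 ?sqr_ge0 // norm2_ge0.
  by rewrite /app big1 ?abs20 // => y _; rewrite mulr0.
have {}a0 : 0 < norm2 a by rewrite lt_neqAle eq_sym a0 norm2_ge0.
pose k := (Num.sqrt (norm2 a))^-1.
have k2 : k ^+ 2 = (norm2 a)^-1 by rewrite exprVn sqr_sqrtr // ltW.
have h : norm2 (fun x => k%:C * a x) <= 1.
  by rewrite norm2Z abs2_real k2 mulVf // gt_eqF.
have := op_norm_ub X h.
have -> : app (ker D X) (fun x => k%:C * a x) = fun x => k%:C * app (ker D X) a x.
  by apply/funext => x; rewrite /app mulr_sumr; apply: eq_bigr => y _; ring.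
rewrite norm2Z abs2_real k2 => le.
have := lerXn2r 2 (sqrtr_ge0 _) (op_norm_ge0 X) le.
by rewrite sqr_sqrtr ?mulr_ge0 ?norm2_ge0 // ?invr_ge0 ?norm2_ge0 // ler_pdivrMl // mulrC.
Qed.

(** AM-GM after weighting the two factors by the square root [k] of the norm and by its inverse.
    This turns the operator norm into the bilinear bound used in [conversion]. *)
Lemma op_norm_form X a b :
  `|complex.Re (dot b (app (ker D X) a))| <= Defs.op_norm n X * (norm2 a + norm2 b) / 2.
Proof.
set o := Defs.op_norm n X; have o0 : 0 <= o := op_norm_ge0 X.
have hX := op_norm_app X a; rewrite -/o in hX.
have [z|nz] := eqVneq o 0.
  rewrite z mul0r mul0r; rewrite z expr0n mul0r in hX.
  have h0 x : app (ker D X) a x = 0.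
    by apply: norm2_eq0; apply/eqP; rewrite eq_le hX norm2_ge0.
  by rewrite /dot big1 ?normr0 // => x _; rewrite h0 mulr0.
have {}o0 : 0 < o by rewrite lt_neqAle eq_sym nz.
pose k := Num.sqrt o.
have k2 : k ^+ 2 = o by rewrite sqr_sqrtr // ltW.
have k0 : k != 0 by rewrite sqrtr_eq0 -ltNge.
apply: (@le_trans _ _ (\sum_x (o * abs2 (b x) + o^-1 * abs2 (app (ker D X) a x)) / 2)).
  rewrite Re_sum; apply: le_trans (ler_norm_sum _ _ _) _; apply: ler_sum => x _.
  have -> : cj (b x) * app (ker D X) a x = (k%:C * cj (b x)) * ((k^-1)%:C * app (ker D X) a x).
    rewrite mulrACA -rcM mulfV // mul1r //.
  apply: le_trans (ReMle _ _) _; rewrite !abs2M !abs2_real abs2J exprVn k2 //.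
rewrite -mulr_suml big_split /= -!mulr_sumr -/(norm2 b) -/(norm2 (app (ker D X) a)).
rewrite ler_pM2r ?invr_gt0 // mulrDr addrC lerD // ler_pdivrMl // mulrA -expr2; exact: hX.
Qed.

Lemma unitary_onb (U : I -> I -> C) : opunitary U -> onb (fun j y => U y j).
Proof.
case=> u1 u2; split=> [i j|x y].
  by have := congr1 (fun X => X i j) u1.
by have := congr1 (fun X => X x y) u2.
Qed.

Lemma eta_ln (x : R) : Defs.eta x = x * ln x.
Proof.
rewrite /Defs.eta; case: RIneq.Req_EM_T => [->|_]; first by rewrite mul0r.
by rewrite RlnE.
Qed.

Lemma opconj_dgm (V : I -> I -> C) l : opconj V (dgm l) = mix l (fun j y => V y j).
Proof.
rewrite dgm_mix opconj_mix; congr mix; apply/funext => j; apply/funext => y.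
by rewrite /app /unit_vec; under eq_bigr do rewrite mulrC; rewrite (sum_delta (fun z => V y z)).
Qed.

(** The eigenbasis is the one that belongs to the chosen [eigvals], so the same weights [r] describe
    the state and its entropy; their sign is read off from the positivity of the state. *)
Lemma entropy_spec A : Defs.is_state n A -> exists r e,
  [/\ onb e, ker D A = mix r e, forall x, 0 <= r x, \sum_x r x = 1 &
      Defs.vN_entropy n A = shannon r].
Proof.
move=> /(ker_state D)[pA tA].
have spec : exists l, exists V, Defs.unitary n V /\
    Defs.meq n A (Defs.mmul n (Defs.mmul n V (Defs.diagm l)) (Defs.adj V)).
  have [v [p [hv e _]]] := psd_spectral pA.
  exists (fun i => p (ix D i)), (mat D (fun y j => v j y)).
  rewrite (ker_unitary D) (ker_meq D) !ker_mmul ker_adj ker_diagm matK; split.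
    exact: onb_unitary.
  rewrite -/(opconj _ _) opconj_dgm e; congr mix; apply/funext => x; by rewrite rkK.
have := ClassicalEpsilon.epsilon_spec (inhabits (fun _ : nat => 0 : R)) _ spec.
rewrite -/(Defs.eigvals n A) => -[V []].
rewrite (ker_unitary D) (ker_meq D) !ker_mmul ker_adj ker_diagm -/(opconj _ _) opconj_dgm.
move=> /unitary_onb hV eA; pose r x := Defs.eigvals n A (rk D x).
have rE x : r x = complex.Re (dot (ker D V ^~ x) (app (ker D A) (ker D V ^~ x))).
  rewrite eA app_mix_onb // /dot.
  have -> : \sum_y cj (ker D V y x) * ((r x)%:C * ker D V y x) = (r x)%:C * dot (ker D V ^~ x) (ker D V ^~ x).
    by rewrite /dot mulr_sumr; apply: eq_bigr => y _; ring.
  by rewrite (proj1 hV) eqxx mulr1.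
exists r, (fun j y => ker D V y j); split=> //.
- by move=> x; rewrite rE; apply: (proj2 pA).
- have := congr1 (@complex.Re R) tA; rewrite eA optr_mix /= => <-.
  by apply: eq_bigr => x _; rewrite (onb_norm2 x hV) mulr1.
rewrite /Defs.vN_entropy Rsum_ord (sum_ix D (fun i => Defs.eta (Defs.eigvals n A i))) /shannon.
rewrite RoppE -sumrN; apply: eq_bigr => x _; by rewrite eta_ln mulrN.
Qed.
End Norms.

Section Indexings.
Lemma unit_ixK i : (i < 1)%N -> 0%N = i. Proof. by case: i. Qed.
Definition unit_indexing : indexing unit 1 :=
  @Indexing unit 1 (fun=> tt) (fun=> 0%N) (fun=> isT) (fun x => match x with tt => erefl end) unit_ixK.

Definition ord_ix d (d0 : (0 < d)%N) (i : nat) : 'I_d := odflt (Ordinal d0) (insub i).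
Lemma ord_rkK d (d0 : (0 < d)%N) (x : 'I_d) : ord_ix d0 x = x.
Proof. by rewrite /ord_ix valK. Qed.
Lemma ord_ixK d (d0 : (0 < d)%N) i : (i < d)%N -> ord_ix d0 i = i :> nat.
Proof. by move=> h; rewrite /ord_ix insubT. Qed.
Definition ord_indexing d (d0 : (0 < d)%N) : indexing 'I_d d :=
  Indexing (@ltn_ord d) (ord_rkK d0) (ord_ixK d0).

Section Fin.
Variables (T : finType) (t0 : T).
Definition fin_ix i := nth t0 (enum T) i.
Definition fin_rk (x : T) : nat := enum_rank x.
Lemma fin_rk_lt x : (fin_rk x < #|T|)%N. Proof. exact: ltn_ord. Qed.
Lemma fin_rkK x : fin_ix (fin_rk x) = x. Proof. exact: nth_enum_rank. Qed.
Lemma fin_ixK i : (i < #|T|)%N -> fin_rk (fin_ix i) = i.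
Proof.
move=> h; rewrite /fin_rk /fin_ix  -(enum_val_nth t0 (Ordinal h)).
by rewrite enum_valK.
Qed.
Definition fin_indexing : indexing T #|T| := Indexing fin_rk_lt fin_rkK fin_ixK.
End Fin.

Section Prod.
Variables (I J : finType) (n m : nat) (D : indexing I n) (F : indexing J m).
Definition prod_ix (k : nat) : I * J := (ix D (PeanoNat.Nat.div k m), ix F (PeanoNat.Nat.modulo k m)).
Definition prod_rk (z : I * J) : nat := Nat.add (Nat.mul (rk D z.1) m) (rk F z.2).

Lemma prod_div z : PeanoNat.Nat.div (prod_rk z) m = rk D z.1.
Proof.
have h := rk_lt F z.2; rewrite /prod_rk PeanoNat.Nat.div_add_l; last by lia.
by rewrite PeanoNat.Nat.div_small; [rewrite PeanoNat.Nat.add_0_r | apply/ssrnat.ltP].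
Qed.
Lemma prod_mod z : PeanoNat.Nat.modulo (prod_rk z) m = rk F z.2.
Proof.
have h := rk_lt F z.2; rewrite /prod_rk PeanoNat.Nat.add_comm PeanoNat.Nat.Div0.mod_add.
by rewrite PeanoNat.Nat.mod_small //; apply/ssrnat.ltP.
Qed.
Lemma prod_rk_lt z : (prod_rk z < Nat.mul n m)%N.
Proof. have h := rk_lt F z.2; have h' := rk_lt D z.1; rewrite /prod_rk; apply/ssrnat.ltP; nia. Qed.
Lemma prod_rkK z : prod_ix (prod_rk z) = z.
Proof. by rewrite /prod_ix prod_div prod_mod !rkK; case: z. Qed.
Lemma prod_ixK k : (k < Nat.mul n m)%N -> prod_rk (prod_ix k) = k.
Proof.
move=> /ssrnat.ltP h; have m0 : m <> 0%N by move=> m0; move: h; rewrite m0; lia.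
rewrite /prod_rk /prod_ix /= !ixK; last 2 first.
- by apply/ssrnat.ltP; apply: PeanoNat.Nat.mod_upper_bound.
- by apply/ssrnat.ltP; apply: PeanoNat.Nat.Div0.div_lt_upper_bound; rewrite PeanoNat.Nat.mul_comm.
by rewrite PeanoNat.Nat.mul_comm -PeanoNat.Nat.div_mod.
Qed.
Definition prod_indexing : indexing (I * J)%type (Nat.mul n m) := Indexing prod_rk_lt prod_rkK prod_ixK.

Lemma ker_kron p A B : ker prod_indexing (Defs.kron p m A B) = optens (ker D A) (ker F B).
Proof.
by apply: op_ext => x y; rewrite /ker /= /Defs.kron !prod_div !prod_mod toC_mul.
Qed.
End Prod.

Fixpoint pw_indexing d (D : indexing 'I_d d) n : indexing (pw 'I_d n) (PeanoNat.Nat.pow d n) :=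
  match n with
  | O => unit_indexing
  | S n' => prod_indexing D (pw_indexing D n')
  end.

Lemma ker_kpow d (D : indexing 'I_d d) n A :
  ker (pw_indexing D n) (Defs.kpow d n A) = tpow (ker D A) (n := n).
Proof.
elim: n => [|n IH]; first by apply: op_ext => -[] [].
by rewrite /= ker_kron IH.
Qed.

Lemma ker_msum (I : finType) n (D : indexing I n) m F :
  ker D (Defs.msum m F) = fun x y => \sum_(i < m) ker D (F i) x y.
Proof.
elim: m => [|m IH]; apply: op_ext => x y; first by rewrite big_ord0.
by rewrite big_ord_recr /= ker_madd /opadd IH.
Qed.

(** An index of [n + 1] copies is [x0 d^n + x]. Since [d^n] is [d^i] times [Q], the leading digit
    [x0] survives only in the quotient by [Q], where the identity factor splits. *)
Lemma kron_mid_split (d n i x0 y0 x y : nat) (M : Defs.Mat) : (i < n)%N -> (0 < d)%N ->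
  (x < PeanoNat.Nat.pow d n)%N -> (y < PeanoNat.Nat.pow d n)%N ->
  let Q := Nat.mul d (PeanoNat.Nat.pow d (n - 1 - i)) in
  toC (Defs.kron (PeanoNat.Nat.pow d i.+1) Q Defs.mid M (Nat.add (Nat.mul x0 (PeanoNat.Nat.pow d n)) x)
     (Nat.add (Nat.mul y0 (PeanoNat.Nat.pow d n)) y)) =
  toC (Defs.mid x0 y0) * toC (Defs.kron (PeanoNat.Nat.pow d i) Q Defs.mid M x y).
Proof.
move=> hi d0 hx hy Q.
have eQ : PeanoNat.Nat.pow d n = Nat.mul (PeanoNat.Nat.pow d i) Q.
  rewrite /Q -PeanoNat.Nat.pow_succ_r' -PeanoNat.Nat.pow_add_r; congr PeanoNat.Nat.pow; lia.
have Q0 : Q <> 0%N by rewrite /Q => /PeanoNat.Nat.mul_eq_0[|/PeanoNat.Nat.pow_nonzero]; lia.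
have div z0 z : PeanoNat.Nat.div (Nat.add (Nat.mul z0 (PeanoNat.Nat.pow d n)) z) Q =
    Nat.add (Nat.mul z0 (PeanoNat.Nat.pow d i)) (PeanoNat.Nat.div z Q).
  by rewrite eQ PeanoNat.Nat.mul_assoc PeanoNat.Nat.div_add_l.
have mod z0 z : PeanoNat.Nat.modulo (Nat.add (Nat.mul z0 (PeanoNat.Nat.pow d n)) z) Q = PeanoNat.Nat.modulo z Q.
  by rewrite eQ PeanoNat.Nat.mul_assoc PeanoNat.Nat.add_comm PeanoNat.Nat.Div0.mod_add.
have lt z : (z < PeanoNat.Nat.pow d n)%N -> (PeanoNat.Nat.div z Q < PeanoNat.Nat.pow d i)%coq_nat.
  move=> /ssrnat.ltP h; apply: PeanoNat.Nat.Div0.div_lt_upper_bound.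
  by rewrite PeanoNat.Nat.mul_comm -eQ.
rewrite /Defs.kron !div !mod !toC_mul mulrA; congr (_ * _).
have := lt _ hx; have := lt _ hy.
set u := PeanoNat.Nat.div x Q; set v := PeanoNat.Nat.div y Q; set P := PeanoNat.Nat.pow d i => hv hu.
rewrite /Defs.mid.
case: (PeanoNat.Nat.eqb_spec x0 y0) => [->|ne].
  case: (PeanoNat.Nat.eqb_spec u v) => [->|ne']; first by rewrite PeanoNat.Nat.eqb_refl mul1r.
  by rewrite (PeanoNat.Nat.eqb_neq _ _).2 ?mul1r //; lia.
by rewrite (PeanoNat.Nat.eqb_neq _ _).2 ?mul0r //; nia.
Qed.

(** The term at position [0] is the charge on the first copy; the term at position [i + 1] is the
    identity on that copy times position [i] of the others, by [kron_mid_split]. *)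
Lemma ker_ncopy d (D : indexing 'I_d d) n L : (0 < d)%N ->
  ker (pw_indexing D n) (Defs.ncopy d n L) = opsum (ker D L) (n := n).
Proof.
move=> d0; elim: n => [|n IH]; first by apply: op_ext => -[] [].
rewrite /Defs.ncopy ker_msum; apply: op_ext => x y; rewrite big_ord_recl.
have e0 : Nat.sub (Nat.sub n.+1 1) (ord0 : 'I_n.+1) = n by rewrite /=; lia.
rewrite [RHS]/= /opadd e0; congr (_ + _).
  have -> : optens (ker D L) (@opid R (pw 'I_d n)) x y =
      ker (pw_indexing D n.+1) (Defs.kron d (PeanoNat.Nat.pow d n) L Defs.mid) x y.
    by rewrite /= ker_kron ker_mid.
  have small (z : pw 'I_d n.+1) : (rk (pw_indexing D n.+1) z < Nat.mul d (PeanoNat.Nat.pow d n))%coq_nat.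
    by apply/ssrnat.ltP; have := rk_lt (pw_indexing D n.+1) z.
  rewrite /ker {1}/Defs.kron !(PeanoNat.Nat.div_small _ _ (small _)) !(PeanoNat.Nat.mod_small _ _ (small _)).
  by rewrite toC_mul mul1r.
rewrite -IH /Defs.ncopy ker_msum /optens mulr_sumr; apply: eq_bigr => i _.
have ei : Nat.sub (Nat.sub n.+1 1) (lift ord0 i) = Nat.sub (Nat.sub n 1) i.
  by rewrite lift0; lia.
rewrite ei -(ker_mid D) /ker.
exact: (kron_mid_split _ _ _ (ltn_ord i) d0 (rk_lt _ _) (rk_lt _ _)).
Qed.
End Indexings.

(** * The equivalence *)

Section OneLength.
Variables (d q : nat) (L : nat -> Defs.Mat) (rho sigma : Defs.Mat).
Hypotheses (d0 : (0 < d)%N).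
Let D := ord_indexing d0.

Variables (w : 'I_d -> 'I_d -> C) (l : 'I_q -> 'I_d -> R).
Variables (r s : 'I_d -> R) (e f : 'I_d -> 'I_d -> C).
Hypotheses (hw : onb w) (eL : forall k : 'I_q, ker D (L k) = mix (l k) w).
Hypotheses (erho : ker D rho = mix r e) (esigma : ker D sigma = mix s f).

Let total_mat n m (Lp : Defs.Mat) k := Defs.madd
  (Defs.kron (PeanoNat.Nat.pow d n) m (Defs.ncopy d n (L k)) Defs.mid)
  (Defs.kron (PeanoNat.Nat.pow d n) m Defs.mid Lp).

Let error_mat n m (U om om' : Defs.Mat) := Defs.msub
  (Defs.mmul (Nat.mul (PeanoNat.Nat.pow d n) m)
    (Defs.mmul (Nat.mul (PeanoNat.Nat.pow d n) m) U
      (Defs.kron (PeanoNat.Nat.pow d n) m (Defs.kpow d n rho) om'))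
    (Defs.adj U))
  (Defs.kron (PeanoNat.Nat.pow d n) m (Defs.kpow d n sigma) om).

Lemma ker_total (T : finType) n m (F : indexing T m) Lp (k : 'I_q) :
  ker (prod_indexing (pw_indexing D n) F) (total_mat n m Lp k) =
  opadd (optens (opsum (mix (l k) w) (n := n)) (@opid R T)) (optens (@opid R (pw 'I_d n)) (ker F Lp)).
Proof. by rewrite ker_madd !ker_kron ker_ncopy // eL !ker_mid. Qed.

Lemma ker_error (T : finType) n m (F : indexing T m) U om om' :
  ker (prod_indexing (pw_indexing D n) F) (error_mat n m U om om') =
  fun x y => opconj (ker (prod_indexing (pw_indexing D n) F) U)
      (optens (tpow (mix r e) (n := n)) (ker F om')) x y
    - optens (tpow (mix s f) (n := n)) (ker F om) x y.
Proof.
by rewrite ker_msub !ker_mmul ker_adj !ker_kron !ker_kpow erho esigma.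
Qed.

Lemma trace_charge A v g (k : 'I_q) : ker D A = mix v g ->
  toC (Defs.trace d (Defs.mmul d (L k) A)) =
  (\sum_y diag_weight v (rotate w g) y * l k y)%:C.
Proof. by move=> eA; rewrite (ker_trace D) ker_mmul eL eA trace_rotate. Qed.

(** The data for one length are bundled into a single tuple, so that sequences in [n] can be
    extracted by one application of choice. *)
Lemma forward_step n eps : 0 <= eps ->
  protocol l r s (rotate w e) (rotate w f) n eps ->
  exists t : nat * (nat -> Defs.Mat) * Defs.Mat * Defs.Mat,
    let: (m, Lp, om, U) := t in
    [/\ Defs.is_state m om,
        forall k, (k < q)%N -> Defs.hermitian m (Lp k) /\
           0 <= Defs.op_norm m (Lp k) <= eps * n%:R /\
           Defs.commute (Nat.mul (PeanoNat.Nat.pow d n) m) U (total_mat n m (Lp k) k),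
        0 <= ln (m%:R : R) <= eps * n%:R,
        Defs.unitary (Nat.mul (PeanoNat.Nat.pow d n) m) U &
        0 <= Defs.trace_norm (Nat.mul (PeanoNat.Nat.pow d n) m) (error_mat n m U om om) <= eps].
Proof.
move=> eps0 /(protocol_rotate hw)[T [om [h [U [h1 h2 h3 [h4 h5] h6]]]]].
(* Trace one excludes an empty ancilla. *)
have [t0 _|T0] := pickP (xpredT : pred T); last first.
  have : (1 : C) = 0 by rewrite -h3.2 /optr big1 // => x _; have := T0 x.
  by move/eqP; rewrite oner_eq0.
pose F := fin_indexing t0; pose P := prod_indexing (pw_indexing D n) F.
(* The matrices are indexed by all naturals; beyond [q] they are set to zero. *)
pose hm k := if insub k is Some k' then dgm (h k') else fun _ _ => 0.
have hmE (k : 'I_q) : hm k = dgm (h k) by rewrite /hm valK.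
exists (#|T|, fun k => mat F (hm k), mat F om, mat P U); split.
- by rewrite (ker_state F) matK.
- move=> k kq; rewrite -[k]/(nat_of_ord (Ordinal kq)) hmE; split; [|split].
  + by rewrite (ker_hermitian F) matK dgm_mix; apply: mix_herm.
  + rewrite (op_norm_ge0 F); apply: (op_norm_dgm (D := F)); first exact: matK.
      by rewrite mulr_ge0.
    exact: h2.
  + by rewrite (ker_commute P) ker_total !matK.
- by rewrite h1 andbT ln_ge0 // ler1n; apply/card_gt0P; exists t0.
- by rewrite (ker_unitary P) matK.
by rewrite (trace_norm_ge0 P) /=; apply: (trace_norm_le (D := P)); rewrite ker_error !matK.
Qed.

Lemma converse_step n eps m (Lp : nat -> Defs.Mat) om om' U :
  Defs.is_state m om -> Defs.is_state m om' ->
  (forall k, (k < q)%N -> Defs.op_norm m (Lp k) <= eps * n%:R /\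
     Defs.commute (Nat.mul (PeanoNat.Nat.pow d n) m) U (total_mat n m (Lp k) k)) ->
  ln (m%:R : R) <= eps * n%:R ->
  Defs.unitary (Nat.mul (PeanoNat.Nat.pow d n) m) U ->
  Defs.trace_norm (Nat.mul (PeanoNat.Nat.pow d n) m) (error_mat n m U om om') <= eps ->
  conversion l r (rotate w e) s (rotate w f) n eps.
Proof.
move=> hom hom' hL hm hU ht.
(* In dimension zero the trace would be 0 and not 1. *)
have m0 : (0 < m)%N.
  rewrite lt0n; apply/eqP => m0; move: hom => [_]; rewrite m0 => /(congr1 toC).
  by move/eqP; rewrite toC_1 eq_sym oner_eq0.
pose F := ord_indexing m0; pose P := prod_indexing (pw_indexing D n) F.
have [p1 t1] := (ker_state F om).1 hom; have [p2 t2] := (ker_state F om').1 hom'.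
apply: (conversion_rotate (T := 'I_m) (omega := ker F om) (omega' := ker F om')
   (L := fun k : 'I_q => ker F (Lp k)) (U := ker P U) hw) => //.
- by rewrite card_ord.
- move=> k a b; apply: le_trans (op_norm_form F (Lp k) a b) _.
  rewrite ler_pM2r ?invr_gt0 // ler_wpM2r ?addr_ge0 ?norm2_ge0 //.
  by have [] := hL k (ltn_ord k).
- exact/ker_unitary.
- move=> k; have [_ /(ker_commute P)] := hL k (ltn_ord k).
  by rewrite ker_total.
apply: nuc_le ht; have := nuc_trace_norm_mat P (error_mat n m U om om').
by rewrite ker_error.
Qed.
End OneLength.

(** One threshold per charge, finitely many in all, so a common one exists. *)
Lemma uniform_rank q (Q : nat -> nat -> Prop) :
  (forall k, (k < q)%N -> exists N, forall n, (N <= n)%N -> Q k n) ->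
  exists N, forall n, (N <= n)%N -> forall k, (k < q)%N -> Q k n.
Proof.
elim: q => [|q IH] h; first by exists 0%N.
have [N1 h1] := IH (fun k kq => h k (leqW kq)).
have [N2 h2] := h q (ltnSn q).
exists (maxn N1 N2) => n; rewrite geq_max => /andP[n1 n2] k.
by rewrite ltnS leq_eqVlt => /predU1P[->|kq]; [apply: h2 | apply: h1].
Qed.

Lemma little_oP (g : nat -> R) : Defs.little_o_n g <->
  forall eps, 0 < eps -> exists N, forall n, (N <= n)%N -> `|g n| <= eps * n%:R.
Proof.
split=> h eps eps0.
  have [N hN] := h eps (elimT RltP eps0); exists N => n /ssrnat.leP /hN /RleP.
  by rewrite RabsE INRE.
have [|N hN] := h eps; first exact/RltP.
by exists N => n /ssrnat.leP /hN => hn; apply/RleP; rewrite RabsE INRE.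
Qed.

Lemma dim_gt0 d rho : Defs.is_state d rho -> (0 < d)%N.
Proof.
case: d => // -[_ /(congr1 toC)]; move/eqP.
by rewrite toC_1 eq_sym oner_eq0.
Qed.

Section Equivalence.
Variables (d q : nat) (L : nat -> Defs.Mat).
Hypothesis hL : forall k, (k < q)%coq_nat -> Defs.hermitian d (L k).
Hypothesis hLc : forall k l, (k < q)%coq_nat -> (l < q)%coq_nat -> Defs.commute d (L k) (L l).
Variables (rho sigma : Defs.Mat).
Hypotheses (hrho : Defs.is_state d rho) (hsigma : Defs.is_state d sigma).

Theorem asymptotic_equivalence :
  (Defs.vN_entropy d rho = Defs.vN_entropy d sigma /\
   forall k, (k < q)%coq_nat -> Defs.trace d (Defs.mmul d (L k) rho) = Defs.trace d (Defs.mmul d (L k) sigma))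
  <->
  exists (m : nat -> nat) (Lp : nat -> nat -> Defs.Mat) (omega omega' U : nat -> Defs.Mat),
    (forall n, Defs.is_state (m n) (omega n) /\ Defs.is_state (m n) (omega' n)) /\
    (forall n k, (k < q)%coq_nat -> Defs.hermitian (m n) (Lp n k)) /\
    Defs.little_o_n (fun n => Rpower.ln (Raxioms.INR (m n))) /\
    (forall k, (k < q)%coq_nat -> Defs.little_o_n (fun n => Defs.op_norm (m n) (Lp n k))) /\
    (forall n, Defs.unitary (Nat.mul (PeanoNat.Nat.pow d n) (m n)) (U n)) /\
    (forall n k, (k < q)%coq_nat ->
       Defs.commute (Nat.mul (PeanoNat.Nat.pow d n) (m n)) (U n)
         (Defs.madd (Defs.kron (PeanoNat.Nat.pow d n) (m n) (Defs.ncopy d n (L k)) Defs.mid)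
               (Defs.kron (PeanoNat.Nat.pow d n) (m n) Defs.mid (Lp n k)))) /\
    Rseries.Un_cv (fun n =>
      Defs.trace_norm (Nat.mul (PeanoNat.Nat.pow d n) (m n))
        (Defs.msub (Defs.mmul (Nat.mul (PeanoNat.Nat.pow d n) (m n))
                 (Defs.mmul (Nat.mul (PeanoNat.Nat.pow d n) (m n)) (U n)
                    (Defs.kron (PeanoNat.Nat.pow d n) (m n) (Defs.kpow d n rho) (omega' n)))
                 (Defs.adj (U n)))
              (Defs.kron (PeanoNat.Nat.pow d n) (m n) (Defs.kpow d n sigma) (omega n)))) 0.
Proof.
have d0 := dim_gt0 hrho.
pose D := ord_indexing d0.
have [w [l [hw eL]]] : exists w l, onb w /\ forall k : 'I_q, ker D (L k) = mix (l k) w.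
  apply: simultaneous_diag => [k|k k'].
    by apply/ker_hermitian/hL/ssrnat.ltP.
  by apply/ker_commute/hLc; apply/ssrnat.ltP.
have [r [e [he erho r0 r1 Sr]]] := entropy_spec D hrho.
have [s [f [hf esigma s0 s1 Ss]]] := entropy_spec D hsigma.
have hre := rotate_onb hw he; have hrf := rotate_onb hw hf.
rewrite Sr Ss; split.
- case=> eS eT.
  have M_eq (k : 'I_q) : \sum_y diag_weight r (rotate w e) y * l k y =
      \sum_y diag_weight s (rotate w f) y * l k y.
    apply: complexI; rewrite -(trace_charge eL k erho) -(trace_charge eL k esigma).
    by rewrite eT //; apply/ssrnat.ltP.
  have [eps [heps lim]] := protocol_sequence
    (fun n => protocol_trivial l n r0 r1 hre s0 s1 hrf)
    (protocol_eventually r0 r1 hre s0 s1 hrf (esym eS) M_eq).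
  have eps0 n : 0 <= eps n := (heps n).1.
  have step n := forward_step hw eL erho esigma (eps0 n) (heps n).2.
  have small c : 0 < c -> exists n0, forall n, (n0 <= n)%N -> eps n * n%:R <= c * n%:R.
    by move=> /lim[n0 hn0]; exists n0 => n /hn0 h; rewrite ler_wpM2r.
  have [t ht] := choice step.
  (* The catalyst is returned, so the same sequence is given for [omega] and [omega']. *)
  exists (fun n => (t n).1.1.1), (fun n => (t n).1.1.2), (fun n => (t n).1.2), (fun n => (t n).1.2), (fun n => (t n).2).
  split; [|split; [|split; [|split; [|split; [|split]]]]].
  + by move=> n; have := ht n; case: (t n) => [[[m Lp] om] U] /= [].
  + by move=> n k /ssrnat.ltP kq; have := ht n; case: (t n) => [[[m Lp] om] U] /= [_ /(_ k kq)[]].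
  + apply/little_oP => c /small[n0 hn0]; exists n0 => n /hn0; have := ht n.
    case: (t n) => [[[m Lp] om] U] /= [_ _ /andP[h1 h2] _ _] h.
    by rewrite INRE RlnE ger0_norm //; apply: le_trans h2 h.
  + move=> k /ssrnat.ltP kq; apply/little_oP => c /small[n0 hn0]; exists n0 => n /hn0; have := ht n.
    case: (t n) => [[[m Lp] om] U] /= [_ /(_ k kq)[_ [/andP[h1 h2] _]] _ _ _] h.
    by rewrite ger0_norm //; apply: le_trans h2 h.
  + by move=> n; have := ht n; case: (t n) => [[[m Lp] om] U] /= [].
  + by move=> n k /ssrnat.ltP kq; have := ht n; case: (t n) => [[[m Lp] om] U] /= [_ /(_ k kq)[_ []]].
  (* [Un_cv] asks for a strict inequality, hence the precision [c / 2]. *)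
  move=> c /RltP c0; have [|n0 hn0] := lim (c / 2); first by rewrite divr_gt0.
  exists n0 => n /ssrnat.leP /hn0 h; apply/RltP; rewrite RdistE subr0.
  have := ht n; case: (t n) => [[[m Lp] om] U] /= [_ _ _ _ /andP[h1 h2]].
  rewrite ger0_norm //; apply: le_lt_trans h2 (le_lt_trans h _).
  by rewrite ltr_pdivrMr // ltr_pMr // ltr1n.
move=> [m [Lp [om [om' [U [hst [hH [hm [hop [hU [hcomm hcv]]]]]]]]]]].
have cv c : 0 < c -> exists n0, forall n, (n0 <= n)%N -> conversion l r (rotate w e) s (rotate w f) n c.
  move=> c0.
  have [N1 h1] := (little_oP _).1 hm c c0.
  have [N2 h2] := uniform_rank (fun k kq => (little_oP _).1 (hop k (ssrnat.ltP kq)) c c0).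
  have [N3 h3] := hcv c (elimT RltP c0).
  exists (maxn N1 (maxn N2 N3)) => n; rewrite !geq_max => /and3P[/h1 {}h1 /h2 {}h2 /ssrnat.leP /h3 {}h3].
  apply: (converse_step (L := L) hw eL erho esigma (proj1 (hst n)) (proj2 (hst n)) (Lp := Lp n) (U := U n)).
  - move=> k kq; split; first by apply: le_trans (ler_norm _) (h2 k kq).
    by apply: hcomm; apply/ssrnat.ltP.
  - by apply: le_trans (ler_norm _) _; rewrite -RlnE -INRE.
  - exact: hU.
  by move/RltP: h3; rewrite RdistE subr0 => h3; apply: le_trans (ler_norm _) (ltW h3).
have [eS eM] := conversion_invariants r0 r1 hre s0 s1 hrf cv.
split=> // k /ssrnat.ltP kq; apply: toC_inj.
rewrite -[k]/(nat_of_ord (Ordinal kq)).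
by rewrite (trace_charge eL (Ordinal kq) erho) (trace_charge eL (Ordinal kq) esigma) eM.
Qed.
End Equivalence.

End AsymptoticEquivalence.

Require Import Defs.
From Stdlib Require Import Reals.
Open Scope R_scope.

Theorem theorem1
  (d : nat) (q : nat) (hq : (1 <= q)%nat) (L : nat -> Mat)
  (hL : forall k, (k < q)%nat -> hermitian d (L k))
  (hLc : forall k l, (k < q)%nat -> (l < q)%nat -> commute d (L k) (L l))
  (rho sigma : Mat) (hrho : is_state d rho) (hsigma : is_state d sigma) :
  (vN_entropy d rho = vN_entropy d sigma /\
   forall k, (k < q)%nat -> trace d (mmul d (L k) rho) = trace d (mmul d (L k) sigma))
  <->
  exists (m : nat -> nat) (Lp : nat -> nat -> Mat) (omega omega' U : nat -> Mat),
    (forall n, is_state (m n) (omega n) /\ is_state (m n) (omega' n)) /\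
    (forall n k, (k < q)%nat -> hermitian (m n) (Lp n k)) /\
    little_o_n (fun n => ln (INR (m n))) /\
    (forall k, (k < q)%nat -> little_o_n (fun n => op_norm (m n) (Lp n k))) /\
    (forall n, unitary (d ^ n * m n) (U n)) /\
    (forall n k, (k < q)%nat ->
       commute (d ^ n * m n) (U n)
         (madd (kron (d ^ n) (m n) (ncopy d n (L k)) mid)
               (kron (d ^ n) (m n) mid (Lp n k)))) /\
    Un_cv (fun n =>
      trace_norm (d ^ n * m n)
        (msub (mmul (d ^ n * m n)
                 (mmul (d ^ n * m n) (U n)
                    (kron (d ^ n) (m n) (kpow d n rho) (omega' n)))
                 (adj (U n)))
              (kron (d ^ n) (m n) (kpow d n sigma) (omega n)))) 0.
Proof. exact (@AsymptoticEquivalence.asymptotic_equivalence d q L hL hLc rho sigma hrho hsigma).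
Qed.
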